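(* The probability measures on $\{0,1\}^{\mathbb{Z}}$ that are both translation-invariant and stationary under the discrete-time totally asymmetric exclusion dynamics are exactly the convex combinations (mixtures) of the measures $\mu_d$, $0\le d\le 1$.
   Context: Let $\mathcal{X}=\{0,1\}^{\mathbb{Z}}$ with the Borel $\sigma$-algebra generated by cylinder sets. The dynamics: from state $x$, for each $i$ with $x_i=1,x_{i+1}=0$ independently with probability $1/2$ replace $(x_i,x_{i+1})$ by $(0,1)$, otherwise leave it; other coordinates unchanged; this gives a random $x'$. A probability measure $\mu$ is stationary if, when $x\sim\mu$, also $x'\sim\mu$; it is translation-invariant if it is invariant under the shift $(Tx)_i=x_{i+1}$. For $0\le d\le1$ put $s=\sqrt{d^2+(1-d)^2}$, $p(0)=1-d$, $p(1)=d$, $q(0,0)=\frac{s-d}{1-d}$, $q(0,1)=\frac{1-s}{1-d}$, $q(1,0)=\frac{1-s}{d}$, $q(1,1)=\frac{s-(1-d)}{d}$ (values at $d=0,1$ by continuity). $\mu_d$ is the unique translation-invariant probability measure on $\mathcal X$ with $\mu_d(\{x: x_0=b_0,\dots,x_k=b_k\})=p(b_0)q(b_0,b_1)\cdots q(b_{k-1},b_k)$ for all $k\ge1$ and $b_0,\dots,b_k\in\{0,1\}$ (a stationary Markov measure). Convex combinations are meant in the sense $\int_0^1\mu_d\,\rho(dd)$ for probability measures $\rho$ on $[0,1]$. *)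

(* Defs.v *)
From HB Require Import structures.
From mathcomp Require Import all_boot all_order all_algebra.
From mathcomp Require Import all_classical all_reals all_analysis.
From mathcomp Require Import ring lra.

Set Implicit Arguments.
Unset Strict Implicit.
Unset Printing Implicit Defensive.

Import Order.TTheory GRing.Theory Num.Theory.
Import numFieldNormedType.Exports.

Local Open Scope classical_set_scope.
Local Open Scope ring_scope.

Definition cylinders : set (set (int -> bool)) :=
  [set A | exists (s : seq int) (b : int -> bool),
     A = [set x | forall i, i \in s -> x i = b i]].

(* The measurable space {0,1}^Z; [true] stands for 1, i.e. an occupied site. *)
Definition config := g_sigma_algebraType cylinders.

Definition shift (x : config) : config := fun i => x (i + 1).

(* [w i] is the coin tossed for the pair (i, i+1); coins attached to pairs
   other than (1,0) are ignored. *)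
Definition jumps (x w : config) (i : int) : bool :=
  [&& x i, ~~ x (i + 1) & w i].

Definition step (x w : config) : config := fun i =>
  if jumps x w i then false else if jumps x w (i - 1) then true else x i.

Lemma measurable_coord (i : int) (b : bool) :
  measurable [set x : config | x i = b].
Proof.
apply: sub_sigma_algebra; exists [:: i], (fun=> b).
apply/seteqP; split => x /=; first by move=> xi j; rewrite inE => /eqP ->.
by apply; rewrite inE.
Qed.

Lemma measurable_to_config d (T : measurableType d) (f : T -> config) :
  (forall i, measurable (f @^-1` [set x : config | x i = true])) ->
  measurable_fun setT f.
Proof.
move=> mf.
have mfb i b : measurable (f @^-1` [set x : config | x i = b]).
  case: b; first exact: mf.
  rewrite (_ : _ @^-1` _ = ~` (f @^-1` [set x : config | x i = true])).
    exact/measurableC/mf.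
  by apply/seteqP; split => x /=; case: (f x i).
apply: (@measurability _ _ _ _ setT f cylinders) => //.
move=> _ [_ [s [b ->]] <-]; rewrite setTI.
elim: s => [|i s IHs].
  rewrite (_ : _ @^-1` _ = setT); first exact: measurableT.
  by apply/seteqP; split.
rewrite (_ : _ @^-1` _ = (f @^-1` [set x : config | x i = b i]) `&`
   (f @^-1` [set x | forall j, j \in s -> x j = b j])).
  exact: measurableI.
apply/seteqP; split => x /=.
  by move=> H; split=> [|j js]; apply: H; rewrite inE ?eqxx ?js ?orbT.
by move=> [Hi Hs] j; rewrite inE => /predU1P[->//|]; exact: Hs.
Qed.

Lemma measurable_shift : measurable_fun setT shift.
Proof. by apply: measurable_to_config => i; exact: measurable_coord. Qed.

Lemma measurable_step :
  measurable_fun setT (fun z : config * config => step z.1 z.2).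
Proof.
have mx i b : measurable [set z : config * config | z.1 i = b].
  rewrite (_ : [set z | _] = [set x : config | x i = b] `*` setT).
    exact: measurableX (measurable_coord i b) measurableT.
  by apply/seteqP; split => z /=; [|case].
have mw i b : measurable [set z : config * config | z.2 i = b].
  rewrite (_ : [set z | _] = setT `*` [set x : config | x i = b]).
    exact: measurableX measurableT (measurable_coord i b).
  by apply/seteqP; split => z /=; [|case].
have mj i : measurable [set z : config * config | jumps z.1 z.2 i].
  rewrite (_ : [set z | _] = [set z | z.1 i = true] `&`
     ([set z | z.1 (i + 1) = false] `&` [set z | z.2 i = true])).
    by apply: measurableI; [|apply: measurableI].
  by apply/seteqP; split => z /=; rewrite /jumps;
    case: (z.1 i) (z.1 (i + 1)) (z.2 i) => [] [] [] //= [] // _ [].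
apply: measurable_to_config => i.
rewrite (_ : _ @^-1` _ = (~` [set z | jumps z.1 z.2 i]) `&`
  ([set z | jumps z.1 z.2 (i - 1)] `|` [set z | z.1 i = true])).
  by apply: measurableI; [exact: measurableC|exact: measurableU].
apply/seteqP; split => z /=; rewrite /step.
  by case: (jumps _ _ i) => //; case: (jumps _ _ (i - 1)) => // H;
    split => //; auto.
by move=> [/negP/negbTE ->]; case: (jumps _ _ (i - 1)) => //= -[].
Qed.

Definition translation_invariant (R : realType) (mu : probability config R) :=
  forall A : set config, measurable A -> pushforward mu shift A = mu A.

Definition fair_coins (R : realType) (P : probability config R) :=
  forall (s : seq int) (b : int -> bool), uniq s ->
    P [set w : config | forall i, i \in s -> w i = b i] =
      ((2^-1 : R) ^+ size s)%:E.

(* The law of the coins is unique by Dynkin's pi-lambda theorem, and the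
   product measure makes them independent of the current state. *)
Definition stationary (R : realType) (mu : probability config R) :=
  exists2 P : probability config R, fair_coins P &
    forall A : set config, measurable A ->
      pushforward (mu \x P)%E (fun z => step z.1 z.2) A = mu A.

Section Markov.
Context {R : realType}.
Implicit Types d : R.

Definition snorm d : R := Num.sqrt (d ^+ 2 + (1 - d) ^+ 2).

Definition pinit d (b : bool) : R := if b then d else 1 - d.

(* The values at d = 0 and d = 1 are those making each entry continuous on
   [0,1]; see [qtrans_continuous]. *)
Definition qtrans d (b c : bool) : R :=
  if d == 0 then (~~ c)%:R else if d == 1 then c%:R else
  match b, c with
  | false, false => (snorm d - d) / (1 - d)
  | false, true  => (1 - snorm d) / (1 - d)
  | true,  false => (1 - snorm d) / d
  | true,  true  => (snorm d - (1 - d)) / d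
  end.

Definition is_markov d (m : probability config R) :=
  translation_invariant m /\
  forall (k : nat) (b : nat -> bool), (1 <= k)%N ->
    m [set x : config | forall j : nat, (j <= k)%N -> x j%:Z = b j] =
      (pinit d (b 0%N) * \prod_(j < k) qtrans d (b j) (b j.+1))%:E.

(* A translation-invariant measure is determined by its values on the cylinders
   based on {0,...,k}, so the family [m] below is uniquely determined on [0,1];
   its values outside [0,1] are irrelevant. *)
Definition markov_mixture (mu : probability config R) :=
  exists (m : R -> probability config R) (rho : probability R R),
    [/\ forall d, 0 <= d <= 1 -> is_markov d (m d),
        rho `[0, 1]%classic = 1%E &
        forall A : set config, measurable A ->
          mu A = (\int[rho]_(d in `[0%R, 1%R]) m d A)%E].

Let qalt d (b c : bool) : R :=
  match b, c with
  | false, false => (1 - d) / (snorm d + d)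
  | false, true  => (2 * d) / (1 + snorm d)
  | true,  false => (2 * (1 - d)) / (1 + snorm d)
  | true,  true  => d / (snorm d + (1 - d))
  end.

Let snorm_gt0 d : 0 < snorm d.
Proof. by rewrite sqrtr_gt0; nra. Qed.

Let snorm2 d : snorm d ^+ 2 = d ^+ 2 + (1 - d) ^+ 2.
Proof. by rewrite sqr_sqrtr //; nra. Qed.

Let snorm_cts : continuous snorm.
Proof.
move=> d; apply: (@continuous_comp _ _ _ (fun t : R => t ^+ 2 + (1 - t) ^+ 2)
  (@Num.sqrt R)); last exact: sqrt_continuous.
apply: cvgD; first exact: exprn_continuous.
apply: (@continuous_comp _ _ _ (fun t : R => 1 - t) (fun t : R => t ^+ 2));
  last exact: exprn_continuous.
by apply: cvgB; [exact: cvg_cst|exact: cvg_id].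
Qed.

Let qtransE d b c : 0 <= d <= 1 -> qtrans d b c = qalt d b c.
Proof.
move=> /andP[d0 d1]; rewrite /qtrans /qalt.
have s0 := snorm_gt0 d; have s2 := snorm2 d.
case: eqP => [dE|/eqP dN0].
  have sE : snorm d = 1 by rewrite /snorm dE expr0n subr0 expr1n add0r sqrtr1.
  by rewrite sE dE; case: b c => [] [] /=; field.
case: eqP => [dE|/eqP dN1].
  have sE : snorm d = 1 by rewrite /snorm dE subrr expr0n expr1n addr0 sqrtr1.
  by rewrite sE dE; case: b c => [] [] /=; field.
have d1' : 1 - d != 0 by rewrite subr_eq0 eq_sym.
have h1 : snorm d + d != 0 by rewrite gt_eqF //; lra.
have h2 : 1 + snorm d != 0 by rewrite gt_eqF //; lra.
have h3 : snorm d + (1 - d) != 0 by rewrite gt_eqF //; lra.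
by case: b c => [] [] /=; apply/eqP; rewrite eqr_div //; apply/eqP; nra.
Qed.

Lemma qtrans_continuous b c :
  {within `[0, 1]%classic, continuous (fun d => qtrans d b c)}.
Proof.
apply: (@subspace_eq_continuous _ _ _ (fun d => qalt d b c)).
  by move=> d; rewrite inE /= in_itv /= => /(qtransE b c) /esym.
apply/continuous_in_subspaceT => d; rewrite inE /= in_itv /= => /andP[d0 d1].
have s0 := snorm_gt0 d.
have cB : (fun t : R => 1 - t) @ d --> 1 - d.
  by apply: cvgB; [exact: cvg_cst|exact: cvg_id].
have c1 : (fun t : R => 1 + snorm t) @ d --> 1 + snorm d.
  by apply: cvgD; [exact: cvg_cst|exact: snorm_cts].
case: b c => [] []; rewrite /qalt /=.
- apply: cvgM; first exact: cvg_id.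
  by apply: cvgV; [rewrite gt_eqF //; lra|apply: cvgD => //; exact: snorm_cts].
- apply: cvgM; first by apply: cvgM => //; exact: cvg_cst.
  by apply: cvgV => //; rewrite gt_eqF //; lra.
- apply: cvgM; first by apply: cvgM; [exact: cvg_cst|exact: cvg_id].
  by apply: cvgV => //; rewrite gt_eqF //; lra.
- apply: cvgM => //.
  apply: cvgV; first by rewrite gt_eqF //; lra.
  by apply: cvgD; [exact: snorm_cts|exact: cvg_id].
Qed.

End Markov.

(* Main.v *)
(* A Markov measure [mu_d] is stationary because its transition probabilities
   [alpha = q(0,1)], [beta = q(1,0)] satisfy
   [alpha + beta - alpha * beta / 2 = 1], which makes the transfer matrices of
   one step of the dynamics collapse to a product of the same [q]'s. Mixtures
   are then invariant by linearity.

   Conversely, couple an invariant stationary [mu] with [mu_d]: both start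
   independent and use the same fair coins, except that the first two bonds of
   every maximal run of active bonds alternating between the two
   configurations use opposite coins. Then the density of discrepancies never
   increases, and two discrepancies of opposite signs at bounded distance
   annihilate with positive probability; hence opposite discrepancies
   disappear from every window as time goes to infinity. Asymptotically the
   two configurations are ordered on a window of length [n], so
   [(X_n - d) (f_n - mu_d(f))] is nonnegative up to the fluctuations of
   [mu_d], where [X_n] is the empirical density under [mu] and [f_n] the
   empirical average of a monomial [f] in the occupation variables. Letting [d]
   run over a fine grid, [f_n - mu_(X_n)(f)] tends to 0, that is
   [mu(f) = lim mu(mu_(X_n)(f))] for every local [f]. Applied to
   [f = (X_p - X_q)^2] this shows that [X_n] converges along a subsequence,
   and the law of its limit is the mixing measure. *)
From Pilot Require Import Defs.
From HB Require Import structures.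
From mathcomp Require Import all_boot all_order all_algebra.
From mathcomp Require Import all_classical all_reals all_analysis.
From mathcomp Require Import measurable_realfun ring lra zify.

Set Implicit Arguments.
Unset Strict Implicit.
Unset Printing Implicit Defensive.

Import Order.TTheory GRing.Theory Num.Theory.
Import numFieldNormedType.Exports.

Local Open Scope classical_set_scope.
Local Open Scope ring_scope.

(** * Local functions and expectations *)

(** All probability is expressed through expectations of functions of finitely many sites. The
    coupled process is never built as a random trajectory: its transition operator is iterated on
    such functions, and translation invariance of the marginals and of the coins passes to every
    later time. Discrepancies obey a local balance with explicit fluxes, so the expected deficit at
    a site telescopes in time and tends to 0; a pattern that destroys discrepancies with positive
    probability therefore dies out. Adjacent opposite discrepancies are such a pattern, and larger
    distances reduce to smaller ones by prescribing finitely many coins. In the comparison, a grid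
    value [d] slightly off [X_n], chosen so that the two factors have opposite signs, turns the sign
    information into a bound on [f_n - mu_(X_n)(f)]. This requires [mu_d(f)] to be Lipschitz in [d],
    separate bounds near 0 and 1 where one side has no grid point, and variances of order [1/n]
    under [mu_d], which come from geometric decay of correlations. *)

Definition cyl (s : seq int) (b : int -> bool) : set config :=
  [set x | forall i, i \in s -> x i = b i].

Lemma cylinders_cyl s b : cylinders (cyl s b).
Proof. by exists s, b. Qed.

Lemma measurable_cyl s b : measurable (cyl s b).
Proof. by apply: sub_sigma_algebra; exact: cylinders_cyl. Qed.

Definition upd (x : config) (i : int) (c : bool) : config :=
  fun j => if j == i then c else x j.

Lemma updE x i c : upd x i c i = c. Proof. by rewrite /upd eqxx. Qed.

Lemma upd_neq x i c j : j != i -> upd x i c j = x j.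
Proof. by rewrite /upd => /negbTE ->. Qed.

Lemma upd_id (x : config) i : upd x i (x i) = x.
Proof. by apply/funext => j; rewrite /upd; case: eqP => [->|]. Qed.

(** Incompatible cylinders have empty intersection, and no cylinder is empty since it contains its
    own pattern [b]; adjoining [set0] gives a pi-system. *)
Lemma setI_closed_cylinders : setI_closed (set0 |` cylinders).
Proof.
move=> A B [->|[s [b ->]]]; first by rewrite set0I; left.
move=> [->|[t [c ->]]]; first by rewrite setI0; left.
have [/allP h|/allPn [i]] := boolP (all (fun i => (i \in t) ==> (b i == c i)) s).
  right; exists (s ++ t), (fun i => if i \in s then b i else c i).
  apply/seteqP; split => x /= => [[xs xt] i|H]; first rewrite mem_cat.
    by case: ifPn => //= [si _|si]; [exact: xs|exact: xt].
  split=> i si; have := H i; rewrite mem_cat si ?orbT => /(_ isT) //.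
  by case: ifPn => // /h; rewrite si => /eqP ->.
rewrite negb_imply => iS /andP[iT bc]; left.
apply/seteqP; split => x //= [/(_ _ iS) xs /(_ _ iT) xt].
by move: bc; rewrite -xs -xt eqxx.
Qed.

Lemma measurable_configE : @measurable _ config = <<s set0 |` cylinders >>.
Proof.
apply/seteqP; split.
  have H : cylinders `<=` set0 |` cylinders by move=> A; right.
  exact: (@sub_sigma_algebra2 _ setT _ _ H).
apply: smallest_sub; first exact: sigma_algebra_measurable.
by move=> A [->|cA]; [exact: measurable0|exact: sub_sigma_algebra].
Qed.

Lemma probability_ext (R : realType) (mu nu : probability config R) :
  (forall s b, mu (cyl s b) = nu (cyl s b)) ->
  forall A, measurable A -> mu A = nu A.
Proof.
move=> h A mA.
apply: (@measure_unique _ R config (set0 |` cylinders) (fun=> setT)) => //.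
- exact: measurable_configE.
- exact: setI_closed_cylinders.
- move=> _; right; exists [::], (fun=> true).
  by apply/seteqP; split.
- by rewrite bigcup_const.
- by move=> _ [->|[s [b ->]]]; [rewrite !measure0|exact: h].
- by move=> _; rewrite [X in (X < _)%E]probability_setT ltry.
Qed.

(** The support is a sequence, possibly with repetitions: unions become concatenations, and
    induction on the support is list induction. *)
Definition dep (T : Type) (s : seq int) (f : config -> T) :=
  forall x y : config, (forall i, i \in s -> x i = y i) -> f x = f y.

Lemma dep_sub (T : Type) (s t : seq int) (f : config -> T) :
  {subset s <= t} -> dep s f -> dep t f.
Proof. by move=> st df x y xy; apply: df => i /st; exact: xy. Qed.

Lemma dep_upd (T : Type) i (s : seq int) (f : config -> T) c :
  dep (i :: s) f -> dep s (fun x => f (upd x i c)).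
Proof.
move=> df x y xy; apply: df => j; rewrite inE /upd.
by case: eqP => //= _; exact: xy.
Qed.

Section expectation.
Context {R : realType}.
Implicit Types (mu : probability config R) (f g : config -> R).

Definition loc f := exists s, dep s f.

Lemma loc_cst r : loc (fun=> r).
Proof. by exists [::]. Qed.

Lemma loc_op2 (o : R -> R -> R) f g :
  loc f -> loc g -> loc (fun x => o (f x) (g x)).
Proof.
move=> [s df] [t dg]; exists (s ++ t) => x y xy; congr o.
  by apply: df => i si; apply: xy; rewrite mem_cat si.
by apply: dg => i si; apply: xy; rewrite mem_cat si orbT.
Qed.

Lemma loc_comp (o : R -> R) f : loc f -> loc (o \o f).
Proof. by move=> [s df]; exists s => x y xy; congr o; exact: df. Qed.

Lemma loc_sum (I : Type) (r : seq I) (F : I -> config -> R) :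
  (forall i, loc (F i)) -> loc (fun x => \sum_(i <- r) F i x).
Proof.
move=> lF; elim: r => [|i r IH].
  by under eq_fun do rewrite big_nil; exact: loc_cst.
under eq_fun do rewrite big_cons.
exact: loc_op2.
Qed.

(** Expansion in a single occupation variable, which removes one site from the support; it drives
    the inductions on local functions below. *)
Lemma site_split f i x : f x =
  (x i)%:R * f (upd x i true) + (1 - (x i)%:R) * f (upd x i false).
Proof. by rewrite -{1}(upd_id x i); case: (x i) => /=; ring. Qed.

Lemma measurable_site i : measurable_fun setT (fun x : config => (x i)%:R : R).
Proof.
rewrite (_ : (fun x : config => _) = \1_[set x : config | x i = true]).
  exact: measurable_indic (measurable_coord i true).
apply/funext => x; rewrite indicE; congr (nat_of_bool _)%:R.
by apply/idP/idP => [xi|]; rewrite inE.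
Qed.

Lemma loc_measurable f : loc f -> measurable_fun setT f.
Proof.
move=> [s]; elim: s f => [|i s IH] f df.
  rewrite (_ : f = fun=> f (fun=> true)); first exact: measurable_cst.
  by apply/funext => x; exact: df.
rewrite (_ : f = fun x => (x i)%:R * f (upd x i true)
   + (1 - (x i)%:R) * f (upd x i false)).
  have mi := measurable_site i.
  apply: measurable_funD; apply: measurable_funM => //.
  - by apply: IH; exact: dep_upd.
  - by apply: measurable_funB => //; exact: measurable_cst.
  - by apply: IH; exact: dep_upd.
by apply/funext => x; exact: site_split.
Qed.

Lemma loc_bounded f : loc f -> exists M, forall x, `|f x| <= M.
Proof.
move=> [s]; elim: s f => [|i s IH] f df.
  by exists `|f (fun=> true)| => x; rewrite (df x (fun=> true)).
have [M HM] := IH _ (dep_upd true df).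
have [N HN] := IH _ (dep_upd false df).
exists (M + N) => x; have := HM x; have := HN x.
rewrite -{3}(upd_id x i); have := normr_ge0 (f (upd x i true)).
by have := normr_ge0 (f (upd x i false)); case: (x i) => /=; lra.
Qed.

Lemma loc_integrable mu f : loc f -> mu.-integrable setT (EFin \o f).
Proof.
move=> lf; apply: measurable_bounded_integrable => //.
- by rewrite [X in (X < _)%E]probability_setT ltry.
- exact: loc_measurable.
- have [M HM] := loc_bounded lf.
  exists M; split; first by rewrite num_real.
  by move=> N MN x _ /=; exact: le_trans (HM x) (ltW MN).
Qed.

Definition E mu f : R := \int[mu]_(x in setT) f x.

Lemma E_cst mu r : E mu (fun=> r) = r.
Proof. by rewrite /E Rintegral_cst //= probability_setT mulr1. Qed.

Lemma E_add mu f g : loc f -> loc g ->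
  E mu (fun x => f x + g x) = E mu f + E mu g.
Proof. by move=> lf lg; rewrite /E RintegralD //; exact: loc_integrable. Qed.

Lemma E_sub mu f g : loc f -> loc g ->
  E mu (fun x => f x - g x) = E mu f - E mu g.
Proof. by move=> lf lg; rewrite /E RintegralB //; exact: loc_integrable. Qed.

Lemma E_scale mu r f : loc f -> E mu (fun x => r * f x) = r * E mu f.
Proof. by move=> lf; rewrite /E RintegralZl //; exact: loc_integrable. Qed.

Lemma E_le mu f g : loc f -> loc g -> (forall x, f x <= g x) ->
  E mu f <= E mu g.
Proof.
by move=> lf lg fg; apply: le_Rintegral => //; exact: loc_integrable.
Qed.

Lemma E_ge0 mu f : (forall x, 0 <= f x) -> 0 <= E mu f.
Proof. by move=> f0; apply: Rintegral_ge0 => x _. Qed.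

Lemma E_sum mu (I : Type) (r : seq I) (F : I -> config -> R) :
  (forall i, loc (F i)) ->
  E mu (fun x => \sum_(i <- r) F i x) = \sum_(i <- r) E mu (F i).
Proof.
move=> lF; elim: r => [|i r IH].
  by under eq_fun do rewrite big_nil; rewrite big_nil E_cst.
rewrite big_cons -IH -E_add //; last exact: loc_sum.
by congr E; apply/funext => x; rewrite big_cons.
Qed.

Definition icyl s b : config -> R := fun x => (all (fun i => x i == b i) s)%:R.

Lemma icylE s b : icyl s b = \1_(cyl s b).
Proof.
apply/funext => x; rewrite /icyl indicE; congr (nat_of_bool _)%:R.
apply/idP/idP => [/allP h|]; first by rewrite inE => i si; exact/eqP/h.
by rewrite inE => h; apply/allP => i si; exact/eqP/h.
Qed.

Lemma dep_icyl s b : dep s (icyl s b).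
Proof.
move=> x y xy; rewrite /icyl; congr (nat_of_bool _)%:R.
by apply: eq_in_all => i /xy ->.
Qed.

Lemma E_icyl mu s b : (E mu (icyl s b))%:E = mu (cyl s b).
Proof.
rewrite /E /Rintegral fineK; last first.
  apply: integral_fune_fin_num => //.
  by apply: loc_integrable; exists s; exact: dep_icyl.
by rewrite icylE integral_indic // ?setIT //; exact: measurable_cyl.
Qed.

(* Every local function is a linear combination of the cylinder indicators
   based on the same sites. *)
Lemma icyl_ind (Pr : (config -> R) -> Prop) s :
  (forall f g, dep s f -> dep s g -> Pr f -> Pr g ->
     Pr (fun x => f x + g x)) ->
  (forall r f, dep s f -> Pr f -> Pr (fun x => r * f x)) ->
  (forall b, Pr (icyl s b)) ->
  forall f, dep s f -> Pr f.
Proof.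
move=> PD PZ Pc f df.
(* Generalisation for the induction: [t] holds the sites already pinned by the indicator, [u] those
   on which [g] may still depend. *)
suff H t u (g : config -> R) b : dep u g -> {subset t <= s} -> {subset u <= s} ->
    {subset s <= t ++ u} -> Pr (fun x => icyl t b x * g x).
  have := H [::] s f (fun=> true) df.
  rewrite (_ : (fun x => _) = f); last first.
    by apply/funext => x; rewrite /icyl mul1r.
  by apply.
elim: u t b g => [|i u IH] t b g dg ts us st.
  rewrite (_ : (fun x => _) = (fun x => g (fun=> true) * icyl s b x)).
    by apply: PZ => //; exact: dep_icyl.
  apply/funext => x; rewrite mulrC (dg x (fun=> true))//; congr (_ * _).
  rewrite /icyl; congr (nat_of_bool _)%:R; apply: eq_all_r => j.
  by apply/idP/idP => [/ts//|/st]; rewrite cats0.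
have us' : {subset u <= s} by move=> j ju; apply: us; rewrite inE ju orbT.
have [it|it] := boolP (i \in t).
  rewrite (_ : (fun x => _) = (fun x => icyl t b x * g (upd x i (b i)))).
    apply: IH => //; first exact: dep_upd.
    by move=> j /st; rewrite !mem_cat inE; case: eqP => // ->; rewrite it.
  apply/funext => x; rewrite /icyl.
  have [/allP/(_ _ it)/eqP <-|] := boolP (all _ _); last by rewrite !mul0r.
  by rewrite upd_id.
rewrite (_ : (fun x => _) = (fun x =>
    icyl (i :: t) (upd b i true) x * g (upd x i true) +
    icyl (i :: t) (upd b i false) x * g (upd x i false))); last first.
  apply/funext => x; rewrite {1}(site_split g i x) /icyl /= !updE.
  have E3 c : all (fun j => x j == upd b i c j) t = all (fun j => x j == b j) t.
    apply: eq_in_all => j jt; rewrite upd_neq //.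
    by apply: contraNneq it => <-.
  by rewrite !E3; case: (x i) => /=; ring.
have Hc c : Pr (fun x => icyl (i :: t) (upd b i c) x * g (upd x i c)).
  apply: IH => //; first exact: dep_upd.
    by move=> j; rewrite inE => /predU1P[->|/ts//]; apply: us; rewrite inE eqxx.
  by move=> j /st; rewrite !mem_cat !inE orbCA orbA.
have dc c : dep s (fun x => icyl (i :: t) (upd b i c) x * g (upd x i c)).
  move=> x y xy; congr (_ * _).
    apply: dep_icyl => j; rewrite inE => /predU1P[->|/ts]; last exact: xy.
    by apply/xy/us; rewrite inE eqxx.
  by apply: (dep_upd c dg) => j /us'; exact: xy.
exact: PD.
Qed.

Definition mono s : config -> R := fun x => (all x s)%:R.

Lemma monoE s : mono s = icyl s (fun=> true).
Proof.
by apply/funext => x; congr (nat_of_bool _)%:R; apply: eq_all => i; rewrite eqb_id.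
Qed.

Lemma loc_mono s : loc (mono s).
Proof. by exists s; rewrite monoE; exact: dep_icyl. Qed.

(* Monomials in the occupation variables span the local functions. *)
Lemma mono_ind (Pr : (config -> R) -> Prop) :
  (forall f g, loc f -> loc g -> Pr f -> Pr g -> Pr (fun x => f x + g x)) ->
  (forall r f, loc f -> Pr f -> Pr (fun x => r * f x)) ->
  (forall s, Pr (mono s)) ->
  forall f, loc f -> Pr f.
Proof.
move=> PD PZ Pm f [s df].
suff H t u (g : config -> R) : dep u g -> Pr (fun x => mono t x * g x).
  have := H [::] s f df.
  rewrite (_ : (fun x => _) = f); first by apply.
  by apply/funext => x; rewrite /mono mul1r.
elim: u t g => [|i u IH] t g dg.
  rewrite (_ : (fun x => _) = (fun x => g (fun=> true) * mono t x)).
    by apply: PZ => //; exact: loc_mono.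
  by apply/funext => x; rewrite mulrC (dg x (fun=> true)).
have dg' := dep_upd _ dg.
(* As a function of [x i], [g] equals its value at 0 plus [x i] times its discrete derivative. *)
rewrite (_ : (fun x => _) = (fun x => mono t x * g (upd x i false) +
   mono (i :: t) x * (g (upd x i true) + -1 * g (upd x i false)))).
  have dh : dep u (fun x => g (upd x i true) + -1 * g (upd x i false)).
    by move=> x y xy; congr (_ + _ * _); apply: dg'.
  apply: PD; try exact: IH.
    apply: loc_op2; first exact: loc_mono.
    by exists u.
  by apply: loc_op2; [exact: loc_mono|exists u].
apply/funext => x; rewrite {1}(site_split g i x) /mono /=.
by case: (x i) (all x t) => [] [] /=; ring.
Qed.

End expectation.

(** * Measures with prescribed cylinder probabilities *)

Section unif01.
Context {R : realType}.

Definition unif01 : set (measurableTypeR R) -> \bar R :=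
  mrestr lebesgue_measure (measurable_itv `[0 : R, 1[).

HB.instance Definition _ := Measure.on unif01.

Lemma unif01_setT : unif01 setT = 1%E.
Proof.
rewrite /unif01 /mrestr setTI [LHS]lebesgue_measure_itv /= lte_fin ltr01.
by rewrite oppr0 adde0.
Qed.

HB.instance Definition _ :=
  Measure_isProbability.Build _ _ _ unif01 unif01_setT.

End unif01.

Section kolmogorov.
Context {R : realType}.
Variables (W : seq bool -> R) (e : nat -> int) (g : int -> nat).
Hypotheses (W_ge0 : forall l, 0 <= W l) (W_nil : W [::] = 1).
Hypothesis W_rcons : forall l, W l = W (rcons l false) + W (rcons l true).
Hypotheses (eK : cancel e g).

(* [u] in [0, 1[ is sent to a sequence starting with [l] exactly when
   [lo l <= u < lo l + W l]. *)
Let lo (l : seq bool) : R :=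
  \sum_(j < size l) (nth false l j)%:R * W (rcons (take j l) false).

Let lo_rcons l c : lo (rcons l c) = lo l + c%:R * W (rcons l false).
Proof.
rewrite /lo size_rcons big_ord_recr /= nth_rcons ltnn eqxx; congr (_ + _ * _).
  apply: eq_bigr => j _; rewrite nth_rcons ltn_ord; congr (_ * W (rcons _ _)).
  by rewrite -cats1 takel_cat // ltnW.
by rewrite (_ : take _ _ = l) //= -cats1 take_size_cat.
Qed.

Let path (u : R) := fix path n : seq bool := if n is k.+1 then
  rcons (path k) (lo (path k) + W (rcons (path k) false) <= u) else [::].

Let size_path u n : size (path u n) = n.
Proof. by elim: n => //= n IH; rewrite size_rcons IH. Qed.

Let nth_path u n j : (j < n)%N -> nth false (path u n) j = nth false (path u j.+1) j.
Proof.
elim: n => // n IH; rewrite ltnS leq_eqVlt => /predU1P[->//|jn].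
by rewrite -IH // /= nth_rcons size_path jn.
Qed.

Let pathP u l : 0 <= u < 1 -> (path u (size l) == l) = (lo l <= u < lo l + W l).
Proof.
move=> u01; elim/last_ind: l => [|l c IH] /=.
  by rewrite /lo big_ord0 W_nil add0r u01.
rewrite size_rcons /= eqseq_rcons IH lo_rcons.
have := W_rcons l; have := W_ge0 (rcons l false); have := W_ge0 (rcons l true).
move=> h1 h0 WE.
have [/eqP pl|pl] := boolP (path u (size l) == l).
  rewrite pl; move: IH; rewrite pl eqxx => /esym/andP[ll lu].
  rewrite ll lu /=; case: c; rewrite ?mul1r ?mul0r ?addr0.
    by rewrite eqb_id -addrA -WE lu andbT.
  by rewrite ll eqbF_neg -ltNge.
move: IH; rewrite (negbTE pl) => /esym/negbT H; rewrite (negbTE H) /=.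
apply/esym/negbTE; apply: contra H; case: c => /=; rewrite ?mul1r ?mul0r.
  by move=> /andP[H1 H2]; apply/andP; split; lra.
by move=> /andP[H1 H2]; apply/andP; split; lra.
Qed.

Let X (u : measurableTypeR R) : config := fun i => nth false (path u (g i).+1) (g i).

Let measurable_path n l : measurable [set u : measurableTypeR R | path u n = l].
Proof.
elim: n l => [|n IH] l /=.
  have [->|/eqP l0] := eqVneq l [::].
    by rewrite (_ : [set _ | _] = setT) //; apply/seteqP; split.
  rewrite (_ : [set _ | _] = set0) //; apply/seteqP; split => // u /= /esym.
  by [].
case/lastP: l => [|l c].
  rewrite (_ : [set _ | _] = set0) //; apply/seteqP; split => // u /=.
  by case: (path u n).
rewrite (_ : [set _ | _] = [set u | path u n = l] `&`
    (if c then `[lo l + W (rcons l false), +oo[%classic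
     else `]-oo, lo l + W (rcons l false)[%classic)).
  by apply: measurableI => //; case: c; exact: measurable_itv.
apply/seteqP; split => u /=.
  move=> /rcons_inj[-> <-]; split=> //.
  by case: leP => h /=; rewrite in_itv /= ?h.
move=> [->]; case: c => /=; rewrite in_itv /= ?andbT => h.
  by rewrite h.
by rewrite leNgt h.
Qed.

Let measurable_X : measurable_fun setT X.
Proof.
apply: measurable_to_config => i.
rewrite (_ : _ @^-1` _ = \bigcup_(l : seq bool)
    ([set u : measurableTypeR R | path u (g i).+1 = l] `&`
     [set _ | nth false l (g i)])).
  apply: countable_bigcupT_measurable => // l.
  apply: measurableI => //.
  case: (nth _ _ _).
    by rewrite (_ : [set _ | _] = setT) //; apply/seteqP; split.
  by rewrite (_ : [set _ | _] = set0) //; apply/seteqP; split.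
apply/seteqP; split => u /=.
  by move=> Xi; exists (path u (g i).+1).
by move=> [l _ [<- ]].
Qed.

(** The uniform measure on [0, 1[ is pushed forward by the quantile map for the lexicographic order:
    the points whose sequence starts with [l] form an interval of length [W l]. The injection [e]
    lists the sites in the order in which they are revealed. *)
Lemma kolmogorov : exists P : probability config R, forall l,
  P [set x | forall j, (j < size l)%N -> x (e j) = nth false l j] = (W l)%:E.
Proof.
pose mX := isMeasurableFun.Build _ _ _ _ X measurable_X.
pose Xf : {mfun measurableTypeR R >-> config} := HB.pack X mX.
exists (distribution unif01 Xf) => l.
rewrite /distribution /pushforward /= /unif01 /mrestr.
have lo_ge0 : 0 <= lo l by apply: sumr_ge0 => j _; rewrite mulr_ge0.
have lo_le1 : lo l + W l <= 1.
  elim/last_ind: l {lo_ge0} => [|l c]; first by rewrite /lo big_ord0 W_nil add0r.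
  rewrite lo_rcons => IH; have := W_rcons l.
  have := W_ge0 (rcons l false); have := W_ge0 (rcons l true).
  by case: c => /=; lra.
rewrite (_ : _ `&` _ = `[lo l, lo l + W l[%classic).
  rewrite [LHS]lebesgue_measure_itv /= lte_fin ltrDl.
  case: ltP => [_|Wl]; first by rewrite -EFinB addrAC subrr add0r.
  by congr EFin; apply/eqP; rewrite eq_le Wl W_ge0.
apply/seteqP; split => u /=; rewrite !in_itv /=.
  move=> [Hx u01]; rewrite -pathP //; apply/eqP.
  apply: (@eq_from_nth _ false); rewrite size_path // => j jl.
  by rewrite -Hx // /X eK nth_path.
move=> lu; have u01 : 0 <= u < 1 by move: lu => /andP[]; lra.
split=> // j jl; move: lu; rewrite -pathP // => /eqP pl.
by rewrite /X eK -[in RHS]pl [RHS]nth_path.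
Qed.

End kolmogorov.

(** * The Markov measures *)

Section qtrans_facts.
Context {R : realType}.
Variable d : R.
Hypothesis d01 : 0 <= d <= 1.

Let s_facts : [/\ 0 < snorm d, snorm d ^+ 2 = d ^+ 2 + (1 - d) ^+ 2,
  d <= snorm d, 1 - d <= snorm d & snorm d <= 1].
Proof.
have /andP[d0 d1] := d01.
have sq : snorm d ^+ 2 = d ^+ 2 + (1 - d) ^+ 2 by rewrite sqr_sqrtr //; nra.
have s0 : 0 < snorm d by rewrite sqrtr_gt0; nra.
have le2 (a b : R) : 0 <= a -> 0 <= b -> a ^+ 2 <= b ^+ 2 -> a <= b.
  by move=> a0 b0; rewrite ler_pXn2r.
have s0' := ltW s0.
by split=> //; apply: le2 => //; rewrite ?sq; nra.
Qed.

Let nontriv (Pr : Prop) : (d = 0 -> Pr) -> (d = 1 -> Pr) ->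
  (0 < d < 1 -> Pr) -> Pr.
Proof.
have /andP[d0 d1] := d01 => H0 H1 H.
have [/esym/H0//|d0'] := eqVneq 0 d; have [/H1//|d1'] := eqVneq d 1.
by apply: H; rewrite !lt_neqAle d0' d0 d1' d1.
Qed.

Lemma qtrans_row b : qtrans d b false + qtrans d b true = 1.
Proof.
rewrite /qtrans; apply: nontriv => [->|->|/andP[d0 d1]].
- by rewrite eqxx /= addr0.
- by rewrite oner_eq0 eqxx /= add0r.
rewrite gt_eqF // lt_eqF //.
have d1' : 1 - d != 0 by rewrite gt_eqF // subr_gt0.
have d0' : d != 0 by rewrite gt_eqF.
by case: b; field.
Qed.

Lemma qtrans_ge0 b c : 0 <= qtrans d b c.
Proof.
have [s0 s2 sd sd' s1] := s_facts.
rewrite /qtrans; case: ifP => // _; case: ifP => // _.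
by have /andP[d0 d1] := d01; case: b c => [] [];
  rewrite divr_ge0 // ?subr_ge0.
Qed.

Lemma pinit_ge0 b : 0 <= pinit d b.
Proof. by have /andP[d0 d1] := d01; case: b => //=; rewrite subr_ge0. Qed.

Lemma pinit_sum : pinit d false + pinit d true = 1.
Proof. by rewrite /=; ring. Qed.

(** Detailed balance: both off-diagonal products equal [1 - snorm d]. It allows the chain to be
    extended to the left with the same kernel. *)
Lemma qtrans_reversible b c :
  pinit d b * qtrans d b c = pinit d c * qtrans d c b.
Proof.
rewrite /qtrans; apply: nontriv => [->|->|/andP[d0 d1]].
- by rewrite eqxx /=; case: b c => [] [] /=; ring.
- by rewrite oner_eq0 eqxx /=; case: b c => [] [] /=; ring.
rewrite gt_eqF // lt_eqF //.
have d1' : 1 - d != 0 by rewrite gt_eqF // subr_gt0.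
have d0' : d != 0 by rewrite gt_eqF.
by case: b c => [] [] /=; field; rewrite ?d0' ?d1'.
Qed.

(* With reversibility, all that stationarity needs to know about [q]. *)
Lemma qtrans_rel : qtrans d false true + qtrans d true false -
  qtrans d false true * qtrans d true false / 2 = 1.
Proof.
have [s0 s2 sd sd' s1] := s_facts.
rewrite /qtrans; apply: nontriv => [->|->|/andP[d0 d1]].
- by rewrite eqxx /=; field.
- by rewrite oner_eq0 eqxx /=; field.
rewrite gt_eqF // lt_eqF //.
have d1' : 1 - d != 0 by rewrite gt_eqF // subr_gt0.
have d0' : d != 0 by rewrite gt_eqF.
(* The choice of [snorm] enters here: [1 - snorm d ^+ 2 = 2 * d * (1 - d)]. *)
transitivity ((1 - snorm d ^+ 2) / (2 * d * (1 - d))); first by field; rewrite d1'.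
by rewrite s2; field; rewrite d1'.
Qed.

(* The second eigenvalue of the chain is [- alpha * beta / 2]. *)
Lemma qtrans_contraction : `|qtrans d false true - qtrans d true true| <= 2^-1.
Proof.
have := qtrans_rel; have := qtrans_row true; have := qtrans_row false.
have := qtrans_ge0 false true; have := qtrans_ge0 false false.
have := qtrans_ge0 true true; have := qtrans_ge0 true false.
set a := qtrans d false true; set b := qtrans d true false => ? ? ? ? r1 r2 r3.
have -> : a - qtrans d true true = a * b / 2 by lra.
rewrite ger0_norm; nra.
Qed.

End qtrans_facts.

Section enumeration.

(* [0, 1, -1, 2, -2, ...] *)
Definition enum_int (j : nat) : int :=
  if odd j then (j.+1./2)%:Z else - (j./2)%:Z.

Definition rank_int (i : int) : nat :=
  match i with Posz 0 => 0%N | Posz n.+1 => n.*2.+1 | Negz n => n.+1.*2 end.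

Lemma enum_intK : cancel enum_int rank_int.
Proof.
move=> j; rewrite /enum_int; have := odd_double_half j; case: ifP => oj.
  have -> : (j.+1)./2 = (j./2).+1 by rewrite -uphalfE uphalf_half oj.
  by rewrite /= add1n.
by rewrite /= add0n => <-; rewrite doubleK; case: (_./2).
Qed.

Lemma rank_intK : cancel rank_int enum_int.
Proof.
by case=> [[|n]|n] //; rewrite /enum_int /= ?odd_double /= ?doubleK ?NegzE.
Qed.

End enumeration.

Section cylinder_bridges.
Context {R : realType}.
Implicit Types (mu P : probability config R).

Lemma E_prob mu A : measurable A -> (E mu \1_A)%:E = mu A.
Proof.
move=> mA; rewrite /E /Rintegral fineK; last first.
  rewrite integral_indic // setIT; apply: fin_num_measure => //.
by rewrite integral_indic // setIT.
Qed.

Lemma icyl_eqmem s t (b c : int -> bool) : s =i t -> {in s, b =1 c} ->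
  icyl s b = icyl t c :> (config -> R).
Proof.
move=> st bc; apply/funext => x; rewrite /icyl; congr (nat_of_bool _)%:R.
by rewrite -(eq_all_r st); apply: eq_in_all => i /bc ->.
Qed.

Lemma E_icyl_split mu s b i : i \notin s ->
  E mu (icyl s b) =
  E mu (icyl (i :: s) (upd b i false)) + E mu (icyl (i :: s) (upd b i true)).
Proof.
move=> si; rewrite -E_add; first last.
- by exists (i :: s); exact: dep_icyl.
- by exists (i :: s); exact: dep_icyl.
congr E; apply/funext => x; rewrite /icyl /= !updE.
have E3 c : all (fun j => x j == upd b i c j) s = all (fun j => x j == b j) s.
  by apply: eq_in_all => j js; rewrite upd_neq //; apply: contraNneq si => <-.
by rewrite !E3; case: (x i) => /=; rewrite ?add0r ?addr0.
Qed.

Lemma kolmogorov_int (W : seq bool -> R) :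
  (forall l, 0 <= W l) -> W [::] = 1 ->
  (forall l, W l = W (rcons l false) + W (rcons l true)) ->
  exists P, forall n b,
    E P (icyl (map enum_int (iota 0 n)) b) =
    W (map (b \o enum_int) (iota 0 n)).
Proof.
move=> W0 W1 W2; have [P HP] := kolmogorov W0 W1 W2 enum_intK.
exists P => n b; apply: EFin_inj; rewrite E_icyl -HP; congr (P _).
apply/seteqP; split => x /= h.
  move=> j; rewrite size_map size_iota => jn.
  rewrite h; last by rewrite map_f // mem_iota.
  by rewrite (nth_map 0%N) ?size_iota // nth_iota.
move=> i /mapP[j]; rewrite mem_iota /= add0n => jn ->{i}.
have := h j; rewrite size_map size_iota => /(_ jn) ->.
by rewrite (nth_map 0%N) ?size_iota // nth_iota.
Qed.

Lemma enum_int_cover (s : seq int) : exists n, {subset s <= map enum_int (iota 0 n)}.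
Proof.
exists (\max_(i <- s) rank_int i).+1 => i si.
rewrite -(rank_intK i) map_f // mem_iota /= add0n ltnS.
exact: leq_bigmax_seq.
Qed.

Lemma fair_coinsP P : fair_coins P <->
  forall s b, uniq s -> E P (icyl s b) = 2^-1 ^+ size s.
Proof.
split=> h s b us; first by apply: EFin_inj; rewrite E_icyl; exact: h.
by rewrite -(h s b us) E_icyl.
Qed.

(** Needed for the mixtures: to be stationary they must exhibit a coin law. *)
Lemma fair_coins_exist : exists P : probability config R, fair_coins P.
Proof.
have [||l|P HP] := @kolmogorov_int (fun l => 2^-1 ^+ size l).
- by move=> l; rewrite exprn_ge0 // invr_ge0.
- by rewrite expr0.
- by rewrite !size_rcons exprS; field.
exists P; apply/fair_coinsP => s b us.
have drop t : forall s, uniq (t ++ s) ->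
    (forall b, E P (icyl (t ++ s) b) = 2^-1 ^+ (size (t ++ s))) ->
    forall b, E P (icyl s b) = 2^-1 ^+ size s.
  elim: t => [|i t IH] s' //= /andP[its uts] H.
  by apply: IH => // c; rewrite (E_icyl_split _ _ its) !H exprS; field.
have [n sn] := enum_int_cover s.
pose t := [seq i <- map enum_int (iota 0 n) | i \notin s].
have uts : uniq (t ++ s).
  rewrite cat_uniq us andbT filter_uniq ?map_inj_uniq ?iota_uniq //; last first.
    exact: can_inj enum_intK.
  by apply/hasPn => i si; rewrite mem_filter si.
have ets : map enum_int (iota 0 n) =i t ++ s.
  move=> i; rewrite mem_cat mem_filter.
  by have [/sn ->|] := boolP (i \in s); rewrite ?orbT ?orbF.
have szts : size (t ++ s) = n.
  have : perm_eq (map enum_int (iota 0 n)) (t ++ s).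
    apply: uniq_perm => //; rewrite map_inj_uniq ?iota_uniq //.
    exact: can_inj enum_intK.
  by move=> /perm_size; rewrite size_map size_iota.
apply: (drop t) => // c.
rewrite -(@icyl_eqmem (map enum_int (iota 0 n)) _ c c ets) // HP.
by rewrite size_map size_iota szts.
Qed.

End cylinder_bridges.

Definition window (a : int) (k : nat) : seq int :=
  [seq a + j%:Z | j <- iota 0 k].

Lemma mem_window a k i : (i \in window a k) = (a <= i < a + k%:Z).
Proof.
apply/mapP/idP => [[j]|/andP[ai ik]].
  by rewrite mem_iota => /andP[_ jk] ->; lia.
exists `|i - a|%N; last by lia.
by rewrite mem_iota; lia.
Qed.

Lemma window_recl a k : window a k.+1 = a :: window (a + 1) k.
Proof.
rewrite /window /= addr0 -[1%N]addn0 iotaDl -map_comp; congr (_ :: _).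
by apply: eq_map => j /=; rewrite -addrA.
Qed.

Lemma window_recr a k : window a k.+1 =i (a + k%:Z) :: window a k.
Proof. by move=> i; rewrite mem_window in_cons mem_window; apply/idP/idP; lia. Qed.

Lemma window_cover (s : seq int) : exists a k, {subset s <= window a k}.
Proof.
have [M HM] : exists M : nat, forall i, i \in s -> (`|i| <= M)%N.
  exists (\max_(i <- s) `|i|)%N => i si; exact: leq_bigmax_seq.
exists (- M%:Z), (M + M).+1 => i /HM; rewrite mem_window; lia.
Qed.

Section markov_chain.
Context {R : realType}.
Implicit Types (mu m : probability config R) (d : R).

Lemma icyl_mem s t (b : int -> bool) : s =i t ->
  icyl s b = icyl t b :> (config -> R).
Proof. by move=> st; exact: icyl_eqmem. Qed.

(** [k] counts transitions, so the weight belongs to a pattern on the [k + 1] sites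
    [a, ..., a + k]. *)
Definition markov_weight d (b : int -> bool) (a : int) (k : nat) : R :=
  pinit d (b a) * \prod_(j < k) qtrans d (b (a + j%:Z)) (b (a + j%:Z + 1)).

Lemma markov_weight_recr d b a k : markov_weight d b a k.+1 =
  markov_weight d b a k * qtrans d (b (a + k%:Z)) (b (a + k%:Z + 1)).
Proof. by rewrite /markov_weight big_ord_recr /= mulrA. Qed.

Lemma markov_weight_recl d b a k : 0 <= d <= 1 ->
  markov_weight d b a k.+1 =
  qtrans d (b (a + 1)) (b a) * markov_weight d b (a + 1) k.
Proof.
move=> d01; rewrite /markov_weight big_ord_recl /= addr0 mulrA.
rewrite qtrans_reversible // [RHS]mulrA [in RHS](mulrC (qtrans _ _ _)).
by congr (_ * _); apply: eq_bigr => j _; rewrite /bump leq0n /= PoszD addrA.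
Qed.

Lemma eq_markov_weight d b c a k : {in window a k.+1, b =1 c} ->
  markov_weight d b a k = markov_weight d c a k.
Proof.
move=> bc; rewrite /markov_weight bc ?mem_window; last by lia.
congr (_ * _); apply: eq_bigr => j _.
have := ltn_ord j => jk.
by rewrite !bc // mem_window; lia.
Qed.

(** Working form of [is_markov]: windows at every position, single sites included, with translation
    invariance a consequence. *)
Definition markov_windows d m := forall a k b,
  E m (icyl (window a k.+1) b) = markov_weight d b a k.

(** Sites are revealed in the order 0, 1, -1, 2, -2, ..., each drawn from its inner neighbour. By
    reversibility the kernel [qtrans d] serves in both directions. *)
Lemma markov_exists d : 0 <= d <= 1 ->
  exists m : probability config R, markov_windows d m.
Proof.
move=> d01.
(* The inner neighbour was revealed two places earlier. For [j = 1] it is the site 0, which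
   truncated subtraction yields. *)
pose w (l : seq bool) j := if j == 0%N then pinit d (nth false l j)
  else qtrans d (nth false l (j - 2)) (nth false l j).
pose W (l : seq bool) : R := \prod_(j < size l) w l j.
have wr l c j : (j < size l)%N -> w (rcons l c) j = w l j.
  move=> jl; rewrite /w !nth_rcons jl.
  by rewrite (leq_ltn_trans _ jl) // leq_subr.
have Wr l c : W (rcons l c) = W l * w (rcons l c) (size l).
  rewrite /W size_rcons big_ord_recr /=; congr (_ * _).
  by apply: eq_bigr => j _; rewrite wr.
have wl l c : w (rcons l c) (size l) = if size l == 0%N then pinit d c
    else qtrans d (nth false l (size l - 2)) c.
  rewrite /w !nth_rcons ltnn eqxx; case: eqP => // /eqP l0.
  by rewrite (_ : (size l - 2 < size l)%N) //; lia.
have [||l|m Hm] := @kolmogorov_int _ W.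
- move=> l; apply: prodr_ge0 => j _; rewrite /w.
  by case: ifP => _; [exact: pinit_ge0|exact: qtrans_ge0].
- by rewrite /W big_ord0.
- rewrite !Wr !wl -mulrDr; case: eqP => _.
    by rewrite pinit_sum // mulr1.
  by rewrite qtrans_row // mulr1.
exists m.
(* After [2n + 1] sites the revealed set is the symmetric window from [-n] to [n]. *)
have sym n b : E m (icyl (window (- n%:Z) (n + n).+1) b) =
    markov_weight d b (- n%:Z) (n + n).
  rewrite (_ : icyl _ b = icyl (map enum_int (iota 0 (n + n).+1)) b); last first.
    apply: icyl_eqmem => // i; rewrite mem_window.
    apply/idP/mapP => [h|[j]].
      exists (rank_int i); last by rewrite rank_intK.
      by rewrite mem_iota /=; case: i h => [[|i]|i] /=; lia.
    rewrite mem_iota /= add0n => jn ->; rewrite /enum_int.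
    by have := odd_double_half j; case: ifP => oj; lia.
  rewrite Hm /W size_map size_iota.
  have wE N j : (j < N)%N ->
      w [seq (b \o enum_int) i | i <- iota 0 N] j =
      if j == 0%N then pinit d (b 0)
      else qtrans d (b (enum_int (j - 2))) (b (enum_int j)).
    move=> jn; rewrite /w !(nth_map 0%N) ?size_iota //; try lia.
    rewrite !nth_iota //; try lia.
    by case: eqP => // ->.
  rewrite (eq_bigr (fun j : 'I__ => if j == 0%N :> nat then pinit d (b 0)
      else qtrans d (b (enum_int (j - 2))) (b (enum_int j)))); last first.
    by move=> j _; rewrite wE.
  elim: n => [|n IH].
    by rewrite big_ord_recr !big_ord0 /= mul1r /markov_weight big_ord0 mulr1.
  rewrite addSn addnS 2!big_ord_recr /= IH.
  have e1 : enum_int (n + n).+1 = n.+1%:Z.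
    by rewrite -[RHS]rank_intK /= addnn.
  have e2 : enum_int (n + n).+2 = - n.+1%:Z.
    by rewrite -NegzE -[RHS]rank_intK /= addnn.
  have e3 : enum_int ((n + n).+2 - 2) = - n%:Z.
    rewrite subn2 /= -[RHS]rank_intK addnn; congr enum_int.
    by case: n {IH e1 e2} => // n; rewrite -NegzE.
  have e4 : enum_int ((n + n).+1 - 2) = n%:Z.
    rewrite -[RHS]rank_intK; congr enum_int.
    by case: n {IH e1 e2 e3} => // n /=; lia.
  rewrite e1 e2 e3 e4 markov_weight_recl //.
  rewrite (_ : - n.+1%:Z + 1 = - n%:Z); last by lia.
  rewrite markov_weight_recr (_ : - n%:Z + (n + n)%N = n%:Z); last by lia.
  by rewrite (_ : n%:Z + 1 = n.+1%:Z); [ring|lia].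
(* Any other window is cut out of a symmetric one by summing out end sites: on the right through the
   row sums, on the left after reversing the first transition. *)
have rdrop a k : (forall b, E m (icyl (window a k.+2) b) = markov_weight d b a k.+1) ->
    forall b, E m (icyl (window a k.+1) b) = markov_weight d b a k.
  move=> H b; rewrite (@E_icyl_split _ _ _ _ (a + k.+1%:Z)); last first.
    by rewrite mem_window; lia.
  rewrite -!(icyl_mem _ (window_recr a k.+1)) !H.
  have ak : a + k%:Z + 1 = a + k.+1%:Z by lia.
  rewrite !markov_weight_recr ak !updE.
  rewrite !(@eq_markov_weight _ (upd b _ _) b) => [|i|i]; last first.
  - by rewrite mem_window => h; rewrite upd_neq //; apply/eqP; lia.
  - by rewrite mem_window => h; rewrite upd_neq //; apply/eqP; lia.
  rewrite !upd_neq; try by apply/eqP; lia.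
  by rewrite -mulrDr qtrans_row // mulr1.
have ldrop a k : (forall b, E m (icyl (window a k.+2) b) = markov_weight d b a k.+1) ->
    forall b, E m (icyl (window (a + 1) k.+1) b) = markov_weight d b (a + 1) k.
  move=> H b; rewrite (@E_icyl_split _ _ _ _ a); last first.
    by rewrite mem_window; lia.
  rewrite -!window_recl !H !markov_weight_recl // !updE.
  rewrite !(@eq_markov_weight _ (upd b _ _) b) => [|i|i]; last first.
  - by rewrite mem_window => h; rewrite upd_neq //; apply/eqP; lia.
  - by rewrite mem_window => h; rewrite upd_neq //; apply/eqP; lia.
  rewrite !upd_neq; try by apply/eqP; lia.
  by rewrite -mulrDl qtrans_row // mul1r.
have rdrops a j : forall k,
    (forall b, E m (icyl (window a (k + j).+1) b) = markov_weight d b a (k + j)) ->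
    forall b, E m (icyl (window a k.+1) b) = markov_weight d b a k.
  elim: j => [|j IH] k H; first by rewrite addn0 in H.
  by apply: IH; apply: rdrop => b; rewrite -addnS.
have ldrops k j : forall a,
    (forall b, E m (icyl (window a (k + j).+1) b) = markov_weight d b a (k + j)) ->
    forall b, E m (icyl (window (a + j%:Z) k.+1) b) = markov_weight d b (a + j%:Z) k.
  elim: j => [|j IH] a H; first by rewrite addn0 in H; rewrite addr0.
  rewrite (_ : a + j.+1%:Z = (a + 1) + j%:Z); last by lia.
  by apply: IH; apply: ldrop => b; rewrite -addnS.
move=> a k.
pose n := (`|a| + k)%N.
rewrite (_ : a = - n%:Z + (absz (a + n%:Z))%:Z); last by lia.
apply: ldrops; have := @rdrops (- n%:Z) (n + n - (k + `|(a + n%:Z)%R|))%N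
  (k + `|(a + n%:Z)%R|)%N.
rewrite (_ : (k + `|(a + n%:Z)%R| + _)%N = (n + n)%N); last by lia.
by apply; exact: sym.
Qed.

End markov_chain.

(** * Translations and one step of the dynamics *)

Definition tr (a : int) (x : config) : config := fun i => x (i + a).

Lemma tr0 x : tr 0 x = x.
Proof. by apply/funext => i; rewrite /tr addr0. Qed.

Lemma trD a b x : tr a (tr b x) = tr (a + b) x.
Proof. by apply/funext => i; rewrite /tr addrA. Qed.

Lemma tr1 x : tr 1 x = Defs.shift x. Proof. by []. Qed.

Lemma dep_tr (T : Type) s (f : config -> T) a :
  dep s f -> dep [seq i + a | i <- s] (f \o tr a).
Proof.
move=> df x y xy; apply: df => i si; apply: xy; exact: map_f.
Qed.

Section two_configurations.
Context {R : realType}.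
Implicit Types (mu nu P : probability config R).

(** The two arguments are either a configuration and its coins, or two coupled configurations. *)
Definition dep2 (s : seq int) (f : config -> config -> R) :=
  forall x x' y y', {in s, x =1 x'} -> {in s, y =1 y'} -> f x y = f x' y'.

Definition loc2 f := exists s, dep2 s f.

Lemma loc2_r f x : loc2 f -> loc (f x).
Proof. by move=> [s df]; exists s => y y' yy; exact: df. Qed.

Lemma loc2_cst r : loc2 (fun _ _ => r).
Proof. by exists [::]. Qed.

Lemma loc2_op2 (o : R -> R -> R) f g :
  loc2 f -> loc2 g -> loc2 (fun x y => o (f x y) (g x y)).
Proof.
move=> [s df] [t dg]; exists (s ++ t) => x x' y y' xx yy; congr o.
  by apply: df => i si; [apply: xx|apply: yy]; rewrite mem_cat si.
by apply: dg => i si; [apply: xx|apply: yy]; rewrite mem_cat si orbT.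
Qed.

Lemma loc2_comp (o : R -> R) f : loc2 f -> loc2 (fun x y => o (f x y)).
Proof. by move=> [s df]; exists s => x x' y y' xx yy; congr o; exact: df. Qed.

Lemma dep2_E s f mu : dep2 s f -> dep s (fun x => E mu (f x)).
Proof.
by move=> df x x' xx; congr E; apply/funext => y; exact: df.
Qed.

Lemma loc2_E f mu : loc2 f -> loc (fun x => E mu (f x)).
Proof. by move=> [s df]; exists s; exact: dep2_E. Qed.

Lemma loc2_fst g : loc g -> loc2 (fun x _ => g x).
Proof. by move=> [s dg]; exists s => x x' y y' xx _; exact: dg. Qed.

Lemma loc2_snd g : loc g -> loc2 (fun _ => g).
Proof. by move=> [s dg]; exists s => x x' y y' _ yy; exact: dg. Qed.

Lemma E_comp_eq mu nu (T : config -> config) :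
  (forall f : config -> R, loc f -> loc (f \o T)) ->
  (forall s b, uniq s -> E mu (icyl s b \o T) = E nu (icyl s b)) ->
  forall f, loc f -> E mu (f \o T) = E nu f.
Proof.
move=> lT H f [s df].
have {}df : dep (undup s) f by apply: dep_sub df => i; rewrite mem_undup.
have LT (g : config -> R) : dep (undup s) g -> loc (g \o T).
  by move=> dg; apply: lT; exists (undup s).
apply: (icyl_ind (Pr := fun f => E mu (f \o T) = E nu f) _ _ _ df).
- move=> g h dg dh Hg Hh; rewrite (E_add _ (LT _ dg) (LT _ dh)).
  by rewrite Hg Hh -E_add //; exists (undup s).
- move=> r g dg Hg; rewrite (E_scale _ _ (LT _ dg)).
  by rewrite Hg E_scale //; exists (undup s).
- by move=> b; apply: H; exact: undup_uniq.
Qed.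

Lemma icyl_compE s b (T : config -> config) :
  icyl s b \o T = \1_(T @^-1` cyl s b) :> (config -> R).
Proof. by apply/funext => x; rewrite /= icylE !indicE. Qed.

Lemma loc_tr (f : config -> R) a : loc f -> loc (f \o tr a).
Proof. by move=> [s df]; exists [seq i + a | i <- s]; exact: dep_tr. Qed.

Lemma translation_invariantP mu : translation_invariant mu <->
  forall f, loc f -> E mu (f \o Defs.shift) = E mu f.
Proof.
split=> [h|h A mA].
  apply: E_comp_eq => [f /loc_tr|s b us]; first exact.
  apply: EFin_inj; rewrite E_icyl icyl_compE E_prob.
    by apply: h; exact: measurable_cyl.
  by rewrite -[X in measurable X]setTI; apply: measurable_shift => //; exact: measurable_cyl.
pose mS := isMeasurableFun.Build _ _ _ _ Defs.shift measurable_shift.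
pose Sf : {mfun config >-> config} := HB.pack Defs.shift mS.
suff H s b : distribution mu Sf (cyl s b) = mu (cyl s b).
  exact: (@probability_ext R (distribution mu Sf) mu H A mA).
rewrite -[RHS]E_icyl -h; last by exists s; exact: dep_icyl.
rewrite icyl_compE E_prob //.
by rewrite -[X in measurable X]setTI; apply: measurable_shift => //; exact: measurable_cyl.
Qed.

Lemma E_tr mu a f : translation_invariant mu -> loc f ->
  E mu (f \o tr a) = E mu f.
Proof.
move=> /translation_invariantP h.
have pos (n : nat) g : loc g -> E mu (g \o tr n%:Z) = E mu g.
  elim: n g => [|n IH] g lg.
    by congr E; apply/funext => x /=; rewrite tr0.
  rewrite -[in RHS]h // -[RHS]IH; last exact: (@loc_tr g 1 lg).
  congr E; apply/funext => x /=; rewrite -tr1 trD; congr (g (tr _ _)).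
move=> lf; have [a0|a0] := leP 0 a.
  by rewrite -{1}(gez0_abs a0) pos.
rewrite -(pos `|a|%N); last exact: loc_tr.
congr E; apply/funext => x /=; rewrite trD.
by rewrite (_ : a + _ = 0) ?tr0 //; lia.
Qed.

Lemma step_dep x x' w w' i : {in [:: i - 1; i; i + 1], x =1 x'} ->
  {in [:: i - 1; i; i + 1], w =1 w'} -> step x w i = step x' w' i.
Proof.
move=> xx ww; rewrite /step /jumps subrK.
by rewrite !(xx (i - 1), xx i, xx (i + 1), ww (i - 1), ww i) // !inE eqxx ?orbT.
Qed.

Definition nbhd (s : seq int) := flatten [seq [:: i - 1; i; i + 1] | i <- s].

Lemma mem_nbhd s i j : i \in s -> j \in [:: i - 1; i; i + 1] -> j \in nbhd s.
Proof.
by move=> si ji; apply/flatten_mapP; exists i.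
Qed.

Lemma loc_step f : loc f -> loc2 (fun x w => f (step x w)).
Proof.
move=> [s df]; exists (nbhd s) => x x' w w' xx ww.
apply: df => i si; apply: step_dep => j ji; [apply: xx|apply: ww];
  exact: mem_nbhd ji.
Qed.

Lemma product_step mu P s b :
  ((mu \x P) [set z | cyl s b (step z.1 z.2)])%E =
  (E mu (fun x => E P (fun w => icyl s b (step x w))))%:E.
Proof.
have lf := loc_step (ex_intro _ s (@dep_icyl R s b)).
rewrite /product_measure1
  [LHS](_ : _ = \int[mu]_x (E P (fun w => icyl s b (step x w)))%:E)%E.
  rewrite /E [RHS]fineK //; apply: integral_fune_fin_num => //.
  by apply: loc_integrable; exact: loc2_E.
apply: eq_integral => x _; rewrite /= -E_prob.
  congr (E P _)%:E; apply/funext => w; rewrite icylE !indicE; congr (nat_of_bool _)%:R.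
  by apply/idP/idP; rewrite !inE; [move/xsectionP|move=> h; apply/xsectionP].
apply: measurable_xsection.
rewrite -[X in measurable X]setTI; apply: measurable_step => //; exact: measurable_cyl.
Qed.

(** From here on the product measure is replaced by an iterated expectation. Both sides are linear
    in the test function, so cylinder events suffice in each direction. *)
Lemma stationaryP mu P :
  (forall A, measurable A ->
     pushforward (mu \x P)%E (fun z => step z.1 z.2) A = mu A) <->
  (forall f, loc f -> E mu (fun x => E P (fun w => f (step x w))) = E mu f).
Proof.
split=> [h|h A mA].
  move=> f lf.
  pose S f := (fun x => E P (fun w => f (step x w))).
  have lS g : loc g -> loc (S g) by move=> lg; apply: loc2_E; exact: loc_step.
  apply: (mono_ind (Pr := fun f => E mu (S f) = E mu f) _ _ _ lf).
  - move=> g k lg lk Hg Hk; rewrite E_add // -Hg -Hk -E_add; try exact: lS.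
    congr E; apply/funext => x.
    exact: (E_add P (loc2_r x (loc_step lg)) (loc2_r x (loc_step lk))).
  - move=> r g lg Hg; rewrite E_scale // -Hg -E_scale; try exact: lS.
    by congr E; apply/funext => x; exact: (E_scale P r (loc2_r x (loc_step lg))).
  - move=> s; rewrite monoE; apply: EFin_inj; rewrite -product_step E_icyl.
    by apply: h; exact: measurable_cyl.
pose mS := isMeasurableFun.Build _ _ _ _ _ measurable_step.
pose Sf : {mfun (config * config)%type >-> config} :=
  HB.pack (fun z : config * config => step z.1 z.2) mS.
suff H s b : distribution (mu \x P)%E Sf (cyl s b) = mu (cyl s b).
  exact: (@probability_ext R (distribution (mu \x P)%E Sf) mu H A mA).
rewrite -[RHS]E_icyl -h; last by exists s; exact: dep_icyl.
by rewrite -product_step.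
Qed.

End two_configurations.

(** * The Markov property, mixing and stationarity *)

Section resampling.
Context {R : realType}.
Implicit Types (m P : probability config R) (d : R).

Lemma icyl_upd (s : seq int) b i c (w : config) : i \notin s ->
  icyl (i :: s) b (upd w i c) = (c == b i)%:R * icyl s b w :> R.
Proof.
move=> si; rewrite /icyl /= updE; rewrite (@eq_in_all _ _ (fun j => w j == b j)).
  by case: (_ == _) => /=; rewrite ?mul1r ?mul0r.
by move=> j js; rewrite upd_neq //; apply: contraNneq si => <-.
Qed.

Lemma loc_upd (f : config -> R) i c : loc f -> loc (fun w => f (upd w i c)).
Proof.
move=> [s df]; exists s; apply: dep_upd; apply: dep_sub df => j.
by rewrite inE orbC => ->.
Qed.

Lemma coin_resample P f i : fair_coins P -> loc f ->
  E P f = 2^-1 * (E P (fun w => f (upd w i false)) + E P (fun w => f (upd w i true))).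
Proof.
move=> /fair_coinsP fP [s df].
pose t := i :: undup [seq j <- s | j != i].
have it : i \notin undup [seq j <- s | j != i].
  by rewrite mem_undup mem_filter /= eqxx.
have {}df : dep t f.
  apply: dep_sub df => j js; rewrite inE mem_undup mem_filter /= js andbT.
  by case: eqP.
have tl (g : config -> R) : dep t g -> loc g by move=> dg; exists t.
apply: (icyl_ind (Pr := fun f => E P f = 2^-1 *
  (E P (fun w => f (upd w i false)) + E P (fun w => f (upd w i true)))) _ _ _ df).
- move=> g h /tl lg /tl lh Hg Hh; rewrite E_add // Hg Hh.
  by rewrite !E_add; try exact: loc_upd; ring.
- move=> r g /tl lg Hg; rewrite E_scale // Hg.
  by rewrite !E_scale; try exact: loc_upd; ring.
- move=> b; rewrite fP /= ?undup_uniq ?it //.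
  have H c : E P (fun w => icyl t b (upd w i c)) =
      (c == b i)%:R * 2^-1 ^+ size (undup [seq j <- s | j != i]).
    under eq_fun do rewrite icyl_upd //.
    rewrite E_scale ?fP ?undup_uniq //.
    by eexists; exact: dep_icyl.
  by rewrite !H exprS; case: (b i) => /=; ring.
Qed.

(** For [f] depending on sites up to [i + 1], the conditional expectation given the sites up to [i]:
    site [i + 1] is redrawn from site [i]. *)
Definition resample d (i : int) (f : config -> R) : config -> R := fun x =>
  qtrans d (x i) false * f (upd x (i + 1) false) +
  qtrans d (x i) true * f (upd x (i + 1) true).

(** The Markov property in integrated form. On a window ending at [i + 1] a cylinder probability is
    that of the shorter window times the last transition, and linearity does the rest. *)
Lemma markov_resample d m i s f : markov_windows d m -> dep s f ->
  {in s, forall j, j <= i + 1} -> E m f = E m (resample d i f).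
Proof.
move=> hm df si.
have [a [k [sa ak]]] : exists a k, {subset s <= window a k.+2} /\ a + k%:Z = i.
  have [a [k sak]] := window_cover (i :: s).
  have /= := sak i; rewrite inE eqxx mem_window => /(_ isT) ai.
  exists a, `|i - a|%N; split; last by lia.
  move=> j js; have := sak j; rewrite inE js orbT mem_window => /(_ isT).
  by rewrite mem_window; have := si _ js; lia.
have {si sa}df : dep (window a k.+2) f by apply: dep_sub df.
have tl (g : config -> R) : dep (window a k.+2) g -> loc g.
  by move=> dg; exists (window a k.+2).
have lq c : loc (fun x : config => qtrans d (x i) c).
  by exists [:: i] => x x' xx; rewrite (xx i) // inE.
have lr g : loc g -> loc (resample d i g).
  by move=> lg; apply: loc_op2; apply: loc_op2 => //; exact: loc_upd.
apply: (icyl_ind (Pr := fun f => E m f = E m (resample d i f)) _ _ _ df).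
- move=> g h /tl lg /tl lh Hg Hh; rewrite E_add // Hg Hh -E_add; try exact: lr.
  by congr E; apply/funext => x; rewrite /resample; ring.
- move=> r g /tl lg Hg; rewrite E_scale // Hg -E_scale; try exact: lr.
  by congr E; apply/funext => x; rewrite /resample; ring.
- move=> b; rewrite hm markov_weight_recr -hm ak.
  have wr : window a k.+2 =i (i + 1) :: window a k.+1.
    by move=> j; rewrite window_recr; congr (j \in _ :: _); lia.
  rewrite (icyl_mem _ wr) mulrC -E_scale; last by eexists; exact: dep_icyl.
  have iw : i + 1 \notin window a k.+1 by rewrite mem_window; lia.
  congr E; apply/funext => x; rewrite /resample !icyl_upd //.
  rewrite /icyl; case: allP => [/(_ i)|_]; last by rewrite !mulr0 addr0.
  rewrite mem_window => H; have /eqP -> : x i == b i by apply: H; lia.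
  by case: (b (i + 1)) => /=; ring.
Qed.

Lemma markov_initial d m i (h : bool -> R) : markov_windows d m ->
  E m (fun x => h (x i)) = pinit d false * h false + pinit d true * h true.
Proof.
move=> hm; have H c : E m (fun x => (x i == c)%:R) = pinit d c.
  have := hm i 0%N (fun=> c); rewrite /markov_weight big_ord0 mulr1 => <-.
  by congr E; apply/funext => x; rewrite /icyl /= addr0 andbT.
have lc c : loc (fun x : config => (x i == c)%:R : R).
  by exists [:: i] => x x' xx; rewrite (xx i) // inE.
rewrite -!H mulrC (mulrC (E m _)) -!E_scale // -E_add.
- congr E; apply/funext => x.
  by case: (x i) => /=; ring.
- by apply: loc_op2 => //; exact: loc_cst.
- by apply: loc_op2 => //; exact: loc_cst.
Qed.

Lemma markov_windows_invariant d m : markov_windows d m -> translation_invariant m.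
Proof.
move=> hm; apply/translation_invariantP => f [s df].
have [a [k sak]] := window_cover s.
have {df}df : dep (window a k.+1) f.
  by apply: dep_sub df => i /sak; rewrite !mem_window; lia.
have tl (g : config -> R) : dep (window a k.+1) g -> loc g.
  by move=> dg; exists (window a k.+1).
apply: (icyl_ind (Pr := fun f => E m (f \o Defs.shift) = E m f) _ _ _ df).
- move=> g h /tl lg /tl lh Hg Hh; rewrite [RHS]E_add // -Hg -Hh -E_add //.
    exact: (@loc_tr _ g 1 lg).
  exact: (@loc_tr _ h 1 lh).
- move=> r g /tl lg Hg; rewrite [RHS]E_scale // -Hg -E_scale //.
  exact: (@loc_tr _ g 1 lg).
- move=> b; rewrite hm.
  rewrite (_ : icyl _ b \o _ = icyl (window (a + 1) k.+1) (fun i => b (i - 1))).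
    rewrite hm /markov_weight addrK; congr (_ * _); apply: eq_bigr => j _.
    by congr (qtrans d (b _) (b _)); lia.
  apply/funext => x; rewrite /icyl /comp; congr (nat_of_bool _)%:R.
  apply/idP/idP => /allP h; apply/allP => j; rewrite mem_window => jw.
    rewrite -{1}[j](subrK 1); apply: (h (j - 1)).
    by rewrite mem_window; lia.
  have := h (j + 1); rewrite addrK; apply; rewrite mem_window; lia.
Qed.

(** The definition prescribes only windows that start at 0 and have at least two sites. A single
    site is obtained by summing out its neighbour, other positions by translation. *)
Lemma is_markovP d m : 0 <= d <= 1 -> is_markov d m <-> markov_windows d m.
Proof.
move=> d01; split=> [[ti h]|hm].
  have h0 k b : E m (icyl (window 0 k.+2) b) = markov_weight d b 0 k.+1.
    apply: EFin_inj; rewrite E_icyl.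
    have := h k.+1 (b \o Posz) isT; rewrite /markov_weight /=.
    rewrite (eq_bigr (fun j : 'I_k.+1 => qtrans d (b (0 + j%:Z)) (b (0 + j%:Z + 1)))).
      move=> <-; congr (m _); apply/seteqP; split => x /= H.
        by move=> j jk; apply: H; rewrite mem_window; lia.
      by move=> j; rewrite mem_window; case: j.
    by move=> j _; rewrite /= add0r; congr (qtrans _ _ (b _)); lia.
  have hr k b : E m (icyl (window 0 k.+1) b) = markov_weight d b 0 k.
    case: k => [|k]; last exact: h0.
    rewrite (@E_icyl_split _ _ _ _ 1); last by rewrite mem_window.
    have wr : 1 :: window 0 1 =i window 0 2.
      by move=> i; rewrite in_cons !mem_window; apply/idP/idP; lia.
    rewrite !(icyl_mem _ wr) !h0 /markov_weight !big_ord1 big_ord0 /=.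
    have u0 c : upd b 1 c 0 = b 0 by rewrite upd_neq.
    by rewrite !addr0 !add0r !u0 !updE -mulrDr qtrans_row //.
  move=> a k b; rewrite -(@E_tr _ m (- a)) //; last by eexists; exact: dep_icyl.
  rewrite (_ : icyl _ b \o _ = icyl (window 0 k.+1) (fun i => b (i + a))).
    rewrite hr /markov_weight add0r; congr (_ * _); apply: eq_bigr => j _.
    by congr (qtrans d (b _) (b _)); lia.
  apply/funext => x; rewrite /icyl /comp; congr (nat_of_bool _)%:R.
  apply/idP/idP => /allP h'; apply/allP => j; rewrite mem_window => jw.
    by have := h' (j + a); rewrite /tr addrK; apply; rewrite mem_window; lia.
  have := h' (j - a); rewrite subrK; apply; rewrite mem_window; lia.
split; first exact: markov_windows_invariant hm.
move=> k b k1.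
have := hm 0 k (fun i => b (absz i)); rewrite /markov_weight /= => bE.
rewrite (_ : [set x | _] = cyl (window 0 k.+1) (fun i => b (absz i))).
  rewrite -E_icyl bE; congr ((_ * _)%:E); apply: eq_bigr => j _.
  by congr (qtrans d (b _) (b _)); lia.
apply/seteqP; split => x /= H.
  by move=> j; rewrite mem_window; case: j => // j; exact: H.
by move=> j jk; rewrite (H j) // mem_window; lia.
Qed.

End resampling.

Section mixing.
Context {R : realType}.
Variables (d : R) (m : probability config R).
Hypotheses (d01 : 0 <= d <= 1) (hm : markov_windows d m).

Definition past (T : Type) (i : int) (f : config -> T) :=
  exists2 s, dep s f & {in s, forall j, j <= i}.

Lemma past_loc i (f : config -> R) : past i f -> loc f.
Proof. by move=> [s df _]; exists s. Qed.

Lemma past_upd (T : Type) i j c (f : config -> T) x : past i f -> i < j ->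
  f (upd x j c) = f x.
Proof.
move=> [s df si] ij; apply: df => k /si ki; rewrite upd_neq //.
by apply/eqP; lia.
Qed.

Lemma past_op2 (T U V : Type) (o : T -> U -> V) i (f : config -> T)
    (g : config -> U) : past i f -> past i g -> past i (fun x => o (f x) (g x)).
Proof.
move=> [s df si] [t dg ti]; exists (s ++ t).
  move=> x y xy; congr o.
    by apply: df => k ks; apply: xy; rewrite mem_cat ks.
  by apply: dg => k ks; apply: xy; rewrite mem_cat ks orbT.
by move=> k; rewrite mem_cat => /orP[/si|/ti].
Qed.

Lemma past_le (T : Type) i j (f : config -> T) : i <= j -> past i f -> past j f.
Proof. by move=> ij [s df si]; exists s => // k /si; lia. Qed.

Lemma past_site (T : Type) i j (h : bool -> T) : j <= i ->
  past i (fun x : config => h (x j)).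
Proof.
move=> ji; exists [:: j] => [x y xy|k]; first by rewrite xy ?inE.
by rewrite inE => /eqP ->.
Qed.

Let qg b := qtrans_ge0 d01 b.

Lemma resample_unit i h : (forall x, 0 <= h x <= 1) ->
  forall x, 0 <= resample d i h x <= 1.
Proof.
move=> h01 x; rewrite /resample.
have /andP[a0 a1] := h01 (upd x (i + 1) false).
have /andP[b0 b1] := h01 (upd x (i + 1) true).
have := qg (x i) false; have := qg (x i) true; have := qtrans_row d01 (x i).
by move=> r q1 q0; apply/andP; split; nra.
Qed.

Lemma E_past_resample i (f h : config -> R) : past i f -> past (i + 1) h ->
  E m (fun x => f x * h x) = E m (fun x => f x * resample d i h x).
Proof.
move=> pf ph.
have [s ds si] := past_op2 *%R (past_le (ltW (ltrDl _ _ : i < i + 1)) pf) ph.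
rewrite (markov_resample hm ds si); congr E; apply/funext => x.
rewrite /resample !(past_upd _ _ pf) ?ltrDl //; ring.
Qed.

(** Integrating out the sites from the right end inwards leaves a function of the site [i] alone,
    namely the conditional expectation of [h] given the past. *)
Lemma markov_project i k h : dep (window i k.+1) h ->
  (forall x, 0 <= h x <= 1) ->
  exists g : bool -> R, (forall b, 0 <= g b <= 1) /\
    forall f, past i f -> E m (fun x => f x * h x) = E m (fun x => f x * g (x i)).
Proof.
elim: k h => [|k IH] h dh h01.
  exists (fun b => h (fun=> b)); split=> [b|f pf]; first exact: h01.
  congr E; apply/funext => x; congr (_ * _); apply: dh => j.
  by rewrite mem_window => ji; congr (x _); lia.
have [|x|g [g01 Hg]] := IH (resample d (i + k%:Z) h).
- move=> x y xy; rewrite /resample (xy (i + k%:Z)); last by rewrite mem_window; lia.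
  have H c : h (upd x (i + k%:Z + 1) c) = h (upd y (i + k%:Z + 1) c).
    apply: dh => j; rewrite mem_window /upd; case: eqP => // ji jw.
    by apply: xy; rewrite mem_window; lia.
  by rewrite !H.
- exact: resample_unit.
exists g; split=> // f pf; rewrite -Hg // -E_past_resample //.
  by apply: past_le pf; lia.
by exists (window i k.+2) => // j; rewrite mem_window; lia.
Qed.

(** Each transition multiplies the oscillation by [|q(0,1) - q(1,1)|], at most 1/2 by
    [qtrans_contraction]. *)
Lemma markov_gap i j (g : bool -> R) : (forall b, 0 <= g b <= 1) ->
  exists g' : bool -> R, [/\ forall b, 0 <= g' b <= 1,
    `|g' false - g' true| <= 2^-1 ^+ j &
    forall f, past i f ->
      E m (fun x => f x * g (x (i + j%:Z))) = E m (fun x => f x * g' (x i))].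
Proof.
elim: j i g => [|j IH] i g g01.
  exists g; split=> //; last by move=> f _; rewrite addr0.
  have /andP[a0 a1] := g01 false; have /andP[b0 b1] := g01 true.
  by rewrite expr0 ler_norml; lra.
have [g' [g'01 g'd Hg']] := IH (i + 1) _ g01.
pose h b := qtrans d b false * g' false + qtrans d b true * g' true.
have hE b : h b = g' false + qtrans d b true * (g' true - g' false).
  by rewrite /h; have := qtrans_row d01 b; move=> /(canRL (addrK _)) ->; ring.
exists h; split.
- move=> b; have /andP[a0 a1] := g'01 false; have /andP[b0 b1] := g'01 true.
  have := qg b false; have := qg b true; have := qtrans_row d01 b; rewrite /h.
  by move=> r q1 q0; apply/andP; split; nra.
- rewrite !hE (_ : _ - _ = (qtrans d false true - qtrans d true true) *
     (g' true - g' false)); last by ring.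
  rewrite normrM exprS ler_pM // ?qtrans_contraction // distrC //.
move=> f pf; rewrite (_ : i + j.+1%:Z = i + 1 + j%:Z); last by lia.
rewrite Hg'; last by apply: past_le pf; lia.
rewrite (@E_past_resample i f (fun x => g' (x (i + 1))) pf); last exact: past_site.
by congr E; apply/funext => x; rewrite /resample !updE.
Qed.

(** Given the past up to [i], [h] becomes a function of [x i] with oscillation at most [2^-j]; such
    a function stays within its oscillation of its mean. *)
Lemma markov_mixing i j k f h : past i f -> dep (window (i + j%:Z) k.+1) h ->
  (forall x, 0 <= f x <= 1) -> (forall x, 0 <= h x <= 1) ->
  `|E m (fun x => f x * h x) - E m f * E m h| <= 2^-1 ^+ j.
Proof.
move=> pf dh f01 h01.
have [g [g01 Hg]] := markov_project dh h01.
have [g' [g'01 g'd Hg']] := markov_gap i j g01.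
have H f' : past i f' -> E m (fun x => f' x * h x) = E m (fun x => f' x * g' (x i)).
  by move=> pf'; rewrite -Hg' // -Hg //; apply: past_le pf'; lia.
have hE : E m h = E m (fun x => g' (x i)).
  have := H (fun=> 1); rewrite (_ : (fun x => 1 * h x) = h); last first.
    by apply/funext => x; rewrite mul1r.
  move=> ->; last by exists [::].
  by congr E; apply/funext => x; rewrite mul1r.
rewrite (H f) // hE (markov_initial i g' hm).
have := pinit_ge0 d01 false; have := pinit_ge0 d01 true; have := pinit_sum d.
set p0 := pinit d false; set p1 := pinit d true => p01 p1_ge0 p0_ge0.
set c := p0 * _ + _.
have lf := past_loc pf.
have lg : loc (fun x : config => g' (x i)).
  exact: past_loc (past_site g' (lexx i)).
have l1 : loc (fun x => f x * g' (x i)) by exact: loc_op2.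
have l2 : loc (fun x => c * f x) by apply: loc_op2 => //; exact: loc_cst.
rewrite [_ * c]mulrC -(E_scale _ _ lf) -(E_sub _ l1 l2).
have gc b : `|g' b - c| <= 2^-1 ^+ j.
  apply: le_trans g'd; rewrite /c.
  have -> : p0 = 1 - p1 by lra.
  case: b.
    rewrite (_ : _ - _ = (p1 - 1) * (g' false - g' true)); last by ring.
    by rewrite normrM ler_piMl // ler_norml; apply/andP; split; lra.
  rewrite (_ : _ - _ = p1 * (g' false - g' true)); last by ring.
  by rewrite normrM ler_piMl // ler_norml; apply/andP; split; lra.
have lz : loc (fun x => f x * g' (x i) - c * f x).
  exact: (loc_op2 (fun a b => a - b) l1 l2).
have b1 x : `|f x * g' (x i) - c * f x| <= 2^-1 ^+ j.
  rewrite (mulrC c) -mulrBr normrM; have /andP[f0 f1] := f01 x.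
  by rewrite (ger0_norm f0) -[leRHS]mul1r ler_pM.
rewrite ler_norml; apply/andP; split.
  rewrite -(E_cst m (- _)); apply: E_le => //; first exact: loc_cst.
  by move=> x; have := b1 x; rewrite ler_norml => /andP[].
rewrite -[leRHS](E_cst m); apply: E_le => //; first exact: loc_cst.
by move=> x; have := b1 x; rewrite ler_norml => /andP[].
Qed.

End mixing.

(** * Stationarity of the Markov measures by transfer matrices *)

Section markov_stationary.
Context {R : realType}.
Variables (d : R) (m P : probability config R).
Hypotheses (d01 : 0 <= d <= 1) (hm : markov_windows d m) (fP : fair_coins P).

(* Transfer matrices for the joint chain (x_i, w_(i-1)): given x_i = a and the
   jump j across the bond (i-1,i), [fwd l a j] is the probability that the
   updated configuration reads [l] at i, i+1, ... *)
Fixpoint fwd (l : seq bool) (a j : bool) : R :=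
  if l is b :: l' then
    \sum_(c : bool) \sum_(e : bool) qtrans d a c / 2 *
      ((b == (if [&& a, ~~ c & e] then false else if j then true else a))%:R *
      fwd l' c [&& a, ~~ c & e])
  else 1.

Fixpoint reads (i : int) (l : seq bool) (x w : config) : bool :=
  if l is b :: l' then (step x w i == b) && reads (i + 1) l' x w else true.

Lemma reads_window k i b x w :
  reads i [seq b j | j <- window i k] x w =
  all (fun j => step x w j == b j) (window i k).
Proof. by elim: k i => // k IH i; rewrite window_recl /= IH. Qed.

(** What a scan from the left knows on reaching site [i]: the occupations up to [i] and the coins of
    bonds ending at or before [i], whose indices are at most [i - 1]. *)
Definition past2 (i : int) (F : config -> config -> R) :=
  exists s t : seq int, [/\ forall x x' w w' : config,
    {in s, x =1 x'} -> {in t, w =1 w'} -> F x w = F x' w', {in s, forall j, j <= i} & {in t, forall j, j <= i - 1}].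

Lemma past2_loc i F : past2 i F -> loc2 F.
Proof.
move=> [s [t [dF _ _]]]; exists (s ++ t) => x x' w w' xx ww.
by apply: dF => j js; [apply: xx|apply: ww]; rewrite mem_cat js ?orbT.
Qed.

Lemma past2_mul i F G : past2 i F -> past2 i G ->
  past2 i (fun x w => F x w * G x w).
Proof.
move=> [s [t [dF sF tF]]] [s' [t' [dG sG tG]]].
exists (s ++ s'), (t ++ t'); split.
- move=> x x' w w' xx ww; congr (_ * _).
    by apply: dF => j js; [apply: xx|apply: ww]; rewrite mem_cat js.
  by apply: dG => j js; [apply: xx|apply: ww]; rewrite mem_cat js orbT.
- by move=> j; rewrite mem_cat => /orP[/sF|/sG].
- by move=> j; rewrite mem_cat => /orP[/tF|/tG].
Qed.

Lemma past2_le i j F : i <= j -> past2 i F -> past2 j F.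
Proof.
move=> ij [s [t [dF sF tF]]]; exists s, t; split=> // k.
  by move=> /sF; lia.
by move=> /tF; lia.
Qed.

Lemma joint_resample i F : past2 (i + 1) F ->
  E m (fun x => E P (F x)) = E m (fun x => E P (fun w =>
    \sum_(c : bool) \sum_(e : bool) qtrans d (x i) c / 2 *
      F (upd x (i + 1) c) (upd w i e))).
Proof.
move=> pF; have lF := past2_loc pF; have [s [t [dF sF _]]] := pF.
have dE : dep s (fun x => E P (F x)).
  by move=> x y xy; congr E; apply/funext => w; exact: dF.
rewrite (markov_resample hm dE sF); congr E; apply/funext => x; rewrite /resample.
have lu c e : loc (fun w => F (upd x (i + 1) c) (upd w i e)).
  exact: (loc_upd (f := F (upd x (i + 1) c)) i e (loc2_r _ lF)).
have lq r c e : loc (fun w => r * F (upd x (i + 1) c) (upd w i e)).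
  by apply: loc_op2 => //; exact: loc_cst.
rewrite E_sum; last by move=> c; exact: loc_sum.
rewrite big_bool !E_sum // !big_bool !E_scale //.
rewrite !(coin_resample (f := F _) i fP); try exact: loc2_r.
by rewrite /=; field.
Qed.

(** Along a scan from left to right, the pair formed by [x i] and the jump across [(i - 1, i)] is
    Markovian: to move on it only needs a fresh site and a fresh coin, supplied by
    [joint_resample]. *)
Lemma joint_transfer l i F : past2 i F ->
  E m (fun x => E P (fun w => F x w * (reads i l x w)%:R)) =
  E m (fun x => E P (fun w => F x w * fwd l (x i) (jumps x w (i - 1)))).
Proof.
elim: l i F => [|b l IH] i F pF //=.
pose G x w : R := (step x w i == b)%:R.
have pG : past2 (i + 1) G.
  exists [:: i - 1; i; i + 1], [:: i - 1; i]; split.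
  - move=> x x' w w' xx ww; rewrite /G /step /jumps subrK.
    by rewrite !(xx (i - 1), xx i, xx (i + 1), ww (i - 1), ww i) // !inE eqxx ?orbT.
  - by move=> j; rewrite !inE => /or3P[] /eqP ->; lia.
  - by move=> j; rewrite !inE => /orP[] /eqP ->; lia.
have pF' : past2 (i + 1) F by apply: past2_le pF; lia.
have := IH (i + 1) _ (past2_mul pF' pG).
rewrite addrK; set L := E m _; set M := E m _ => LM.
transitivity L.
  congr E; apply/funext => x; congr E; apply/funext => w.
  by rewrite -mulrA /G -natrM mulnb.
rewrite LM /M.
pose H x w := F x w * G x w * fwd l (x (i + 1)) (jumps x w i).
have pH : past2 (i + 1) H.
  apply: past2_mul; first exact: past2_mul.
  exists [:: i; i + 1], [:: i]; split.
  - move=> x x' w w' xx ww; rewrite /jumps.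
    by rewrite !(xx i, xx (i + 1), ww i) // !inE eqxx ?orbT.
  - by move=> j; rewrite !inE => /orP[] /eqP ->; lia.
  - by move=> j; rewrite !inE => /eqP ->; lia.
rewrite (joint_resample pH); congr E; apply/funext => x; congr E.
apply/funext => w; rewrite mulr_sumr; apply: eq_bigr => c _.
rewrite mulr_sumr; apply: eq_bigr => e _; rewrite /H.
have -> : F (upd x (i + 1) c) (upd w i e) = F x w.
  have [s [t [dF sF tF]]] := pF; apply: dF => j js; rewrite upd_neq //.
    by apply/eqP; have := sF _ js; lia.
  by apply/eqP; have := tF _ js; lia.
have -> : jumps (upd x (i + 1) c) (upd w i e) i = [&& x i, ~~ c & e].
  by rewrite /jumps !updE upd_neq //; apply/eqP; lia.
have -> : G (upd x (i + 1) c) (upd w i e) =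
    (b == (if [&& x i, ~~ c & e] then false else
      if jumps x w (i - 1) then true else x i))%:R.
  rewrite /G eq_sym /step /jumps subrK !updE !upd_neq //; apply/eqP; lia.
by rewrite updE; ring.
Qed.

Let alpha := qtrans d false true.
Let beta := qtrans d true false.
(** Probabilities that the updated configuration reads [l] to the right of a site: [A] given a hole
    there, [B] given a particle and jointly with its not jumping, [C] given a particle and jointly
    with its jumping. *)
Let A l := alpha * fwd l true false + qtrans d false false * fwd l false false.
Let B l := qtrans d true true * fwd l true false + beta / 2 * fwd l false false.
Let C l := beta / 2 * fwd l false true.

Let A_cons b l :
  A (b :: l) = alpha * (if b then B l else C l) +
    qtrans d false false * (if b then 0 else A l).
Proof. by rewrite /A /B /C /= !big_bool /= /alpha /beta; case: b => /=; field. Qed.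

Let B_cons b l :
  B (b :: l) = qtrans d true true * (if b then B l else C l) +
    beta / 2 * (if b then 0 else A l).
Proof. by rewrite /A /B /C /= !big_bool /= /alpha /beta; case: b => /=; field. Qed.

Let C_cons b l : C (b :: l) = beta / 2 * (if b then A l else 0).
Proof. by rewrite /A /B /C /= !big_bool /= /alpha /beta; case: b => /=; field. Qed.

Fixpoint qprod (b : bool) (l : seq bool) : R :=
  if l is c :: l' then qtrans d b c * qprod c l' else 1.

Let ABC b l : [/\ A (b :: l) = qtrans d true b * qprod b l,
  B (b :: l) = (if b then qtrans d true true * (1 - beta / 2)
                else (1 + qtrans d true true) * (beta / 2)) * qprod b l &
  C (b :: l) = (if b then beta / 2 else 0) * qprod b l].
Proof.
have := qtrans_rel d01; have := qtrans_row d01 true; have := qtrans_row d01 false.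
have := qtrans_ge0 d01 false false; rewrite -/alpha -/beta.
set q00 := qtrans d false false; set q11 := qtrans d true true => q00_ge0.
move=> r0 r1 rel.
have hq0 : q00 = 1 - alpha by lra.
have hq1 : q11 = 1 - beta by lra.
have ha : 2 - alpha != 0 by rewrite gt_eqF //; lra.
(* [qtrans_rel] solved for [beta], which turns every case into a rational identity in [alpha]. *)
have hb : beta = 2 * (1 - alpha) / (2 - alpha).
  by apply: (mulIf ha); rewrite divfK //; lra.
elim: l b => [|c l IH] b; rewrite (A_cons b) (B_cons b) (C_cons b).
  rewrite /A /B /C /= -/q00 -/q11 hq0 hq1 hb.
  by case: b; rewrite -/q11 -/beta ?hq1 ?hb; split; field.
have [-> -> ->] := IH c; rewrite /=; set Q := qprod c l.
case: b c Q {IH} => [] [] Q /=; rewrite -?/q11 -?/q00 -?/alpha -?/beta;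
  by rewrite ?hq0 ?hq1 hb; split; field.
Qed.

(** The reading at [i] also depends on a possible jump from [i - 1], so this site is averaged over
    as well: a hole there contributes [A], a particle [B + C]. *)
Lemma markov_step_reads b l i :
  E m (fun x => E P (fun w => (reads i (b :: l) x w)%:R)) = pinit d b * qprod b l.
Proof.
have p1 : past2 i (fun _ _ => 1) by exists [::], [::]; split.
have := @joint_transfer (b :: l) i _ p1.
under eq_fun do under eq_fun do rewrite mul1r.
move=> ->.
pose H (x w : config) : R := 1 * fwd (b :: l) (x i) (jumps x w (i - 1)).
have pH : past2 (i - 1 + 1) H.
  exists [:: i - 1; i], [:: i - 1]; split.
  - move=> x x' w w' xx ww; rewrite /H /jumps subrK.
    by rewrite !(xx i, xx (i - 1), ww (i - 1)) // !inE eqxx ?orbT.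
  - by move=> j; rewrite !inE => /orP[] /eqP ->; lia.
  - by move=> j; rewrite !inE => /eqP ->; lia.
rewrite (joint_resample pH).
pose h a := \sum_(c : bool) \sum_(e : bool) qtrans d a c / 2 *
   fwd (b :: l) c [&& a, ~~ c & e].
rewrite (_ : (fun x => _) = fun x : config => h (x (i - 1))); last first.
  apply/funext => x; rewrite -(E_cst P (h _)); congr E; apply/funext => w.
  apply: eq_bigr => c _; apply: eq_bigr => e _.
  rewrite /H mul1r /jumps subrK !updE upd_neq //.
  by apply/eqP; lia.
rewrite (markov_initial (i - 1) h hm).
have [AE BE CE] := ABC b l.
have -> : h false = A (b :: l).
  by rewrite /h; move: (b :: l) => k; rewrite !big_bool /= /A /alpha; field.
have -> : h true = B (b :: l) + C (b :: l).
  by rewrite /h; move: (b :: l) => k; rewrite !big_bool /= /B /C /beta; field.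
rewrite AE BE CE.
have := qtrans_row d01 true; have := qtrans_reversible d01 true false.
have := qtrans_row d01 false; have := qtrans_rel d01.
rewrite -/alpha -/beta => rel r0 rev r1.
(* Conservation of density: the left side is the probability of a hole after the step. *)
have key : beta - d * beta * beta / 2 = 1 - d.
  have /= -> := rev; rewrite -/alpha.
  rewrite (_ : (1 - d) * alpha * beta / 2 = (1 - d) * (alpha * beta / 2)); last by field.
  have -> : alpha * beta / 2 = alpha + beta - 1 by lra.
  by move: rev; rewrite /= -/alpha -/beta; lra.
have -> : qtrans d true true = 1 - beta by lra.
case: b {H pH h AE BE CE p1} => /=; rewrite -/beta; set Q := qprod _ _.
  have -> : qtrans d true true = 1 - beta by lra.
  by rewrite [in RHS](_ : d = 1 - (beta - d * beta * beta / 2)); [field|lra].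
by rewrite -[in RHS]key; field.
Qed.

Lemma markov_weight_qprod k i b :
  markov_weight d b i k = pinit d (b i) * qprod (b i) [seq b j | j <- window (i + 1) k].
Proof.
rewrite /markov_weight; congr (_ * _).
elim: k i => [|k IH] i; first by rewrite big_ord0.
rewrite big_ord_recl window_recl /= -IH addr0; congr (_ * _).
by apply: eq_bigr => j _; rewrite /bump leq0n /= PoszD addrA.
Qed.

Lemma markov_stationary f : loc f ->
  E m (fun x => E P (fun w => f (step x w))) = E m f.
Proof.
move=> [s df]; have [a [k sak]] := window_cover s.
have {df}df : dep (window a k.+1) f.
  by apply: dep_sub df => i /sak; rewrite !mem_window; lia.
have tl (g : config -> R) : dep (window a k.+1) g -> loc g.
  by move=> dg; exists (window a k.+1).
have lr (g : config -> R) x : dep (window a k.+1) g -> loc (fun w => g (step x w)).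
  by move=> /tl lg; exact: loc2_r (loc_step lg).
have lr' (g : config -> R) : dep (window a k.+1) g ->
    loc (fun x => E P (fun w => g (step x w))).
  by move=> /tl lg; apply: loc2_E; exact: loc_step.
apply: (icyl_ind (Pr := fun f => E m (fun x => E P (fun w => f (step x w))) = E m f)
  _ _ _ df).
- move=> g h dg dh Hg Hh; rewrite [RHS](E_add _ (tl _ dg) (tl _ dh)).
  rewrite -Hg -Hh -(E_add _ (lr' _ dg) (lr' _ dh)).
  by congr E; apply/funext => x; rewrite (E_add P (lr _ x dg) (lr _ x dh)).
- move=> r g dg Hg; rewrite [RHS](E_scale _ _ (tl _ dg)).
  rewrite -Hg -(E_scale _ _ (lr' _ dg)).
  by congr E; apply/funext => x; rewrite (E_scale P _ (lr _ x dg)).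
- move=> b; rewrite hm markov_weight_qprod -(markov_step_reads _ _ a).
  congr E; apply/funext => x; congr E; apply/funext => w.
  rewrite /icyl; congr (nat_of_bool _)%:R.
  by rewrite -reads_window window_recl.
Qed.

End markov_stationary.

(** * A coupling in which discrepancies never increase *)

Definition act (x : config) (k : int) : bool := x k && ~~ x (k + 1).

(* Bonds active for exactly one of [x], [y] form chains in which the two
   configurations alternate; [lnk k] says that [k, k+1] are the first two bonds
   of such a chain. *)
Definition lnk (x y : config) (k : int) : bool :=
  [&& act x k, act y (k + 1) & ~~ act y (k - 1)] ||
  [&& act y k, act x (k + 1) & ~~ act x (k - 1)].

(* With independent coins an alternating chain could jump everywhere at once and
   create discrepancies; opposite coins on its first two bonds exclude this. *)
Definition coin (x y w : config) : config := fun k =>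
  if lnk x y (k - 1) then ~~ w (k - 1) else w k.

Definition cstep (x y w : config) : config := step x (coin x y w).

Lemma lnkC x y : lnk x y =1 lnk y x.
Proof. by move=> k; rewrite /lnk orbC. Qed.

Lemma coinC x y w : coin x y w = coin y x w.
Proof. by apply/funext => k; rewrite /coin lnkC. Qed.

Lemma act_tr a x k : act (tr a x) k = act x (k + a).
Proof. by rewrite /act /tr addrAC. Qed.

Lemma lnk_tr a x y k : lnk (tr a x) (tr a y) k = lnk x y (k + a).
Proof. by rewrite /lnk !act_tr !(addrAC _ _ a). Qed.

Lemma cstep_tr a x y w : cstep (tr a x) (tr a y) (tr a w) = tr a (cstep x y w).
Proof.
apply/funext => k; rewrite /cstep /tr /step /jumps /coin !lnk_tr /tr.
by rewrite !(addrAC _ _ a).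
Qed.

(** A pair starting at [k + 1] would have to begin a chain, but bond [k] already precedes it in
    alternation. Disjoint pairs are what keeps each marginal coin law fair. *)
Lemma lnk_disjoint x y k : lnk x y k -> lnk x y (k + 1) = false.
Proof.
rewrite /lnk /act !subrK (addrK 1 k) => /orP[] /and3P[/andP[h1 h2] /andP[h3 h4] h5];
  by rewrite ?h1 ?h2 ?h3 ?h4 ?(negbTE h2) ?(negbTE h4) /= ?andbF ?orbF ?andbF.
Qed.

(** A generous range, the same for all purposes, containing every site and coin inspected by an
    update or a flux at [i]. *)
Definition around (s : seq int) := flatten [seq window (i - 4) 9 | i <- s].

Lemma around_dep (s : seq int) i x x' y y' w w' : i \in s ->
  {in around s, x =1 x'} -> {in around s, y =1 y'} -> {in around s, w =1 w'} ->
  [/\ forall j, i - 4 <= j < i + 5 -> x j = x' j /\ y j = y' j,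
      forall j, i - 4 <= j < i + 4 -> act x j = act x' j /\ act y j = act y' j,
      forall j, i - 3 <= j < i + 3 -> lnk x y j = lnk x' y' j &
      forall j, i - 2 <= j < i + 3 -> coin x y w j = coin x' y' w' j].
Proof.
move=> si xx yy ww.
have N (z z' : config) (j : int) : {in around s, z =1 z'} ->
    i - 4 <= j < i + 5 -> z j = z' j.
  move=> zz ij; apply: zz; apply/flatten_mapP; exists i => //.
  by rewrite mem_window; lia.
have ax (z z' : config) j : {in around s, z =1 z'} ->
    i - 4 <= j < i + 4 -> act z j = act z' j.
  by move=> zz ij; rewrite /act !(N _ _ _ zz) //; lia.
have al j : i - 3 <= j < i + 3 -> lnk x y j = lnk x' y' j.
  by move=> ij; rewrite /lnk !(ax _ _ _ xx) ?(ax _ _ _ yy) //; lia.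
split=> // j ij.
- by rewrite (N _ _ _ xx ij) (N _ _ _ yy ij).
- by rewrite (ax _ _ _ xx ij) (ax _ _ _ yy ij).
- by rewrite /coin al ?(N _ _ _ ww) //; lia.
Qed.

Lemma cstep_dep s x x' y y' w w' : {in around s, x =1 x'} ->
  {in around s, y =1 y'} -> {in around s, w =1 w'} ->
  {in s, cstep x y w =1 cstep x' y' w'}.
Proof.
move=> xx yy ww i si; have [N _ _ ac] := around_dep si xx yy ww.
by rewrite /cstep /step /jumps !ac ?(proj1 (N _ _)) //; lia.
Qed.

Section coupling_step.
Context {R : realType}.
Variable P : probability config R.
Hypothesis fP : fair_coins P.

(** [p] marks the left ends of disjoint pairs; exchanging and flipping the two coins of each pair is
    a permutation of sites followed by flips, and both preserve fair coins. *)
Lemma fair_swap (p : int -> bool) f : (forall k, p k -> p (k + 1) = false) ->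
  loc f -> E P (f \o (fun w : config => (fun k : int => if p (k - 1) then ~~ w (k - 1)
    else if p k then ~~ w (k + 1) else w k) : config)) = E P f.
Proof.
move=> pp; set T := (X in f \o X).
pose sg (k : int) := if p (k - 1) then k - 1 else if p k then k + 1 else k.
have TE w k : T w k = (p (k - 1) || p k) (+) w (sg k).
  by rewrite /T /sg; case: (p (k - 1)) => //=; case: (p k).
have p' k : p k -> p (k - 1) = false.
  by move=> pk; apply: contraTF pk => /pp; rewrite subrK => ->.
have sgK : involutive sg.
  move=> k; rewrite {2}/sg; case: ifP => h1; first by rewrite /sg p' // h1 subrK.
  case: ifP => h2; first by rewrite /sg addrK h2.
  by rewrite /sg h1 h2.
have psg k : p (sg k - 1) || p (sg k) = p (k - 1) || p k.
  rewrite {1 2}/sg; case: ifP => h1; first by rewrite h1 orbT.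
  by case: ifP => h2; rewrite ?addrK ?h2 ?h1.
apply: E_comp_eq.
  move=> g [s dg]; exists (nbhd s) => w w' ww; apply: dg => k ks.
  rewrite /T !(ww k, ww (k - 1), ww (k + 1)) //; apply: (mem_nbhd ks);
    by rewrite !inE eqxx ?orbT.
move=> s b us.
rewrite (_ : icyl s b \o T =
    icyl (map sg s) (fun k => (p (k - 1) || p k) (+) b (sg k))).
  have /fair_coinsP H := fP.
  by rewrite !H ?size_map // map_inj_uniq //; exact: inv_inj.
apply/funext => w; rewrite /icyl /= all_map; congr (nat_of_bool _)%:R.
apply: eq_all => k /=; rewrite TE psg sgK.
by case: (_ || _) (w _) (b k) => [] [] [].
Qed.

(** Only one bond of a linked pair is active for [x], so [x] never uses both opposed coins.
    Exchanging and flipping the pairs whose second bond is the active one yields fair coins that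
    produce the same jumps of [x]. *)
Lemma cstep_marginal x y (f : config -> R) : loc f ->
  E P (fun w => f (cstep x y w)) = E P (fun w => f (step x w)).
Proof.
move=> lf.
have lg : loc (fun w => f (step x w)) by exact: loc2_r (loc_step lf).
rewrite -(fair_swap (p := fun k => lnk x y k && act x (k + 1)) _ lg); last first.
  by move=> k /andP[/lnk_disjoint ->].
congr E; apply/funext => w; rewrite /cstep /=; congr f.
set v := fun k => _.
have cv k : act x k -> coin x y w k = v k.
  rewrite /coin /v subrK => ak; rewrite ak andbT; case: ifP => // _.
  by move: ak; rewrite /act => /andP[_ /negbTE ->]; rewrite andbF.
have jv k : jumps x (coin x y w) k = jumps x v k.
  rewrite /jumps; case xk: (x k) => //=; case xk1 : (x (k + 1)) => //=.
  by rewrite cv // /act xk xk1.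
by apply/funext => k; rewrite /step !jv.
Qed.

(** The transition operator of the coupled chain, acting on functions of the two configurations. *)
Definition coupling (f : config -> config -> R) x y : R :=
  E P (fun w => f (cstep x y w) (cstep y x w)).

Lemma loc_cstep x y (f : config -> config -> R) : loc2 f ->
  loc (fun w => f (cstep x y w) (cstep y x w)).
Proof.
move=> [s df]; exists (around s) => w w' ww.
by apply: df; apply: cstep_dep.
Qed.

Lemma loc2_coupling f : loc2 f -> loc2 (coupling f).
Proof.
move=> [s df]; exists (around s) => x x' y y' xx yy.
by congr E; apply/funext => w; apply: df; apply: cstep_dep.
Qed.

Lemma coupling_add f g : loc2 f -> loc2 g ->
  coupling (fun x y => f x y + g x y) = fun x y => coupling f x y + coupling g x y.
Proof.
move=> lf lg; apply/funext => x; apply/funext => y.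
exact: (E_add P (loc_cstep x y lf) (loc_cstep x y lg)).
Qed.

Lemma coupling_scale r f : loc2 f ->
  coupling (fun x y => r * f x y) = fun x y => r * coupling f x y.
Proof.
move=> lf; apply/funext => x; apply/funext => y.
exact: (E_scale P r (loc_cstep x y lf)).
Qed.

Lemma coupling_le f g : loc2 f -> loc2 g -> (forall x y, f x y <= g x y) ->
  forall x y, coupling f x y <= coupling g x y.
Proof.
move=> lf lg fg x y.
by apply: (E_le P (loc_cstep x y lf) (loc_cstep x y lg)).
Qed.

Lemma coupling_cst r : coupling (fun _ _ => r) = fun _ _ => r.
Proof. by apply/funext => x; apply/funext => y; exact: E_cst. Qed.

Lemma fair_coins_invariant : translation_invariant P.
Proof.
have /fair_coinsP H := fP.
apply/translation_invariantP; apply: E_comp_eq => [f lf|s b us].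
  exact: (@loc_tr _ f 1 lf).
rewrite (_ : icyl s b \o Defs.shift =
    icyl [seq i + 1 | i <- s] (fun i => b (i - 1))).
  by rewrite !H ?size_map // map_inj_uniq //; exact: addIr.
apply/funext => x; rewrite /icyl /comp all_map; congr (nat_of_bool _)%:R.
by apply: eq_all => i /=; rewrite addrK.
Qed.

Lemma coupling_tr a f : loc2 f ->
  coupling (fun x y => f (tr a x) (tr a y)) = fun x y => coupling f (tr a x) (tr a y).
Proof.
move=> lf; apply/funext => x; apply/funext => y; rewrite /coupling.
rewrite -[RHS](E_tr a fair_coins_invariant); last exact: loc_cstep.
by congr E; apply/funext => w /=; rewrite !cstep_tr.
Qed.

Lemma coupling_fst (g : config -> R) : loc g ->
  coupling (fun x _ => g x) = fun x _ => E P (fun w => g (step x w)).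
Proof. by move=> lg; apply/funext => x; apply/funext => y; exact: cstep_marginal. Qed.

Lemma coupling_snd (g : config -> R) : loc g ->
  coupling (fun _ y => g y) = fun _ y => E P (fun w => g (step y w)).
Proof. by move=> lg; apply/funext => x; apply/funext => y; exact: cstep_marginal. Qed.

(* Among the coins on [s], each pattern has probability at least [2^-|s|]. *)
Lemma fair_lower (s : seq int) (h : config -> R) w : dep s h -> (forall w, 0 <= h w) ->
  h w <= 2 ^+ size s * E P h.
Proof.
move=> dh h0; have lh : loc h by exists s.
have /fair_coinsP H := fP.
have := H (undup s) w (undup_uniq s) => Hs.
have : h w * E P (icyl (undup s) w) <= E P h.
  rewrite -E_scale; last by eexists; exact: dep_icyl.
  apply: E_le => //.
    by apply: loc_op2; [exact: loc_cst|eexists; exact: dep_icyl].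
  move=> v; rewrite /icyl; case: allP => [av|_]; last by rewrite mulr0.
  rewrite mulr1 (dh w v) // => i si; apply/esym/eqP/av.
  by rewrite mem_undup.
rewrite Hs => le.
have e2 : (2 ^+ size s : R) * 2^-1 ^+ size (undup s) >= 1.
  rewrite -(subnK (size_undup s)) exprD -mulrA -exprMn divff ?pnatr_eq0 //.
  by rewrite expr1n mulr1 exprn_ege1 // ler1n.
apply: le_trans (ler_wpM2l _ le); last by rewrite exprn_ge0.
by rewrite mulrCA ler_peMr.
Qed.

End coupling_step.

(** * Transport of discrepancies and their local balance *)

Definition disc (x y : config) (i : int) : bool := x i (+) y i.

Definition single (x y : config) (k : int) : bool := act x k (+) act y k.

Definition follows (x y : config) (k : int) : bool :=
  (act x k && act y (k - 1)) || (act y k && act x (k - 1)).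

(* The jump across [k] carries a discrepancy to the left if [k] starts a chain
   or if only its right end is discrepant, and to the right otherwise. *)
Definition leftward (x y : config) (k : int) : bool :=
  lnk x y k || (~~ follows x y k && ~~ disc x y k).

(** A unit carried from [k + 1] to [k]; [flux_right] carries one from [k] to [k + 1]. *)
Definition flux_left (x y w : config) (k : int) : bool :=
  [&& single x y k, coin x y w k & leftward x y k].

Definition flux_right (x y w : config) (k : int) : bool :=
  [&& single x y k, coin x y w k & ~~ leftward x y k].

Definition all_bool (p : bool -> bool) : bool := p true && p false.

Lemma all_boolP p : all_bool p -> forall b, p b.
Proof. by move=> /andP[h1 h2] []. Qed.

(** Local balance: what is present after the step together with the outflow is at most what was
    present before together with the inflow. Opposite coins at the start of a chain exclude the
    violating patterns. *)
Lemma loss_ge0 x y w i :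
  (disc (cstep x y w) (cstep y x w) i + flux_right x y w i + flux_left x y w (i - 1) <=
   disc x y i + flux_left x y w i + flux_right x y w (i - 1))%N.
Proof.
rewrite /flux_left /flux_right /leftward /follows /single /disc /cstep /step /jumps
  !(coinC y x) /coin /lnk /act !subrK.
move: (x (i - 1 - 1 - 1)) (x (i - 1 - 1)) (x (i - 1)) (x i) (x (i + 1)) (x (i + 1 + 1)).
move: (y (i - 1 - 1 - 1)) (y (i - 1 - 1)) (y (i - 1)) (y i) (y (i + 1)) (y (i + 1 + 1)).
move: (w (i - 1 - 1)) (w (i - 1)) (w i).
(* A finite check over the 15 occupation numbers and coins involved. *)
do 15! move=> ?.
do 15! match goal with b : bool |- _ => move: b; apply: all_boolP end.
by vm_compute.
Qed.

Lemma flux_left_tr a x y w k :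
  flux_left (tr a x) (tr a y) (tr a w) k = flux_left x y w (k + a).
Proof.
rewrite /flux_left /single /leftward /follows /coin !lnk_tr !act_tr /disc /tr.
by rewrite !(addrAC _ _ a).
Qed.

Lemma flux_right_tr a x y w k :
  flux_right (tr a x) (tr a y) (tr a w) k = flux_right x y w (k + a).
Proof.
rewrite /flux_right /single /leftward /follows /coin !lnk_tr !act_tr /disc /tr.
by rewrite !(addrAC _ _ a).
Qed.

Lemma cvg_ext0 (R : realType) (a b : nat -> R) l :
  b @ \oo --> l -> l = 0 -> (forall t, a t = b t) -> a @ \oo --> (0 : R).
Proof. by move=> bl l0 ab; rewrite (_ : a = b) -?l0 //; apply/funext. Qed.

(** * The coupled process in time and the disappearance of losses *)

Section evolution.
Context {R : realType}.
Variables (mu nu P : probability config R).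
Hypotheses (fP : fair_coins P).
Hypotheses (imu : translation_invariant mu) (inu : translation_invariant nu).
Hypothesis smu : forall f, loc f ->
  E mu (fun x => E P (fun w => f (step x w))) = E mu f.
Hypothesis snu : forall f, loc f ->
  E nu (fun x => E P (fun w => f (step x w))) = E nu f.

Let K := @coupling R P.

(* Expectation at time [t] for the coupled process started from the product of
   [mu] and [nu]. *)
Definition Et (t : nat) (f : config -> config -> R) : R :=
  E mu (fun x => E nu (fun y => iter t K f x y)).

Lemma EtS t f : Et t.+1 f = Et t (K f).
Proof. by rewrite /Et iterSr. Qed.

Lemma Et_add t f g : loc2 f -> loc2 g ->
  Et t (fun x y => f x y + g x y) = Et t f + Et t g.
Proof.
move=> lf lg; elim: t f g lf lg => [|t IH] f g lf lg.
  rewrite /Et /= -E_add; try exact: loc2_E.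
  congr E; apply/funext => x.
  exact: (E_add nu (loc2_r x lf) (loc2_r x lg)).
by rewrite !EtS /K coupling_add // IH //; exact: loc2_coupling.
Qed.

Lemma Et_scale t r f : loc2 f -> Et t (fun x y => r * f x y) = r * Et t f.
Proof.
move=> lf; elim: t f lf => [|t IH] f lf.
  rewrite /Et /= -E_scale; last exact: loc2_E.
  congr E; apply/funext => x; exact: (E_scale nu r (loc2_r x lf)).
by rewrite !EtS /K coupling_scale // IH //; exact: loc2_coupling.
Qed.

Lemma Et_le t f g : loc2 f -> loc2 g -> (forall x y, f x y <= g x y) ->
  Et t f <= Et t g.
Proof.
move=> lf lg; elim: t f g lf lg => [|t IH] f g lf lg fg.
  apply: E_le; try exact: loc2_E.
  by move=> x; apply: (E_le nu (loc2_r x lf) (loc2_r x lg)).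
rewrite !EtS; apply: IH; try exact: loc2_coupling.
exact: coupling_le.
Qed.

Lemma Et_cst t r : Et t (fun _ _ => r) = r.
Proof.
elim: t => [|t IH]; last by rewrite EtS /K coupling_cst.
by rewrite /Et /=; under eq_fun do rewrite E_cst; rewrite E_cst.
Qed.

Lemma Et_ge0 t f : loc2 f -> (forall x y, 0 <= f x y) -> 0 <= Et t f.
Proof.
by move=> lf f0; rewrite -(Et_cst t 0); apply: Et_le => //; exact: loc2_cst.
Qed.

Lemma loc2_tr (f : config -> config -> R) a : loc2 f ->
  loc2 (fun x y => f (tr a x) (tr a y)).
Proof.
move=> [s df]; exists [seq i + a | i <- s] => x x' y y' xx yy.
by apply: df => i si; [apply: xx|apply: yy]; exact: map_f.
Qed.

Lemma Et_tr t a f : loc2 f -> Et t (fun x y => f (tr a x) (tr a y)) = Et t f.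
Proof.
move=> lf; elim: t f lf => [|t IH] f lf; last first.
  by rewrite !EtS /K (coupling_tr fP a lf) (IH _ (loc2_coupling P lf)).
rewrite /Et /= -[RHS](E_tr a imu); last exact: loc2_E.
congr E; apply/funext => x /=.
exact: (E_tr a inu (loc2_r (tr a x) lf)).
Qed.

(** The first marginal of the coupling is the dynamics itself, and [mu] is stationary for it. *)
Lemma Et_fst t g : loc g -> Et t (fun x _ => g x) = E mu g.
Proof.
move=> lg; elim: t g lg => [|t IH] g lg.
  by rewrite /Et /=; under eq_fun do rewrite E_cst.
rewrite EtS /K coupling_fst // IH ?smu //.
by apply: loc2_E; exact: loc_step.
Qed.

Lemma Et_snd t g : loc g -> Et t (fun _ y => g y) = E nu g.
Proof.
move=> lg; elim: t g lg => [|t IH] g lg; first by rewrite /Et /= E_cst.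
rewrite EtS /K coupling_snd // IH ?snu //.
by apply: loc2_E; exact: loc_step.
Qed.

Definition vanishes (f : config -> config -> R) :=
  (fun t => Et t f) @ \oo --> (0 : R).

Lemma vanishes_le f g : loc2 f -> loc2 g -> (forall x y, 0 <= f x y <= g x y) ->
  vanishes g -> vanishes f.
Proof.
move=> lf lg fg vg; apply: (squeeze_cvgr _ (cvg_cst 0) vg).
apply: nearW => t; apply/andP; split.
  by apply: Et_ge0 => // x y; have /andP[] := fg x y.
by apply: Et_le => // x y; have /andP[] := fg x y.
Qed.

Lemma vanishes_add f g : loc2 f -> loc2 g -> vanishes f -> vanishes g ->
  vanishes (fun x y => f x y + g x y).
Proof.
move=> lf lg vf vg.
exact: cvg_ext0 (cvgD vf vg) (addr0 _) (fun t => Et_add t lf lg).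
Qed.

Lemma vanishes_scale r f : loc2 f -> vanishes f -> vanishes (fun x y => r * f x y).
Proof.
move=> lf vf.
have vr : (fun t => r * Et t f) @ \oo --> r * 0 by exact: cvgMl_tmp.
exact: cvg_ext0 vr (mulr0 r) (fun t => Et_scale t r lf).
Qed.

Lemma vanishes_tr a f : loc2 f -> vanishes f ->
  vanishes (fun x y => f (tr a x) (tr a y)).
Proof. by move=> lf vf; exact: cvg_ext0 vf erefl (fun t => Et_tr t a lf). Qed.

Lemma vanishes_coupling f : vanishes f -> vanishes (K f).
Proof.
move=> vf; apply: (cvg_ext0 _ erefl (fun t => esym (EtS t f))).
by rewrite (cvg_shiftS (fun t => Et t f)).
Qed.

(** The deficit in the balance [loss_ge0] at site 0, that is the discrepancies destroyed there. *)
Definition loss (x y w : config) : R :=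
  (disc x y 0 + flux_left x y w 0 + flux_right x y w (-1))%:R -
  (disc (cstep x y w) (cstep y x w) 0 + flux_right x y w 0 +
   flux_left x y w (-1))%:R.

Lemma loss_nonneg x y w : 0 <= loss x y w.
Proof. by rewrite subr_ge0 ler_nat; exact: (loss_ge0 x y w 0). Qed.

Lemma flux_dep s x x' y y' w w' : {in around s, x =1 x'} ->
  {in around s, y =1 y'} -> {in around s, w =1 w'} -> {in s, forall i,
  flux_left x y w i = flux_left x' y' w' i /\
  flux_right x y w i = flux_right x' y' w' i}.
Proof.
move=> xx yy ww i si; have [N a al ac] := around_dep si xx yy ww.
rewrite /flux_left /flux_right /single /leftward /follows /disc.
rewrite !ac ?al ?(proj1 (a _ _)) ?(proj2 (a _ _))
  ?(proj1 (N _ _)) ?(proj2 (N _ _)) //; lia.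
Qed.

Lemma loss_dep x x' y y' w w' (s := around [:: 0; -1]) : {in s, x =1 x'} ->
  {in s, y =1 y'} -> {in s, w =1 w'} -> loss x y w = loss x' y' w'.
Proof.
move=> xx yy ww.
have H i := @flux_dep [:: 0; -1] x x' y y' w w' xx yy ww i.
rewrite /loss; have [-> ->] := H 0 isT; have [-> ->] := H (-1) isT.
have zs : (0 : int) \in s by [].
by rewrite /disc xx // yy // !(@cstep_dep [:: 0; -1] _ _ _ _ _ _ xx yy ww) //
  !(@cstep_dep [:: 0; -1] _ _ _ _ _ _ yy xx ww).
Qed.

Lemma loc_loss x y : loc (loss x y).
Proof. by exists (around [:: 0; -1]) => w w' ww; exact: loss_dep. Qed.

Definition mean_loss x y : R := E P (loss x y).

Lemma loc2_mean_loss : loc2 mean_loss.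
Proof.
exists (around [:: 0; -1]) => x x' y y' xx yy; congr E; apply/funext => w.
exact: loss_dep.
Qed.

Let D x y : R := (disc x y 0)%:R.

Let loc2_D : loc2 D.
Proof.
by exists [:: 0] => x x' y y' xx yy; rewrite /D /disc xx ?yy // inE.
Qed.

Let flux x y : R := E P (fun w =>
  (flux_right x y w (-1))%:R - (flux_left x y w (-1))%:R).

Let loc_flux x y i : loc (fun w =>
  (flux_right x y w i)%:R - (flux_left x y w i)%:R : R).
Proof.
exists (around [:: i]) => w w' ww.
have xx : {in around [:: i], x =1 x} by [].
have yy : {in around [:: i], y =1 y} by [].
by have [-> ->] := flux_dep xx yy ww (mem_head i [::]).
Qed.

Let loc2_flux : loc2 flux.
Proof.
exists (around [:: -1]) => x x' y y' xx yy; congr E; apply/funext => w.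
have ww : {in around [:: -1], w =1 w} by [].
by have [-> ->] := flux_dep xx yy ww (mem_head (-1) [::]).
Qed.

Let flux_tr x y : flux (tr 1 x) (tr 1 y) = E P (fun w =>
  (flux_right x y w 0)%:R - (flux_left x y w 0)%:R).
Proof.
rewrite -[LHS](E_tr 1 (fair_coins_invariant fP)); last exact: loc_flux.
by congr E; apply/funext => w; rewrite /= flux_right_tr flux_left_tr addNr.
Qed.

Let mean_lossE x y :
  mean_loss x y = D x y - K D x y + flux x y - flux (tr 1 x) (tr 1 y).
Proof.
rewrite flux_tr -(E_cst P (D x y)) /K /coupling.
have l0 : loc (fun _ : config => D x y) by exact: loc_cst.
have l1 := loc_cstep x y loc2_D.
have l2 := loc_flux x y (-1); have l3 := loc_flux x y 0.
have l01 := loc_op2 (fun a b => a - b) l0 l1.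
have l012 := loc_op2 +%R l01 l2.
rewrite -(E_sub P l0 l1) -(E_add P l01 l2) -(E_sub P l012 l3); congr E.
apply/funext => w; rewrite /loss /D !natrD; ring.
Qed.

(** The flux terms form a discrete divergence, whose expectation vanishes by translation invariance;
    only the decrease of the discrepancy density remains. *)
Let Et_mean_loss t : Et t mean_loss = Et t D - Et t.+1 D.
Proof.
have lK := loc2_coupling P loc2_D.
have l0 := loc2_op2 +%R loc2_D (loc2_op2 *%R (loc2_cst (-1)) lK).
have lT := loc2_tr 1 loc2_flux.
have l1 := loc2_op2 +%R l0 loc2_flux.
have l2 := loc2_op2 *%R (loc2_cst (-1)) lT.
rewrite (_ : mean_loss = fun x y => (D x y + -1 * coupling P D x y) + flux x y +
   -1 * flux (tr 1 x) (tr 1 y)); last first.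
  apply/funext => x; apply/funext => y; rewrite mean_lossE /K; ring.
rewrite (Et_add t l1 l2) (Et_add t l0 loc2_flux).
rewrite (Et_add t loc2_D (loc2_op2 *%R (loc2_cst (-1)) lK)).
rewrite (Et_scale t _ lK) (Et_scale t _ lT) (Et_tr t 1 loc2_flux) (EtS t D).
rewrite -[K D]/(coupling P D).
move: (Et t D) (Et t (coupling P D)) (Et t flux) => a b c; ring.
Qed.

Lemma mean_loss_ge0 x y : 0 <= mean_loss x y.
Proof. by apply: E_ge0 => w; exact: loss_nonneg. Qed.

(** The discrepancy density is nonincreasing and nonnegative, hence convergent, so its successive
    differences tend to 0. *)
Lemma vanishes_mean_loss : vanishes mean_loss.
Proof.
have D0 t : 0 <= Et t D by apply: Et_ge0.
have dec : nonincreasing_seq (fun t => Et t D).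
  apply/nonincreasing_seqP => t; rewrite -subr_ge0 -Et_mean_loss.
  by apply: Et_ge0; [exact: loc2_mean_loss|exact: mean_loss_ge0].
have cv : cvgn (fun t => Et t D).
  apply: nonincreasing_is_cvgn => //.
  by exists 0 => _ [t _ <-].
have cvS : (fun t => Et t.+1 D) @ \oo --> limn (fun t => Et t D).
  by rewrite (cvg_shiftS (fun t => Et t D)).
exact: cvg_ext0 (cvgB cv cvS) (subrr _) Et_mean_loss.
Qed.

End evolution.

(** * Annihilation of opposite discrepancies *)

Definition pm (x y : config) (i j : int) : bool := [&& x i, ~~ y i, ~~ x j & y j].

Definition opposite (x y : config) (i j : int) : bool := pm x y i j || pm y x i j.

(** Opposition inside linked pairs is the only constraint on the coins. When just the second bond of
    a pair lies to be prescribed together with the first, the raw coin of the first is chosen so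
    that its negation is the value wanted on the second. *)
Lemma choose_coins x y (T : int -> bool) (c : int -> bool) :
  (forall k, lnk x y k -> T k -> T (k + 1) -> c (k + 1) = ~~ c k) ->
  exists w, forall k, T k -> coin x y w k = c k.
Proof.
move=> H; exists (fun k => if lnk x y k && T (k + 1) then ~~ c (k + 1) else c k).
move=> k Tk; rewrite /coin subrK; case: ifP => lk /=.
  by rewrite lk Tk negbK.
by case: ifP => // /andP[lk1 Tk1]; rewrite (H k) // negbK.
Qed.

Section moves.
Variables (x y u : config).

(** [x] is blocked by the particle at [i + 1], and the bond [i - 1], being off, keeps [y] from
    filling its hole. *)
Lemma plus_stays i : x i -> ~~ y i -> x (i + 1) -> ~~ u (i - 1) ->
  step x u i && ~~ step y u i.
Proof.
move=> xi yi x1 ui; rewrite /step /jumps subrK xi (negbTE yi) x1 (negbTE ui).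
by rewrite /= ?andbF.
Qed.

Lemma plus_right i : x i -> ~~ y i -> ~~ x (i + 1) -> ~~ y (i + 1) -> u i ->
  step x u (i + 1) && ~~ step y u (i + 1).
Proof.
move=> xi yi x1 y1 ui; rewrite /step /jumps (addrK 1 i).
by rewrite xi (negbTE yi) (negbTE x1) (negbTE y1) ui.
Qed.

Lemma minus_stays j : ~~ x j -> y j -> ~~ x (j - 1) -> ~~ y (j - 1) -> ~~ u j ->
  ~~ step x u j && step y u j.
Proof.
move=> xj yj x1 y1 uj; rewrite /step /jumps subrK.
by rewrite (negbTE xj) yj (negbTE x1) (negbTE y1) (negbTE uj) /= ?andbF.
Qed.

(** [x] fills [j] from [j - 1] while [y] is blocked, so the discrepancy moves against the direction
    of the particles. *)
Lemma minus_left j : ~~ x j -> y j -> x (j - 1) -> y (j - 1) -> u (j - 1) ->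
  ~~ step x u (j - 1) && step y u (j - 1).
Proof.
move=> xj yj x1 y1 uj; rewrite /step /jumps !subrK.
by rewrite (negbTE xj) yj x1 y1 uj /= ?andbF.
Qed.

Lemma pair_jumps k : x k -> ~~ x (k + 1) -> u k -> step x u k = false.
Proof. by move=> xk xk1 uk; rewrite /step /jumps xk xk1 uk. Qed.

End moves.

(** No two prescribed bonds are consecutive, so the constraint in [choose_coins] is vacuous. *)
Lemma isolated2 (a b k : int) : a + 1 <> b -> a < b ->
  (k == a) || (k == b) -> (k + 1 == a) || (k + 1 == b) -> False.
Proof. by move=> ? ? /orP[]/eqP ? /orP[]/eqP ?; lia. Qed.

Lemma isolated3 (m n : nat) (k : int) : (2 <= m < n)%N ->
  [|| k == -1, k == n%:Z | k == m%:Z - 1] ->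
  [|| k + 1 == -1, k + 1 == n%:Z | k + 1 == m%:Z - 1] -> False.
Proof. by move=> ? /or3P[]/eqP ? /or3P[]/eqP ?; lia. Qed.

Lemma pm_approach x y (n : nat) : (2 <= n)%N -> pm x y 0 n ->
  x 1 = y 1 -> x (n%:Z - 1) = y (n%:Z - 1) ->
  exists w, pm (cstep x y w) (cstep y x w)
    (if x 1 then 0 else 1) (if x (n%:Z - 1) then n%:Z - 1 else n%:Z).
Proof.
move=> n2 /and4P[x0 y0 xn yn] x1 xn1.
(* The bonds to prescribe. On the left: bond -1 off if the particle at 0 is blocked, bond 0 on if it
   can advance. On the right: bond [n - 1] on if site [n - 1] is occupied, bond [n] off
   otherwise. *)
pose i0 : int := if x 1 then -1 else 0.
pose j0 : int := if x (n%:Z - 1) then n%:Z - 1 else n%:Z.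
pose T k := (k == i0) || (k == j0).
pose c k := if k == i0 then ~~ x 1 else x (n%:Z - 1).
(* A clash would require [n = 2], but then both choices read the same site 1 and exclude each
   other. *)
have ij : i0 + 1 <> j0.
  rewrite /i0 /j0; case: ifP => h1; case: ifP => h2; move: n2; try by clear; lia.
  by move=> _ h3; move: h2; rewrite -h3 add0r h1.
have ij0 : i0 < j0.
  by rewrite /i0 /j0; case: ifP => _; case: ifP => _; move: n2; clear; lia.
have [|w Hw] := @choose_coins x y T c.
  by move=> k _ h1 h2; case: (isolated2 ij ij0 h1 h2).
exists w.
have wi : coin x y w i0 = ~~ x 1 by rewrite Hw /T /c eqxx.
have wj : coin x y w j0 = x (n%:Z - 1).
  by rewrite Hw /T /c ?eqxx ?orbT //; case: eqP => // ji; move: ij0; rewrite ji ltxx.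
rewrite /pm /cstep (coinC y x); set u := coin x y w in wi wj *.
rewrite andbA; apply/andP; split.
  move: wi; rewrite /i0; case: ifP => h wi.
    by apply: plus_stays; rewrite ?add0r ?wi ?sub0r ?wi.
  by apply: (@plus_right x y u 0); rewrite ?add0r -?x1 ?h ?wi.
move: wj; rewrite /j0; case: ifP => h wj.
  by apply: minus_left; rewrite -?xn1 ?h ?wj.
by apply: minus_stays; rewrite -?xn1 ?h ?wj.
Qed.

(** A common particle at [m - 1] jumps onto the common hole at [m] while bonds -1 and [n] are off:
    the hole advances to the left and both discrepancies stay in place. *)
Lemma pm_sort x y (n m : nat) : (2 <= m < n)%N -> pm x y 0 n ->
  x 1 -> x 1 = y 1 -> ~~ x (n%:Z - 1) -> x (n%:Z - 1) = y (n%:Z - 1) ->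
  x (m%:Z - 1) -> x (m%:Z - 1) = y (m%:Z - 1) -> ~~ x m%:Z -> ~~ y m%:Z ->
  exists w, [&& pm (cstep x y w) (cstep y x w) 0 n,
    ~~ cstep x y w (m%:Z - 1) & ~~ cstep y x w (m%:Z - 1)].
Proof.
move=> mn /and4P[x0 y0 xn yn] x1 x1E xn1 xn1E xm1 xm1E xm ym.
pose T k := [|| k == -1, k == n%:Z | k == m%:Z - 1].
pose c k := k == m%:Z - 1.
have [|w Hw] := @choose_coins x y T c.
  by move=> k _ h1 h2; case: (isolated3 mn h1 h2).
exists w; rewrite /pm /cstep (coinC y x); set u := coin x y w in Hw *.
have e1 : (-1 : int) == m%:Z - 1 = false by apply/eqP; move: mn; clear; lia.
have e2 : n%:Z == m%:Z - 1 = false by apply/eqP; move: mn; clear; lia.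
have u1 : ~~ u (-1) by rewrite Hw /T /c ?eqxx // e1.
have un : ~~ u n%:Z by rewrite Hw /T /c ?eqxx ?orbT // e2.
have um : u (m%:Z - 1) by rewrite Hw /T /c eqxx ?orbT.
rewrite andbA -andbA; apply/and3P; split; last 2 first.
- by rewrite pair_jumps ?subrK.
- by rewrite pair_jumps ?subrK // -xm1E.
rewrite andbA; apply/andP; split.
  by apply: plus_stays; rewrite ?add0r ?sub0r.
by apply: minus_stays; rewrite -?xn1E.
Qed.

Lemma lossC (R : realType) x y w : loss x y w = loss y x w :> R.
Proof.
have sC k : single x y k = single y x k by rewrite /single addbC.
have dC k : disc x y k = disc y x k by rewrite /disc addbC.
have fC k : follows x y k = follows y x k by rewrite /follows orbC.
have lC k : leftward x y k = leftward y x k by rewrite /leftward lnkC fC dC.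
rewrite /loss /flux_left /flux_right !(coinC y x) !sC !lC !dC.
by rewrite [disc (cstep x y w) _ _]/disc [in LHS]addbC.
Qed.

(** When bond 0 fires and its two neighbours do not, the jump in [x] removes both discrepancies. In
    the sum over sites 0 and 1 the fluxes across bond 0 cancel and the outer ones are zero. *)
Lemma pm_adjacent_loss (R : realType) x y : pm x y 0 1 ->
  exists w, 1 <= loss x y w + loss (tr 1 x) (tr 1 y) (tr 1 w) :> R.
Proof.
move=> /and4P[x0 y0 xn yn].
pose T (k : int) : bool := [|| k == -1, k == 0 | k == 1].
(* The pattern off, on, off alternates, so it is admissible whichever of these bonds are linked. *)
have [|w Hw] := @choose_coins x y T (fun k => k == 0).
  by move=> k _ /or3P[]/eqP -> /or3P[]/eqP.
exists w; have um : coin x y w (-1) = false by rewrite Hw.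
have u0 : coin x y w 0 by rewrite Hw.
have u1 : coin x y w 1 = false by rewrite Hw.
have d0 : disc x y 0 by rewrite /disc x0 (negbTE y0).
have d1 : disc x y 1 by rewrite /disc yn (negbTE xn).
have d0' : disc (cstep x y w) (cstep y x w) 0 = false.
  rewrite /disc /cstep (coinC y x) /step /jumps sub0r um !andbF add0r.
  by rewrite x0 u0 xn (negbTE y0).
have d1' : disc (cstep x y w) (cstep y x w) 1 = false.
  rewrite /disc /cstep (coinC y x) /step /jumps subrr u1 !andbF add0r.
  by rewrite x0 u0 xn yn (negbTE y0).
rewrite /loss !cstep_tr.
have dT (a b : config) : disc (tr 1 a) (tr 1 b) 0 = disc a b 1.
  by rewrite /disc /tr add0r.
rewrite !dT d0 d1 d0' d1' !flux_left_tr !flux_right_tr add0r addNr.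
have fl1 k : coin x y w k = false -> flux_left x y w k = false.
  by move=> h; rewrite /flux_left h andbF.
have fr1 k : coin x y w k = false -> flux_right x y w k = false.
  by move=> h; rewrite /flux_right h andbF.
rewrite !(fl1 _ um) !(fr1 _ um) !(fl1 _ u1) !(fr1 _ u1) !natrD /=.
set a := (flux_left _ _ _ _)%:R; set b := (flux_right _ _ _ _)%:R.
lra.
Qed.

Definition locb (e : config -> config -> bool) := exists s : seq int,
  forall x x' y y', {in s, x =1 x'} -> {in s, y =1 y'} -> e x y = e x' y'.

Lemma locb_pm i j : locb (fun x y => pm x y i j).
Proof.
exists [:: i; j] => x x' y y' xx yy.
by rewrite /pm !(xx i, xx j, yy i, yy j) // !inE eqxx ?orbT.
Qed.

Lemma locb_op2 (o : bool -> bool -> bool) e f : locb e -> locb f ->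
  locb (fun x y => o (e x y) (f x y)).
Proof.
move=> [s de] [t df]; exists (s ++ t) => x x' y y' xx yy; congr o.
  by apply: de => i si; [apply: xx|apply: yy]; rewrite mem_cat si.
by apply: df => i si; [apply: xx|apply: yy]; rewrite mem_cat si orbT.
Qed.

Lemma locbC e : locb e -> locb (fun x y => e y x).
Proof. by move=> [s de]; exists s => x x' y y' xx yy; exact: de. Qed.

Lemma locb_opposite i j : locb (fun x y => opposite x y i j).
Proof. exact: locb_op2 (locb_pm i j) (locbC (locb_pm i j)). Qed.

Lemma loc2_locb (R : realType) e : locb e -> loc2 (fun x y => (e x y)%:R : R).
Proof. by move=> [s de]; exists s => x x' y y' xx yy; rewrite (de x x' y y'). Qed.

Section annihilation.
Context {R : realType}.
Variables (mu nu P : probability config R).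
Hypotheses (fP : fair_coins P).
Hypotheses (imu : translation_invariant mu) (inu : translation_invariant nu).

Implicit Types e h : config -> config -> bool.

Definition vanishing_event (e : config -> config -> bool) :=
  locb e /\ vanishes mu nu P (fun x y => (e x y)%:R).

Lemma vanishing_sub e h : locb e -> (forall x y, e x y -> h x y) ->
  vanishing_event h -> vanishing_event e.
Proof.
move=> le eh [lh vh]; split; first exact: le.
apply: (vanishes_le (loc2_locb R le) (loc2_locb R lh) _ vh) => x y.
by rewrite ler0n ler_nat; have := eh x y; case: (e x y) => // ->.
Qed.

Lemma vanishing_or e h : vanishing_event e -> vanishing_event h ->
  vanishing_event (fun x y => e x y || h x y).
Proof.
move=> [le ve] [lh vh]; split; first exact: locb_op2.
have Le := loc2_locb R le; have Lh := loc2_locb R lh.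
have Leh := loc2_locb R (locb_op2 orb le lh).
apply: (vanishes_le Leh (loc2_op2 +%R Le Lh) _ (vanishes_add Le Lh ve vh)).
by move=> x y; rewrite -natrD ler0n ler_nat; case: (e x y) (h x y) => [] [].
Qed.

Lemma vanishing_false : vanishing_event (fun _ _ => false).
Proof.
split; first by exists [::].
exact: cvg_ext0 (cvg_cst 0) erefl (fun t => Et_cst mu nu P t 0).
Qed.

Lemma vanishing_has (I : Type) (s : seq I) (F : I -> config -> config -> bool) :
  (forall i, vanishing_event (F i)) ->
  vanishing_event (fun x y => has (fun i => F i x y) s).
Proof.
move=> vF; elim: s => [|i s IH] /=; last exact: (vanishing_or (vF i) IH).
exact: vanishing_false.
Qed.

(** A coin pattern on [s] has probability at least [2^-|s|], so the indicator of [e] is at most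
    [2^|s|] times the mean of [h]. *)
Lemma loc2_reach (s : seq int) e (h : config -> config -> config -> R) :
  locb e -> (forall x y, dep s (h x y)) -> loc2 (fun x y => E P (h x y)) ->
  (forall x y w, 0 <= h x y w) ->
  (forall x y, e x y -> exists w, 1 <= h x y w) ->
  vanishes mu nu P (fun x y => E P (h x y)) -> vanishing_event e.
Proof.
move=> le dh lh h0 eh vh; split; first exact: le.
have lc := loc2_op2 *%R (loc2_cst (2 ^+ size s)) lh.
apply: (vanishes_le (loc2_locb R le) lc _ (vanishes_scale (2 ^+ size s) lh vh)).
move=> x y; rewrite ler0n /=.
have [exy|_] := boolP (e x y); last by rewrite mulr_ge0 ?exprn_ge0 // E_ge0.
have [w hw] := eh _ _ exy.
exact: le_trans hw (fair_lower fP w (dh x y) (h0 x y)).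
Qed.

(** The probability of [e] at time [t] is at most a constant times that of [h] at time [t + 1]. *)
Lemma vanishing_reach e h : locb e ->
  (forall x y, e x y -> exists w, h (cstep x y w) (cstep y x w)) ->
  vanishing_event h -> vanishing_event e.
Proof.
move=> le eh [[s dh] vh].
have lh := loc2_locb R (ex_intro _ s dh).
apply: (@loc2_reach (around s) _
  (fun x y w => (h (cstep x y w) (cstep y x w))%:R)).
- exact: le.
- by move=> x y w w' ww; congr (nat_of_bool _)%:R; apply: dh; apply: cstep_dep.
- exact: loc2_coupling lh.
- by move=> x y w; rewrite ler0n.
- by move=> x y /eh[w hw]; exists w; rewrite hw.
- exact: vanishes_coupling vh.
Qed.

Lemma vanishing_step e h : locb e ->
  (forall x y, e x y -> h x y \/ exists w, h (cstep x y w) (cstep y x w)) ->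
  vanishing_event h -> vanishing_event e.
Proof.
move=> le eh vh.
have lh : locb h by case: vh.
have le' : locb (fun x y => e x y && ~~ h x y).
  exact: (locb_op2 (fun a b => a && ~~ b) le lh).
have v' : vanishing_event (fun x y => e x y && ~~ h x y).
  apply: (vanishing_reach le' _ vh) => x y /andP[/eh[->//|//]].
apply: vanishing_sub le _ (vanishing_or vh v') => x y ->.
by case: (h x y).
Qed.

Lemma vanishing_opposite_tr i j a : vanishing_event (fun x y => opposite x y i j) ->
  vanishing_event (fun x y => opposite x y (i + a) (j + a)).
Proof.
move=> [lo vo]; split; first exact: locb_opposite.
exact: (vanishes_tr fP imu inu a (loc2_locb R lo) vo).
Qed.

(** By [pm_adjacent_loss] such a pair loses at least 1 at sites 0 and 1 under some coin pattern,
    while the mean loss tends to 0. *)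
Lemma vanishing_adjacent : vanishing_event (fun x y => opposite x y 0 1).
Proof.
have L x y := @loc_loss R x y.
pose h (x y w : config) : R := loss x y w + loss (tr 1 x) (tr 1 y) (tr 1 w).
have l2 : loc2 (fun x y => @mean_loss R P x y + @mean_loss R P (tr 1 x) (tr 1 y)).
  by apply: loc2_op2; [|apply: loc2_tr]; exact: loc2_mean_loss.
have hE : (fun x y => E P (h x y)) =
    (fun x y => @mean_loss R P x y + @mean_loss R P (tr 1 x) (tr 1 y)).
  apply/funext => x; apply/funext => y.
  rewrite (E_add P (L x y) (@loc_tr _ _ 1 (L (tr 1 x) (tr 1 y)))).
  by congr (_ + _); exact: (E_tr 1 (fair_coins_invariant fP)).
pose s0 := around [:: 0; -1].
apply: (@loc2_reach (s0 ++ [seq i + 1 | i <- s0]) _ h).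
- exact: locb_opposite.
- move=> x y w w' ww; congr (_ + _); apply: loss_dep => // i si.
    by apply: ww; rewrite mem_cat si.
  by rewrite /tr; apply: ww; rewrite mem_cat (map_f (fun i => i + 1) si) orbT.
- by rewrite hE.
- by move=> x y w; apply: addr_ge0; exact: loss_nonneg.
- move=> x y /orP[/(pm_adjacent_loss R)//|/(pm_adjacent_loss R)[w hw]].
  by exists w; rewrite /h lossC [X in _ + X]lossC.
- rewrite hE; have lm := loc2_mean_loss P.
  have vm := vanishes_mean_loss fP imu inu.
  exact: vanishes_add lm (loc2_tr 1 lm) vm (vanishes_tr fP imu inu 1 lm vm).
Qed.

Lemma between_closer x y (n : nat) (k : int) : opposite x y 0 n -> 0 < k < n%:Z ->
  x k != y k -> opposite x y 0 k || opposite x y k n.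
Proof.
move=> /orP[]/and4P[h1 h2 h3 h4] _; rewrite /opposite /pm h1 h2 h3 h4 /=;
  by case: (x k) (y k) => [] [] //=; rewrite ?orbT.
Qed.

(* Steer two nearest opposite discrepancies together, the left one through
   empty sites and the right one through occupied sites; when the left one
   faces a particle and the right one a hole, first move a common hole left
   until it meets the left one. *)
Lemma vanishing_opposite (n : nat) :
  (0 < n)%N -> vanishing_event (fun x y => opposite x y 0 n).
Proof.
have [N] := ubnP n; elim: N n => // N IH n nN n0.
have [->|n2] := eqVneq n 1%N; first exact: vanishing_adjacent.
have {}n2 : (2 <= n)%N by move: n0 n2; clear; lia.
have sm i (k : nat) : (0 < k < n)%N ->
    vanishing_event (fun x y => opposite x y i (i + k%:Z)).
  move=> /andP[k0 kn].
  have := vanishing_opposite_tr i (IH k (leq_trans kn nN) k0).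
  by rewrite add0r addrC.
pose F (p : nat * nat) x y :=
  (0 < p.2 < n)%N && opposite x y p.1%:Z (p.1%:Z + p.2%:Z).
have vF p : vanishing_event (F p).
  rewrite /F; case: (boolP (0 < p.2 < n)%N) => [/(sm p.1%:Z)//|_].
  exact: vanishing_false.
(* Some opposite pair within [0, ..., n] at distance less than [n]: a finite union of events covered
   by the induction hypothesis. *)
pose close x y := has (fun p => F p x y)
  [seq (i, k) | i <- iota 0 n.+1, k <- iota 1 n.-1].
have vclose : vanishing_event close by exact: vanishing_has.
have closeP x y (i j : int) : 0 <= i -> i < j -> j <= n%:Z -> j - i < n%:Z ->
    opposite x y i j -> close x y.
  move=> i0 ij jn ijn o; apply/hasP; exists (`|i|%N, `|j - i|%N).
    apply/allpairsPdep; exists `|i|%N, `|j - i|%N; split=> //.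
      by rewrite mem_iota; move: i0 ij jn; clear; lia.
    by rewrite mem_iota; move: i0 ij jn ijn n0; clear; lia.
  rewrite /F /=; apply/andP; split; first by move: i0 ij jn ijn; clear; lia.
  by rewrite !gez0_abs ?subr_ge0 ?(ltW ij) // [i + _]addrC subrK.
have inner x y : opposite x y 0 n -> ~~ close x y ->
    forall k : int, 0 < k < n%:Z -> x k = y k.
  move=> o nc k kn; apply/eqP; apply: contraNT nc => kxy.
  have /andP[k0 kn'] := kn.
  have /orP[] := between_closer o kn kxy; apply: closeP => //.
  - exact: ltW.
  - by rewrite subr0.
  - exact: ltW.
  - by move: k0; clear; lia.
(* If site 1 is empty or site [n - 1] is occupied, at least one discrepancy moves inwards while the
   other stays or moves inwards too. *)
have approach x y : opposite x y 0 n -> ~~ close x y -> ~~ x 1 || x (n%:Z - 1) ->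
    exists w, close (cstep x y w) (cstep y x w).
  move=> o nc h.
  have e1 : x 1 = y 1 by apply: (inner _ _ o nc); move: n2; clear; lia.
  have e2 : x (n%:Z - 1) = y (n%:Z - 1).
    by apply: (inner _ _ o nc); move: n2; clear; lia.
  pose i0 : int := if x 1 then 0 else 1.
  pose j0 : int := if x (n%:Z - 1) then n%:Z - 1 else n%:Z.
  have [w hw] : exists w, opposite (cstep x y w) (cstep y x w) i0 j0.
    move: o => /orP[] o.
      have [w hw] := pm_approach n2 o e1 e2.
      by exists w; rewrite /opposite /i0 /j0 hw.
    have [w hw] := pm_approach n2 o (esym e1) (esym e2).
    by exists w; rewrite /opposite /i0 /j0 e1 e2 hw orbT.
  exists w; apply: closeP hw; rewrite /i0 /j0.
  - by case: ifP.
  - case: ifP => h1; case: ifP => h2; try by move: n2; clear; lia.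
    have : n%:Z - 1 <> 1 by move=> h3; rewrite h3 h1 in h2.
    by move: n2; clear; lia.
  - by case: ifP => _; clear; lia.
  - by move: h; case: ifP => h1; case: ifP => h2 //= _; clear; lia.
(* Induction on the position of a common hole: either the discrepancies can approach, or the hole
   moves one site to the left. A hole at 1 lets the left discrepancy advance. *)
have vU (m : nat) : (0 < m < n)%N ->
    vanishing_event (fun x y => [&& opposite x y 0 n, ~~ x m & ~~ y m]).
  have lU (k : int) : locb (fun x y => [&& opposite x y 0 n, ~~ x k & ~~ y k]).
    apply: (locb_op2 andb (locb_opposite 0 n)).
    by exists [:: k] => x x' y y' xx yy; rewrite (xx k) ?(yy k) // inE.
  elim: m => [|m IHm] mn; first by exfalso; case/andP: mn.
  pose g (x y : config) := close x y ||
    [&& (0 < m)%N, opposite x y 0 n, ~~ x m & ~~ y m].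
  have vg : vanishing_event g.
    apply: (vanishing_or vclose); case: (posnP m) => [_|m0] /=.
      exact: vanishing_false.
    by apply: IHm; move: m0 mn; clear; lia.
  apply: (vanishing_step (lU m.+1) _ vg) => x y /and3P[ho xm ym].
  have [c|nc] := boolP (close x y); first by left; rewrite /g c.
  have [h|] := boolP (~~ x 1 || x (n%:Z - 1)).
    by right; have [w hw] := approach x y ho nc h; exists w; rewrite /g hw.
  rewrite negb_or negbK => /andP[x1 xn1].
  have m0 : (0 < m)%N.
    by rewrite lt0n; apply: contraNneq xm => ->.
  have em : m.+1%:Z - 1 = m%:Z by clear; lia.
  have exm : x m = y m by apply: (inner _ _ ho nc); move: m0 mn; clear; lia.
  have e1 : x 1 = y 1 by apply: (inner _ _ ho nc); move: n2; clear; lia.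
  have e2 : x (n%:Z - 1) = y (n%:Z - 1).
    by apply: (inner _ _ ho nc); move: n2; clear; lia.
  have [xm0|xm0] := boolP (x m); last first.
    by left; rewrite /g m0 ho xm0 -exm xm0 orbT.
  right; have mn' : (2 <= m.+1 < n)%N by move: m0 mn; clear; lia.
  move: ho => /orP[] ho.
    have := pm_sort mn' ho x1 e1 xn1 e2; rewrite em.
    move=> /(_ xm0 exm xm ym)[w /and3P[h1 h2 h3]].
    by exists w; rewrite /g m0 /opposite h1 h2 h3 /= orbT.
  have := pm_sort mn' ho; rewrite -e1 -e2 em -exm.
  move=> /(_ x1 erefl xn1 erefl xm0 erefl ym xm)[w /and3P[h1 h2 h3]].
  by exists w; rewrite /g m0 /opposite h1 h2 h3 /= !orbT.
(* When no approach is possible, site [n - 1] is itself a common hole, which starts the leftward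
   motion. *)
have vn : vanishing_event (fun x y =>
    close x y || [&& opposite x y 0 n, ~~ x n.-1 & ~~ y n.-1]).
  by apply: (vanishing_or vclose); apply: vU; move: n2; clear; lia.
apply: (vanishing_step (locb_opposite 0 n) _ vn) => x y o.
have en : n.-1%:Z = n%:Z - 1 by move: n2; clear; lia.
have [c|nc] := boolP (close x y); first by left.
have [h|] := boolP (~~ x 1 || x (n%:Z - 1)).
  by right; have [w hw] := approach x y o nc h; exists w; rewrite hw.
rewrite negb_or negbK => /andP[x1 xn1].
have e2 : x (n%:Z - 1) = y (n%:Z - 1).
  by apply: (inner _ _ o nc); move: n2; clear; lia.
by left; rewrite o /= en -e2 xn1.
Qed.

End annihilation.

(** * Comparison with the Markov measures *)

Section comparison.
Context {R : realType}.
Implicit Types (mu nu m P : probability config R) (f g : config -> R).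

Definition avg (n : nat) f : config -> R :=
  fun x => n%:R^-1 * \sum_(i < n) f (tr i%:Z x).

Lemma loc_avg n f : loc f -> loc (avg n f).
Proof.
move=> lf; apply: loc_op2; first exact: loc_cst.
by apply: loc_sum => i; exact: loc_tr.
Qed.

Lemma E_avg mu n f : translation_invariant mu -> loc f -> (0 < n)%N ->
  E mu (avg n f) = E mu f.
Proof.
move=> imu lf n0; rewrite E_scale; last by apply: loc_sum => i; exact: loc_tr.
rewrite E_sum => [|i]; last exact: loc_tr.
rewrite (eq_bigr (fun=> E mu f)) => [|i _]; last exact: E_tr.
by rewrite sumr_const card_ord -(mulr_natl (E mu f)) mulKf // pnatr_eq0 -lt0n.
Qed.

Lemma avg_unit n f x : (forall x, 0 <= f x <= 1) -> 0 <= avg n f x <= 1.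
Proof.
move=> f01; case: n => [|n].
  by rewrite /avg big_ord0 mulr0 lexx ler01.
apply/andP; split.
  rewrite mulr_ge0 ?invr_ge0 //; apply: sumr_ge0 => i _.
  by have /andP[] := f01 (tr i%:Z x).
rewrite ler_pdivrMl ?ltr0n // mulr1 -[leRHS]mulr_natl mulr1.
rewrite -[in leRHS](card_ord n.+1) -sumr_const; apply: ler_sum => i _.
by have /andP[] := f01 (tr i%:Z x).
Qed.

Lemma mono_unit s (x : config) : 0 <= (mono s x : R) <= 1.
Proof. by rewrite /mono; case: all; rewrite ?lexx ler01. Qed.

Lemma mono_homo s (x y : config) : {in s, forall i, x i ==> y i} ->
  (mono s x : R) <= mono s y.
Proof.
move=> xy; rewrite ler_nat; case: (boolP (all x s)) => //= /allP h.
by rewrite (_ : all y s) //; apply/allP => i si; have := xy i si; rewrite h.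
Qed.

Lemma avg_homo n s (x y : config) :
  {in flatten [seq [seq i + j%:Z | i <- s] | j <- iota 0 n], forall i, x i ==> y i} ->
  (avg n (mono s) x : R) <= avg n (mono s) y.
Proof.
move=> xy; rewrite ler_wpM2l ?invr_ge0 //; apply: ler_sum => j _.
apply: mono_homo => i si; apply: xy; apply/flatten_mapP; exists (j : nat).
  by rewrite mem_iota /=.
exact: (map_f (fun i => i + j%:Z)).
Qed.

Definition negp (r : R) : R := Num.max 0 (- r).

Lemma negp_ge0 r : 0 <= negp r. Proof. by rewrite le_max lexx. Qed.

(** Factors bounded by 1 in absolute value make the product change by at most the change of each
    factor; this trades the random averages of the second configuration for their means. *)
Lemma negp_perturb (a b a' b' p q : R) : 0 <= a <= 1 -> 0 <= b <= 1 ->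
  0 <= a' <= 1 -> 0 <= q <= 1 ->
  negp ((a - p) * (b - q)) <=
    negp ((a - a') * (b - b')) + (`|a' - p| + `|b' - q|).
Proof.
move=> a01 b01 a'01 q01.
have h1 : - ((a' - p) * (b - q)) <= `|a' - p|.
  apply: le_trans (ler_norm _) _; rewrite normrN normrM ler_piMr //.
  by rewrite ler_norml; lra.
have h2 : - ((a - a') * (b' - q)) <= `|b' - q|.
  apply: le_trans (ler_norm _) _; rewrite normrN normrM ler_piMl //.
  by rewrite ler_norml; lra.
rewrite /negp ge_max; apply/andP; split.
  by rewrite !addr_ge0 // le_max lexx.
have : - ((a - a') * (b - b')) <= Num.max 0 (- ((a - a') * (b - b'))).
  by rewrite le_max lexx orbT.
have -> : (a - p) * (b - q) = (a - a') * (b - b') + (a' - p) * (b - q) +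
  (a - a') * (b' - q) by ring.
lra.
Qed.

(* Where the coupled configurations are ordered, both averages are ordered the
   same way, so [G] below is at most the probability of opposite discrepancies,
   which vanishes as the coupling is run. *)
Lemma comparison mu m P s1 s2 n : fair_coins P ->
  translation_invariant mu -> translation_invariant m ->
  (forall f, loc f -> E mu (fun x => E P (fun w => f (step x w))) = E mu f) ->
  (forall f, loc f -> E m (fun x => E P (fun w => f (step x w))) = E m f) ->
  E mu (fun x => negp ((avg n (mono s1) x - E m (mono s1)) *
                       (avg n (mono s2) x - E m (mono s2)))) <=
  E m (fun y => `|avg n (mono s1) y - E m (mono s1)| +
                `|avg n (mono s2) y - E m (mono s2)|).
Proof.
move=> fP imu im smu sm; set p1 := E m (mono s1); set p2 := E m (mono s2).
pose f1 := avg n (mono s1 : config -> R); pose f2 := avg n (mono s2 : config -> R).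
have l1 : loc f1 by apply: loc_avg; exact: loc_mono.
have l2 : loc f2 by apply: loc_avg; exact: loc_mono.
have u1 x : 0 <= f1 x <= 1 by apply: avg_unit; exact: mono_unit.
have u2 x : 0 <= f2 x <= 1 by apply: avg_unit; exact: mono_unit.
pose L x := negp ((f1 x - p1) * (f2 x - p2)).
pose B y := `|f1 y - p1| + `|f2 y - p2|.
pose G (x y : config) := negp ((f1 x - f1 y) * (f2 x - f2 y)).
have lL : loc L.
  apply: (loc_comp negp (f := fun x => (f1 x - p1) * (f2 x - p2))).
  by apply: (loc_op2 (fun a b => (a - p1) * (b - p2))).
have lB : loc B by apply: (loc_op2 (fun a b => `|a - p1| + `|b - p2|)).
have lG : loc2 G.
  apply: (loc2_comp negp (f := fun x y => (f1 x - f1 y) * (f2 x - f2 y))).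
  apply: (loc2_op2 *%R).
    exact: (loc2_op2 (fun a b => a - b) (loc2_fst l1) (loc2_snd l1)).
  exact: (loc2_op2 (fun a b => a - b) (loc2_fst l2) (loc2_snd l2)).
have p201 : 0 <= p2 <= 1.
  rewrite E_ge0 => [|x]; last by have /andP[] := mono_unit s2 x.
  rewrite -[leRHS](E_cst m); apply: E_le; [exact: loc_mono|exact: loc_cst|].
  by move=> x; have /andP[] := mono_unit s2 x.
have LGB x y : L x <= G x y + B y by exact: negp_perturb.
pose W := flatten [seq [seq i + j%:Z | i <- s1] | j <- iota 0 n] ++
          flatten [seq [seq i + j%:Z | i <- s2] | j <- iota 0 n].
pose e (x y : config) := has (fun p : int * int => (p.1 < p.2) && opposite x y p.1 p.2)
   [seq (i, j) | i <- W, j <- W].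
have Ge x y : G x y <= (e x y)%:R.
  have G1 : G x y <= 1.
    rewrite /G /negp ge_max ler01 /=; have := u1 x; have := u1 y.
    have := u2 x; have := u2 y; move: (f1 x) (f1 y) (f2 x) (f2 y).
    by clear; move=> a b c d /andP[? ?] /andP[? ?] /andP[? ?] /andP[? ?]; nra.
  have G0 : (f1 x <= f1 y /\ f2 x <= f2 y) \/ (f1 y <= f1 x /\ f2 y <= f2 x) ->
      G x y <= 0.
    move=> h; rewrite /G /negp ge_max lexx /= oppr_le0.
    by case: h => -[h1 h2]; [apply: mulr_le0|apply: mulr_ge0];
      rewrite ?subr_ge0 ?subr_le0.
  have [//|ne] := boolP (e x y).
  apply: G0; have [/allP h|/allPn[i iW]] := boolP (all (fun i => x i ==> y i) W).
    by left; split; apply: avg_homo => i iW; apply: h; rewrite mem_cat iW ?orbT.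
  rewrite negb_imply => /andP[xi yi].
  (* Once [x] exceeds [y] at one site of [W], the absence of opposite pairs forces [y] below [x] on
     all of [W]. *)
  have h j : j \in W -> y j ==> x j.
    move=> jW; apply/implyP => yj; apply: contraNT ne => xj.
    have ij : i != j by apply: contraNneq xj => <-.
    apply/hasP; move: ij; rewrite neq_lt => /orP[ij|ij].
      exists (i, j); first by apply/allpairsPdep; exists i, j; split.
      by rewrite /= ij /opposite /pm xi yi xj yj.
    exists (j, i); first by apply/allpairsPdep; exists j, i; split.
    by rewrite /= ij /opposite /pm xi yi xj yj orbT.
  by right; split; apply: avg_homo => j jW; apply: h; rewrite mem_cat jW ?orbT.
have ve : vanishing_event mu m P e.
  apply: vanishing_has => -[i j] /=.
  have [ij|_] := boolP (i < j); last exact: vanishing_false.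
  have n0 : (0 < `|(j - i)%R|)%N by move: ij; clear; lia.
  have := vanishing_opposite_tr fP imu im i (vanishing_opposite fP imu im n0).
  have e2 : `|(j - i)%R|%:Z + i = j by move: ij; clear; lia.
  by rewrite add0r e2; exact.
have vG : vanishes mu m P G.
  apply: (vanishes_le lG (loc2_locb R (proj1 ve)) _ (proj2 ve)) => x y.
  by rewrite negp_ge0 Ge.
(* The marginals are stationary, so two of the three terms do not depend on [t] and the third is
   sent to 0. *)
have LE t : E mu L <= Et mu m P t G + E m B.
  rewrite -(Et_fst m fP smu t lL) -(Et_snd mu fP sm t lB).
  rewrite -(Et_add mu m P t lG (loc2_snd lB)).
  by apply: Et_le; [exact: loc2_fst|exact: (loc2_op2 +%R lG (loc2_snd lB))|].
rewrite leNgt; apply/negP => BL.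
have d0 : 0 < E mu L - E m B by rewrite subr_gt0.
have [t ht] := filter_ex (cvgr_lt _ vG _ d0).
by have := LE t; rewrite leNgt -ltrBrDr ht.
Qed.

End comparison.

(** * Fluctuations of averages under a Markov measure *)

Section variance.
Context {R : realType}.
Variables (d : R) (m : probability config R).
Hypotheses (d01 : 0 <= d <= 1) (hm : markov_windows d m).

(** Covariance bound at lag [l] for functions of [k + 1] sites. Truncated subtraction gives the
    trivial bound 1 when the windows overlap. *)
Let bnd (k l : nat) : R := 2^-1 ^+ (l - k).

Let sum_bnd k N : \sum_(l < N) bnd k l <= (minn N k)%:R + 2 - 2 * 2^-1 ^+ (N - k).
Proof.
elim: N => [|N IH]; first by rewrite big_ord0 min0n sub0n expr0; lra.
rewrite big_ord_recr /=; apply: le_trans (lerD IH (lexx _)) _.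
have [Nk|kN] := ltnP N k.
  have -> : minn N.+1 k = N.+1 by lia.
  have -> : (N.+1 - k = 0)%N by lia.
  have e : (N - k = 0)%N by lia.
  by rewrite /bnd e -(natr1 N) !expr0; lra.
have -> : minn N.+1 k = k by lia.
by rewrite /bnd subSn // exprS; lra.
Qed.

(** Covariances decay geometrically in the lag, so adding one term raises the second moment of the
    centred sum by at most [2 * (k + 2)]. *)
Lemma variance_avg a k f n : dep (window a k.+1) f -> (forall x, 0 <= f x <= 1) ->
  (0 < n)%N ->
  E m (fun x => (avg n f x - E m f) ^+ 2) <= (2 * (k%:R + 2)) / n%:R.
Proof.
move=> df f01 n0; set p := E m f.
have lf : loc f by exists (window a k.+1).
have im := markov_windows_invariant hm.
have Ef (i : int) : E m (f \o tr i) = p by exact: E_tr.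
have p01 : 0 <= p <= 1.
  rewrite E_ge0 => [|x]; last by have /andP[] := f01 x.
  rewrite -[leRHS](E_cst m); apply: E_le => //; first exact: loc_cst.
  by move=> x; have /andP[] := f01 x.
pose Z (i : nat) x := f (tr i%:Z x) - p.
have lt (i : int) : loc (f \o tr i) by exact: loc_tr.
have lZ i : loc (Z i).
  by apply: (loc_op2 (fun a b => a - b) (lt i) (loc_cst p)).
have lZZ i j : loc (fun x => Z i x * Z j x) by exact: loc_op2.
have cov i l : E m (fun x => Z i x * Z (i + l)%N x) <= bnd k l.
  pose g x := f (tr i%:Z x) * f (tr (i + l)%N%:Z x).
  have lg : loc g by exact: (loc_op2 *%R (lt i%:Z) (lt (i + l)%N%:Z)).
  have -> : E m (fun x => Z i x * Z (i + l)%N x) = E m g - p * p.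
    rewrite (_ : (fun x => _) = fun x => g x + (- p) * (f (tr i%:Z x))
       + (- p) * f (tr (i + l)%N%:Z x) + p * p); last first.
      by apply/funext => x; rewrite /Z /g; ring.
    have l1 := loc_op2 *%R (loc_cst (- p)) (lt i%:Z).
    have l2 := loc_op2 *%R (loc_cst (- p)) (lt (i + l)%N%:Z).
    have l3 := loc_op2 +%R lg l1; have l4 := loc_op2 +%R l3 l2.
    rewrite (E_add m l4 (loc_cst _)) (E_add m l3 l2) (E_add m lg l1).
    rewrite (E_scale m _ (lt i%:Z)) (E_scale m _ (lt (i + l)%N%:Z)) E_cst.
    by rewrite (Ef i%:Z) (Ef (i + l)%N%:Z); ring.
  have [lk|kl] := ltnP l k.
    rewrite /bnd (_ : (l - k = 0)%N) ?expr0; last by lia.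
    have : E m g <= 1.
      rewrite -[leRHS](E_cst m); apply: E_le => //; first exact: loc_cst.
      move=> x; rewrite /g; have /andP[a0 a1] := f01 (tr i%:Z x).
      have /andP[b0 b1] := f01 (tr (i + l)%N%:Z x).
      by rewrite -[leRHS]mulr1 ler_pM.
    by have /andP[q0 q1] := p01; nra.
  have pf : past (a + i%:Z + k%:Z) (f \o tr i%:Z).
    exists [seq j + i%:Z | j <- window a k.+1]; first exact: dep_tr.
    by move=> j /mapP[j']; rewrite mem_window => h ->; move: h; clear; lia.
  have dh : dep (window (a + i%:Z + k%:Z + (l - k)%N%:Z) k.+1) (f \o tr (i + l)%N%:Z).
    apply: (@dep_sub R _ _ _ _ (@dep_tr R _ f (i + l)%N%:Z df)) => j /mapP[j'].
    by rewrite !mem_window => h ->; move: h kl; clear; lia.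
  have := markov_mixing d01 hm pf dh (fun x => f01 _) (fun x => f01 _).
  rewrite (Ef i%:Z) (Ef (i + l)%N%:Z); apply: le_trans.
  exact: ler_norm.
pose S N x := \sum_(i < N) Z i x.
have lS N : loc (S N) by exact: loc_sum.
have lS2 N : loc (fun x => S N x ^+ 2) by exact: (loc_comp (fun a => a ^+ 2) (lS N)).
pose C : R := 2 * (k%:R + 2).
have ES N : E m (fun x => S N x ^+ 2) <= C * N%:R.
  elim: N => [|N IH].
    rewrite mulr0 (_ : (fun x => _) = fun=> 0) ?E_cst //.
    by apply/funext => x; rewrite /S big_ord0 expr0n.
  rewrite (_ : (fun x => _) = fun x => S N x ^+ 2 +
     (2 * (\sum_(i < N) Z i x * Z N x) + Z N x * Z N x)); last first.
    apply/funext => x; rewrite /S big_ord_recr /= -mulr_suml; ring.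
  have l1 : loc (fun x => \sum_(i < N) Z i x * Z N x) by exact: loc_sum.
  have l2 := loc_op2 *%R (loc_cst 2) l1.
  rewrite (E_add m (lS2 N) (loc_op2 +%R l2 (lZZ N N))) (E_add m l2 (lZZ N N)).
  rewrite (E_scale m _ l1) E_sum //.
  have h1 : \sum_(i < N) E m (fun x => Z i x * Z N x) <= \sum_(i < N) bnd k i.+1.
    (* The term [i] is at lag [N - i]; reversing the order lists the lags 1 to [N]. *)
    rewrite [leRHS](reindex_inj rev_ord_inj) /=; apply: ler_sum => i _.
    have -> : (N - i.+1).+1 = (N - i)%N by have := ltn_ord i; clear; lia.
    have := cov i (N - i)%N; rewrite subnKC //.
    by have := ltn_ord i; clear; lia.
  have h2 : E m (fun x => Z N x * Z N x) <= bnd k 0.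
    by have := cov N 0%N; rewrite addn0.
  have h3 : \sum_(i < N) bnd k i.+1 + bnd k 0 <= k%:R + 2.
    have := sum_bnd k N.+1; rewrite big_ord_recl /= addrC.
    have g0 : 0 <= 2^-1 ^+ (N.+1 - k) :> R by rewrite exprn_ge0 // invr_ge0.
    have mk : (minn N.+1 k)%:R <= k%:R :> R by rewrite ler_nat geq_minr.
    by move: g0 mk; lra.
  have b0 : 0 <= bnd k 0 by rewrite exprn_ge0 // invr_ge0.
  rewrite -(natr1 N) [C * _]mulrDr mulr1; apply: (lerD IH).
  by rewrite /C; move: h1 h2 h3 b0; lra.
have nn : (n%:R : R) != 0 by rewrite pnatr_eq0 -lt0n.
have -> : (fun x => (avg n f x - p) ^+ 2) = fun x => n%:R^-1 ^+ 2 * S n x ^+ 2.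
  apply/funext => x; rewrite -exprMn; congr (_ ^+ 2).
  rewrite /avg /S sumrB sumr_const card_ord mulrBr; congr (_ - _).
  by rewrite -(mulr_natl p) mulKf.
rewrite (E_scale m _ (lS2 n)) -/C.
apply: le_trans (ler_wpM2l _ (ES n)) _; first by rewrite exprn_ge0 // invr_ge0.
by rewrite (_ : _ * (C * n%:R) = C / n%:R) //; field.
Qed.

(** From the variance through [|z| <= e + z^2 / e], with [e] left free to be optimised. *)
Lemma mean_deviation a k f n (e : R) : dep (window a k.+1) f ->
  (forall x, 0 <= f x <= 1) -> (0 < n)%N -> 0 < e ->
  E m (fun x => `|avg n f x - E m f|) <= e + (2 * (k%:R + 2)) / n%:R / e.
Proof.
move=> df f01 n0 e0; have lf : loc f by exists (window a k.+1).
have la := loc_avg n lf.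
have l2 : loc (fun x => (avg n f x - E m f) ^+ 2).
  exact: (loc_comp (fun r => (r - E m f) ^+ 2) la).
have l3 := loc_op2 *%R (loc_cst e^-1) l2.
apply: (@le_trans _ _ (E m (fun x => e + e^-1 * (avg n f x - E m f) ^+ 2))).
  apply: E_le; [exact: (loc_comp (fun r => `|r - E m f|) la)| |move=> x].
    exact: (loc_op2 +%R (loc_cst e) l3).
  set z := avg n f x - E m f.
  rewrite -(@ler_pM2l _ e) // mulrDr mulrA mulfV ?gt_eqF // mul1r.
  rewrite -[z ^+ 2](real_normK (num_real z)); have := normr_ge0 z; nra.
rewrite (E_add m (loc_cst e) l3) E_cst (E_scale m _ l2) lerD2l mulrC.
by apply: ler_wpM2r; [rewrite invr_ge0 ltW|exact: variance_avg df f01 n0].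
Qed.

End variance.

(** * Dependence of the Markov measures on the density *)

Section lipschitz.
Context {R : realType}.

(** A 1-Lipschitz retraction onto [0,1], making the family of measures and its regularity global on
    the line. *)
Definition clamp (d : R) : R := Num.max 0 (Num.min d 1).

Lemma clamp01 d : 0 <= clamp d <= 1.
Proof.
by rewrite /clamp le_max lexx /= ge_max ler01 ge_min lexx orbT.
Qed.

Lemma clamp_id d : 0 <= d <= 1 -> clamp d = d.
Proof. by move=> /andP[d0 d1]; rewrite /clamp (min_idPl d1) (max_idPr d0). Qed.

Lemma clamp_dist d e : `|clamp d - clamp e| <= `|d - e|.
Proof.
have cE (r : R) : clamp r = if r < 0 then 0 else if 1 < r then 1 else r.
  rewrite /clamp; case: (ltP r 0) => r0; case: (ltP 1 r) => r1; try lra.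
  - by rewrite (max_idPl (ltW r0)).
  - by rewrite (max_idPr ler01).
  - by rewrite (max_idPr r0).
rewrite !cE; case: (ltP d 0) => ?; case: (ltP 1 d) => ?; case: (ltP e 0) => ?;
  case: (ltP 1 e) => ?; case: (lerP e d) => ?; rewrite ?ler_norml;
  try (apply/andP; split); lra.
Qed.

(** Bounded and Lipschitz: boundedness is included so that the class is stable under products. *)
Definition blip (g : R -> R) := exists M L, forall d, `|g d| <= M /\
  forall e, `|g d - g e| <= L * `|d - e|.

Lemma blip_cst r : blip (fun=> r).
Proof. by exists `|r|, 0 => d; split=> // e; rewrite subrr normr0 mul0r. Qed.

Lemma blip_continuous g : blip g -> continuous g.
Proof.
move=> [M [L gP]] d; apply/cvgrPdist_le => e e0; have [_ h] := gP d.
have L1 : 0 < `|L| + 1 by rewrite ltr_wpDl.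
near=> y; apply: le_trans (h y) _.
apply: (@le_trans _ _ ((`|L| + 1) * `|d - y|)).
  by rewrite ler_wpM2r // (le_trans (ler_norm L)) // lerDl.
rewrite -ler_pdivlMl //; near: y.
by apply: (@cvgr_dist_le _ _ _ _ _ id d) => //; rewrite mulr_gt0 // invr_gt0.
Unshelve. all: by end_near. Qed.

Lemma blip_add g h : blip g -> blip h -> blip (fun d => g d + h d).
Proof.
move=> [M [L gP]] [M' [L' hP]]; exists (M + M'), (L + L') => d.
have [g1 g2] := gP d; have [h1 h2] := hP d; split=> [|e].
  exact: le_trans (ler_normD _ _) (lerD g1 h1).
rewrite opprD addrACA mulrDl.
exact: le_trans (ler_normD _ _) (lerD (g2 e) (h2 e)).
Qed.

Lemma blip_mul g h : blip g -> blip h -> blip (fun d => g d * h d).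
Proof.
move=> [M [L gP]] [M' [L' hP]]; exists (M * M'), (L * M' + M * L') => d.
have [g1 g2] := gP d; have [h1 h2] := hP d; split=> [|e].
  by rewrite normrM ler_pM.
have -> : g d * h d - g e * h e = (g d - g e) * h d + g e * (h d - h e) by ring.
apply: le_trans (ler_normD _ _) _; rewrite !normrM mulrDl; apply: lerD.
  by rewrite mulrAC ler_pM.
by rewrite -mulrA ler_pM //; have [] := gP e.
Qed.

Let snorm_facts (d : R) : 0 <= d <= 1 ->
  [/\ 2^-1 <= snorm d & snorm d ^+ 2 = d ^+ 2 + (1 - d) ^+ 2].
Proof.
move=> /andP[d0 d1]; have sq : snorm d ^+ 2 = d ^+ 2 + (1 - d) ^+ 2.
  by rewrite sqr_sqrtr //; nra.
split=> //; have s0 : 0 <= snorm d by exact: sqrtr_ge0.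
have le2 (a b : R) : 0 <= a -> 0 <= b -> a ^+ 2 <= b ^+ 2 -> a <= b.
  by move=> a0 b0; rewrite ler_pXn2r.
apply: le2 => //; rewrite ?invr_ge0 // sq; nra.
Qed.

(** Multiplying numerator and denominator by [1 + snorm d] removes the denominators that vanish at 0
    or 1. *)
Let qtransE (d : R) : 0 <= d <= 1 ->
  qtrans d false true = 2 * d / (1 + snorm d) /\
  qtrans d true false = 2 * (1 - d) / (1 + snorm d).
Proof.
move=> d01; have [s0 s2] := snorm_facts d01; have /andP[d0 d1] := d01.
have h : 1 + snorm d != 0 by rewrite gt_eqF //; lra.
rewrite /qtrans; case: eqP => [dE|/eqP dN0].
  have sE : snorm d = 1 by rewrite /snorm dE expr0n subr0 expr1n add0r sqrtr1.
  by rewrite sE dE; split => /=; field.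
case: eqP => [dE|/eqP dN1].
  have sE : snorm d = 1 by rewrite /snorm dE subrr expr0n expr1n addr0 sqrtr1.
  by rewrite sE dE; split => /=; field.
have d1' : 1 - d != 0 by rewrite subr_eq0 eq_sym.
by split; apply/eqP; rewrite eqr_div //; apply/eqP; nra.
Qed.

Let lip_ratio (a b s t : R) : 0 <= a <= 1 -> 0 <= b <= 1 -> 2^-1 <= s -> 2^-1 <= t ->
  `|s - t| <= 2 * `|a - b| -> t <= 1 ->
  `|2 * a / (1 + s) - 2 * b / (1 + t)| <= 8 * `|a - b|.
Proof.
move=> a01 b01 s0 t0 st t1.
have -> : 2 * a / (1 + s) - 2 * b / (1 + t) =
  (2 * (a - b) * (1 + t) + 2 * b * (t - s)) / ((1 + s) * (1 + t)).
  by field; apply/andP; split; rewrite gt_eqF //; lra.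
rewrite normrM [`|_^-1|]ger0_norm; last by rewrite invr_ge0; nra.
rewrite ler_pdivrMr; last by nra.
(* Each of the two terms contributes 4: [2 * (1 + t) <= 4] in the first, [2 * b * 2 <= 4] in the
   second. *)
have h : `|2 * (a - b) * (1 + t) + 2 * b * (t - s)| <= 8 * `|a - b|.
  apply: le_trans (ler_normD _ _) _; rewrite !normrM (distrC t s).
  rewrite (ger0_norm (_ : 0 <= (1 + t))); last by lra.
  rewrite (ger0_norm (_ : 0 <= (2 : R))) // (ger0_norm (_ : 0 <= b)); last by lra.
  have := normr_ge0 (a - b); have := normr_ge0 (s - t).
  by move: (`|s - t|) (`|a - b|) st => u v; nra.
by apply: le_trans h _; rewrite ler_peMr ?mulr_ge0 //; nra.
Qed.

Let snorm_lip (a b : R) : 0 <= a <= 1 -> 0 <= b <= 1 ->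
  `|snorm a - snorm b| <= 2 * `|a - b|.
Proof.
move=> a01 b01; have [sa sa2] := snorm_facts a01; have [sb sb2] := snorm_facts b01.
have e : (snorm a - snorm b) * (snorm a + snorm b) = (a - b) * (2 * (a + b - 1)).
  by rewrite -subr_sqr sa2 sb2; ring.
have p : `|snorm a - snorm b| <= `|snorm a - snorm b| * (snorm a + snorm b).
  by rewrite ler_peMr //; lra.
apply: le_trans p _; rewrite -[X in _ * X <= _]ger0_norm; last by lra.
rewrite -normrM e normrM mulrC ler_wpM2r //.
by rewrite ler_norml; lra.
Qed.

Let snorm_le1 (d : R) : 0 <= d <= 1 -> snorm d <= 1.
Proof.
move=> d01; have [s0 s2] := snorm_facts d01.
have le2 (a b : R) : 0 <= a -> 0 <= b -> a ^+ 2 <= b ^+ 2 -> a <= b.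
  by move=> a0 b0; rewrite ler_pXn2r.
by apply: le2 => //; [lra|rewrite s2; nra].
Qed.

Lemma blip_qtrans b c : blip (fun d => qtrans (clamp d) b c).
Proof.
have H01 : blip (fun d => qtrans (clamp d) false true).
  exists 1, 8 => d; have c1 := clamp01 d; split=> [|e].
    have := qtrans_ge0 c1 false true; have := qtrans_ge0 c1 false false.
    by have := qtrans_row c1 false; rewrite ler_norml; lra.
  have c2 := clamp01 e.
  have [s1 _] := snorm_facts c1; have [s2 _] := snorm_facts c2.
  rewrite (proj1 (qtransE c1)) (proj1 (qtransE c2)).
  apply: le_trans (lip_ratio c1 c2 s1 s2 (snorm_lip c1 c2) (snorm_le1 c2)) _.
  by rewrite ler_wpM2l // clamp_dist.
have H10 : blip (fun d => qtrans (clamp d) true false).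
  exists 1, 8 => d; have c1 := clamp01 d; split=> [|e].
    have := qtrans_ge0 c1 true true; have := qtrans_ge0 c1 true false.
    by have := qtrans_row c1 true; rewrite ler_norml; lra.
  have c2 := clamp01 e.
  have [s1 _] := snorm_facts c1; have [s2 _] := snorm_facts c2.
  rewrite (proj2 (qtransE c1)) (proj2 (qtransE c2)).
  have c1' : 0 <= 1 - clamp d <= 1 by lra.
  have c2' : 0 <= 1 - clamp e <= 1 by lra.
  have e1 : `|1 - clamp d - (1 - clamp e)| = `|clamp d - clamp e|.
    by rewrite -normrN; congr `|_|; ring.
  have sl := snorm_lip c1 c2; rewrite -e1 in sl.
  apply: le_trans (lip_ratio c1' c2' s1 s2 sl (snorm_le1 c2)) _.
  by rewrite e1 ler_wpM2l // clamp_dist.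
case: b c => [] [] //.
  rewrite (_ : (fun d => _) = fun d => 1 + (-1) * qtrans (clamp d) true false).
    by apply: blip_add; [exact: blip_cst|apply: blip_mul => //; exact: blip_cst].
  by apply/funext => d; have := qtrans_row (clamp01 d) true; lra.
rewrite (_ : (fun d => _) = fun d => 1 + (-1) * qtrans (clamp d) false true).
  by apply: blip_add; [exact: blip_cst|apply: blip_mul => //; exact: blip_cst].
by apply/funext => d; have := qtrans_row (clamp01 d) false; lra.
Qed.

Lemma blip_pinit b : blip (fun d => pinit (clamp d) b).
Proof.
have H : blip clamp.
  exists 1, 1 => d; have c1 := clamp01 d; split=> [|e].
    by rewrite ler_norml; lra.
  by rewrite mul1r clamp_dist.
case: b => //=.
rewrite (_ : (fun d => _) = fun d => 1 + (-1) * clamp d).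
  by apply: blip_add; [exact: blip_cst|apply: blip_mul => //; exact: blip_cst].
by apply/funext => d; ring.
Qed.

Lemma markov_family : exists m : R -> probability config R,
  forall d, markov_windows (clamp d) (m d).
Proof.
have [m hm] := boolp.choice (fun d : R => markov_exists (clamp01 d)).
by exists m.
Qed.

Variable m : R -> probability config R.
Hypothesis hm : forall d, markov_windows (clamp d) (m d).

(** Cylinder probabilities are finite products of entries with this regularity, and they span the
    local functions on a window. *)
Lemma blip_E f : loc f -> blip (fun d => E (m d) f).
Proof.
move=> [s df]; have [a [k sak]] := window_cover s.
have {df}df : dep (window a k.+1) f.
  by apply: dep_sub df => i /sak; rewrite !mem_window; lia.
have tl (g : config -> R) : dep (window a k.+1) g -> loc g.
  by move=> dg; exists (window a k.+1).
apply: (icyl_ind (Pr := fun f => blip (fun d => E (m d) f)) _ _ _ df).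
- move=> g h dg dh Hg Hh; under eq_fun do rewrite (E_add _ (tl _ dg) (tl _ dh)).
  exact: blip_add.
- move=> r g dg Hg; under eq_fun do rewrite (E_scale _ _ (tl _ dg)).
  by apply: blip_mul => //; exact: blip_cst.
- move=> b; under eq_fun do rewrite hm.
  elim: k {df tl sak} => [|k IH].
    rewrite /markov_weight; under eq_fun do rewrite big_ord0.
    by apply: blip_mul; [exact: blip_pinit|exact: blip_cst].
  under eq_fun do rewrite markov_weight_recr.
  by apply: blip_mul => //; exact: blip_qtrans.
Qed.

Lemma E_density d i : E (m d) (mono [:: i]) = clamp d.
Proof.
rewrite (_ : mono [:: i] = fun x => (x i)%:R).
  by rewrite (markov_initial i (fun b => b%:R) (hm d)) /=; ring.
by apply/funext => x; rewrite /mono /= andbT.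
Qed.

Lemma E_mono_ub d i s : E (m d) (mono (i :: s)) <= clamp d.
Proof.
rewrite -(E_density d i); apply: E_le; try exact: loc_mono.
by move=> x; rewrite ler_nat /=; case: (x i) => //=; case: all.
Qed.

(** A union bound over the sites that may be empty. Together with [E_mono_ub] it pins the mean near
    the endpoints of [0,1], where the grid argument has no point on one side. *)
Lemma E_mono_lb d s : 1 - (size s)%:R * (1 - clamp d) <= E (m d) (mono s).
Proof.
elim: s => [|i s IH] /=.
  rewrite mul0r subr0 (_ : mono [::] = fun=> 1) ?E_cst ?lexx //.
have l1 := @loc_mono R [:: i]; have l2 := @loc_mono R s.
have l3 := @loc_mono R (i :: s).
have : E (m d) (mono s) + E (m d) (mono [:: i]) <= E (m d) (mono (i :: s)) + 1.
  rewrite -[X in _ <= _ + X](E_cst (m d)) -(E_add _ l2 l1) -(E_add _ l3 (loc_cst 1)).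
  apply: E_le; [exact: loc_op2|exact: (loc_op2 +%R l3 (loc_cst 1))|move=> x].
  by rewrite /mono /= andbT; case: (x i) (all x s) => [] [] /=; lra.
by rewrite E_density -(natr1 (size s)); lra.
Qed.

End lipschitz.

Section grid.
Context {R : realType}.

(* At the grid point about [1/K] to [2/K] beyond [X], on the side where [F]
   disagrees with [phi], the two factors have opposite signs. *)
Lemma grid_bound (phi : R -> R) (L A F X : R) (K : nat) :
  (0 < K)%N -> 0 <= L -> 0 <= A -> 0 <= F <= 1 -> 0 <= X <= 1 ->
  (forall d e, `|phi d - phi e| <= L * `|d - e|) ->
  (forall d, 0 <= d <= 1 -> 1 - A * (1 - d) <= phi d <= d) ->
  `|F - phi X| <= (2 * L + 2 * A + 1) / K%:R +
    K%:R * \sum_(j < K.+1) negp ((X - j%:R / K%:R) * (F - phi (j%:R / K%:R))).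
Proof.
move=> K0 L0 A0 F01 X01 phiL phiA.
pose k : R := K%:R^-1; have Kk : K%:R * k = 1 by rewrite mulfV // pnatr_eq0 -lt0n.
have k0 : 0 < k by rewrite invr_gt0 ltr0n.
have KR0 : 0 < K%:R :> R by rewrite ltr0n.
set S := \sum_(j < _) _; rewrite -/k.
have Sj (j : nat) : (j <= K)%N ->
    K%:R * negp ((X - j%:R * k) * (F - phi (j%:R * k))) <= K%:R * S.
  move=> jK; rewrite ler_pM2l // /S (bigD1 (Ordinal (jK : (j < K.+1)%N))) //= lerDl.
  by apply: sumr_ge0 => i _; exact: negp_ge0.
have S0 : 0 <= K%:R * S.
  by rewrite mulr_ge0 // ?ler0n //; apply: sumr_ge0 => i _; exact: negp_ge0.
have negpP (r : R) : - r <= negp r by rewrite le_max lexx orbT.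
have neg0 (r : R) : 0 <= negp r by exact: negp_ge0.
have [t [tX Xt]] : exists t : nat, t%:R * k <= X /\ X < t.+1%:R * k.
  exists (Num.truncn (X * K%:R)).
  have XK : 0 <= X * K%:R by rewrite mulr_ge0 // ?ler0n //; lra.
  have /andP[h1 h2] := truncn_itv XK.
  rewrite -(ler_pM2r KR0) -(ltr_pM2r KR0) -!mulrA (mulrC k) Kk !mulr1.
  by [].
have Lk : 0 <= L * k by rewrite mulr_ge0 // ltW.
have Ak : 0 <= A * k by rewrite mulr_ge0 // ltW.
have phiX := phiA X X01.
rewrite ler_norml; apply/andP; split.
  (* Too close to 0 for a grid point on the left; [phi X <= X] bounds the difference directly. *)
  have [X1|X1] := ltP X k; first by move: phiX; nra.
  have t1 : (0 < t)%N.
    by case: t tX Xt => // _; rewrite mul1r; move: X1; lra.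
  have tK : (t.-1 <= K)%N.
    rewrite -(ler_nat R) -(ler_pM2r k0) Kk; apply: le_trans (_ : t%:R * k <= _).
      by rewrite ler_pM2r // ler_nat leq_pred.
    lra.
  have dt : t.-1%:R * k = t%:R * k - k.
    by rewrite -[in RHS](prednK t1) -natr1 mulrDl mul1r addrK.
  have dt' : t.+1%:R * k = t%:R * k + k by rewrite -natr1 mulrDl mul1r.
  have := Sj _ tK; rewrite dt; set d := t%:R * k - k; set D := phi d => H.
  have h : D - F <= K%:R * S.
    have [DF|DF] := leP D F; first by lra.
    apply: le_trans H; have := negpP ((X - d) * (F - D)) => h.
    rewrite -(ler_pM2l k0) mulrA (mulrC k K%:R) Kk mul1r; apply: le_trans h.
    by move: X1 DF; rewrite /d; nra.
  have := phiL X d; rewrite -/D (@ger0_norm _ (X - d)); last by rewrite /d; lra.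
  rewrite ler_norml => /andP[_ h'].
  have : L * (X - d) <= L * (2 * k) by rewrite ler_wpM2l // /d; lra.
  by rewrite !mulrDl; lra.
(* Too close to 1 for a grid point on the right; the lower bound on [phi X] and [F <= 1] suffice. *)
have [X1|X1] := ltP (1 - 2 * k) X; first by move: phiX; nra.
have dt' : t.+1%:R * k = t%:R * k + k by rewrite -natr1 mulrDl mul1r.
have dt : t.+2%:R * k = t%:R * k + 2 * k by rewrite -addn2 natrD mulrDl.
have tK : (t.+2 <= K)%N.
  by rewrite -(ler_nat R) -(ler_pM2r k0) Kk dt; lra.
have := Sj _ tK; rewrite dt; set d := t%:R * k + 2 * k; set D := phi d => H.
have h : F - D <= K%:R * S.
  have [DF|DF] := leP F D; first by lra.
  apply: le_trans H; have := negpP ((X - d) * (F - D)) => h.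
  rewrite -(ler_pM2l k0) mulrA (mulrC k K%:R) Kk mul1r; apply: le_trans h.
  by move: X1 DF; rewrite /d; nra.
have := phiL d X; rewrite -/D (@ger0_norm _ (d - X)); last by rewrite /d; lra.
rewrite ler_norml => /andP[_ h'].
have : L * (d - X) <= L * (2 * k) by rewrite ler_wpM2l // /d; lra.
by rewrite !mulrDl; lra.
Qed.

End grid.

(** * The asymptotic density *)

Section density.
Context {R : realType}.
Variable m : R -> probability config R.
Hypothesis hm : forall d, markov_windows (clamp d) (m d).
Variables (mu P : probability config R).
Hypotheses (fP : fair_coins P) (imu : translation_invariant mu).
Hypothesis smu : forall f, loc f ->
  E mu (fun x => E P (fun w => f (step x w))) = E mu f.

Definition density (n : nat) : config -> R := avg n (mono [:: 0]).

Lemma density01 n x : 0 <= density n x <= 1.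
Proof. by apply: avg_unit; exact: mono_unit. Qed.

Lemma loc_density n : loc (density n).
Proof. by apply: loc_avg; exact: loc_mono. Qed.

Let mono_deviation s : exists2 B, 0 <= B & forall d n (e : R), (0 < n)%N -> 0 < e ->
  E (m d) (fun x => `|avg n (mono s) x - E (m d) (mono s)|) <= e + B / n%:R / e.
Proof.
have [a [k sak]] := window_cover s.
exists (2 * (k%:R + 2)) => [|d n e n0 e0]; first by rewrite mulr_ge0 // addr_ge0.
have df : dep (window a k.+1) (mono s : config -> R).
  have := @dep_icyl R s (fun=> true); rewrite -monoE; apply: dep_sub => i /sak.
  by rewrite !mem_window; clear; lia.
exact: (mean_deviation (clamp01 d) (hm d) df (mono_unit s) n0 e0).
Qed.

Lemma loc_E_density n f : loc f -> loc (fun x => E (m (density n x)) f).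
Proof.
by move=> _; exact: (loc_comp (fun r => E (m r) f) (loc_density n)).
Qed.

(** [grid_bound] is averaged over [mu], each of its [K + 1] terms being controlled by [comparison]
    with the Markov measure at the grid density. The monomial has at least one site so that its mean
    is at most [d]. *)
Let bound i s : exists C B : R, [/\ 0 <= C, 0 <= B &
  forall K n e, (0 < K)%N -> (0 < n)%N -> 0 < e ->
  `|E mu (mono (i :: s)) - E mu (fun x => E (m (density n x)) (mono (i :: s)))| <=
  C / K%:R + (K%:R * K.+1%:R) * (2 * e + B / n%:R / e)].
Proof.
set f := mono (i :: s); have lf : loc f by exact: loc_mono.
have [M [L0 ML]] := blip_E hm lf.
pose A : R := (size (i :: s))%:R.
have [B1 B10 dev1] := mono_deviation [:: 0].
have [B2 B20 dev2] := mono_deviation (i :: s).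
exists (2 * `|L0| + 2 * A + 1), (B1 + B2); split=> [||K n e K0 n0 e0].
- by rewrite !addr_ge0 ?mulr_ge0 // ler0n.
- exact: addr_ge0.
pose phi d := E (m d) f; pose F := avg n f.
have lF : loc F by exact: loc_avg.
have lphi : loc (fun x => phi (density n x)) by exact: loc_E_density.
have lX := loc_density n.
have -> : E mu (fun x => E (m (density n x)) f) = E mu (fun x => phi (density n x)).
  by [].
rewrite -(E_avg imu lf n0) -/F.
rewrite -(E_sub mu lF lphi).
have lD : loc (fun x => F x - phi (density n x)).
  exact: (loc_op2 (fun a b => a - b) lF lphi).
have lA : loc (fun x => `|F x - phi (density n x)|) by exact: (loc_comp Num.norm lD).
have absE : `|E mu (fun x => F x - phi (density n x))| <=
    E mu (fun x => `|F x - phi (density n x)|).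
  rewrite ler_norml; apply/andP; split; last first.
    by apply: E_le => // x; exact: ler_norm.
  rewrite -mulN1r -(E_scale mu (-1) lA); apply: E_le => //.
    exact: (loc_op2 *%R (loc_cst (-1)) lA).
  by move=> x; rewrite mulN1r lerNl -normrN ler_norm.
apply: le_trans absE _.
pose d j : R := j%:R / K%:R.
pose N (j : nat) x := negp ((density n x - d j) * (F x - phi (d j))).
have lN j : loc (N j).
  apply: (loc_comp negp (f := fun x => (density n x - d j) * (F x - phi (d j)))).
  exact: (loc_op2 (fun a b => (a - d j) * (b - phi (d j))) lX lF).
have lS : loc (fun x => \sum_(j < K.+1) N j x) by exact: loc_sum.
have lKS := loc_op2 *%R (loc_cst K%:R) lS.
set c := _ / K%:R.
apply: (@le_trans _ _ (E mu (fun x => c + K%:R * \sum_(j < K.+1) N j x))).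
  apply: E_le => //; first exact: (loc_op2 +%R (loc_cst c) lKS).
  move=> x; apply: (@grid_bound _ phi `|L0| A) => //.
  - by apply: avg_unit; exact: mono_unit.
  - exact: density01.
  - move=> a b; have [_ h] := ML a; apply: le_trans (h b) _.
    by rewrite ler_wpM2r // ler_norm.
  - move=> a a01; apply/andP; split.
      by have := E_mono_lb hm a (i :: s); rewrite (clamp_id a01).
    by have := E_mono_ub hm a i s; rewrite (clamp_id a01).
rewrite (E_add mu (loc_cst c) lKS) E_cst (E_scale mu _ lS) E_sum // lerD2l -mulrA.
apply: ler_wpM2l; first exact: ler0n.
have EN (j : 'I_K.+1) : E mu (N j) <= 2 * e + (B1 + B2) / n%:R / e.
  have d01 : 0 <= d j <= 1.
    rewrite /d divr_ge0 ?ler0n //= ler_pdivrMr ?ltr0n // mul1r ler_nat.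
    by rewrite -ltnS.
  have im := markov_windows_invariant (hm (d j)).
  have sm := markov_stationary (clamp01 (d j)) (hm (d j)) fP.
  have := comparison [:: 0] (i :: s) n fP imu im smu sm.
  rewrite (E_density hm) (clamp_id d01) => /le_trans; apply.
  have l1 : loc (fun y => `|avg n (mono [:: 0]) y - d j|).
    exact: (loc_comp (fun r => `|r - d j|) lX).
  have l2 : loc (fun y => `|F y - phi (d j)|).
    exact: (loc_comp (fun r => `|r - phi (d j)|) lF).
  rewrite (E_add _ l1 l2).
  have := dev1 (d j) n e n0 e0; rewrite (E_density hm) (clamp_id d01) => h1.
  have h2 : E (m (d j)) (fun y => `|F y - phi (d j)|) <= e + B2 / n%:R / e.
    exact: dev2.
  apply: le_trans (lerD h1 h2) _.
  by rewrite !mulrDl; lra.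
apply: le_trans (ler_sum _ (fun j _ => EN j)) _.
by rewrite sumr_const card_ord -[leLHS]mulr_natl lexx.
Qed.

Lemma density_cvg f : loc f ->
  (fun n => E mu (fun x => E (m (density n x)) f)) @ \oo --> E mu f.
Proof.
move=> lf; apply: (mono_ind (Pr := fun f =>
  (fun n => E mu (fun x => E (m (density n x)) f)) @ \oo --> E mu f) _ _ _ lf).
- move=> g h lg lh Hg Hh; rewrite (E_add mu lg lh).
  rewrite (_ : (fun n => _) = fun n => E mu (fun x => E (m (density n x)) g) +
     E mu (fun x => E (m (density n x)) h)); first exact: cvgD.
  apply/funext => n; rewrite -(E_add mu (loc_E_density n lg) (loc_E_density n lh)).
  by congr E; apply/funext => x; exact: E_add.
- move=> r g lg Hg; rewrite (E_scale mu r lg).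
  rewrite (_ : (fun n => _) = fun n => r * E mu (fun x => E (m (density n x)) g)).
    exact: cvgMl_tmp.
  apply/funext => n; rewrite -(E_scale mu r (loc_E_density n lg)).
  by congr E; apply/funext => x; exact: E_scale.
case=> [|i s].
  have -> : mono [::] = fun=> 1 :> R by [].
  rewrite E_cst; under eq_fun do under eq_fun do rewrite E_cst.
  by under eq_fun do rewrite E_cst; exact: cvg_cst.
have [C [B [C0 B0 bnd]]] := bound i s.
apply/cvgrPdist_le => eps eps0.
(* The grid size is fixed before [e], and [e] before [n]: each of the three contributions becomes at
   most [eps / 3]. *)
pose K := (Num.truncn (3 * C / eps)).+1.
have KP : C / K%:R <= eps / 3.
  have h : 3 * C / eps < K%:R.
    by have /andP[] := truncn_itv (divr_ge0 (mulr_ge0 (ler0n _ 3) C0) (ltW eps0)).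
  rewrite ler_pdivrMr ?ltr0n //; move: h; rewrite ltr_pdivrMr // => h.
  by rewrite mulrC; lra.
pose k : R := K%:R * K.+1%:R.
have k0 : 0 < k by rewrite mulr_gt0 // ltr0n.
pose e := eps / (6 * k).
have e0 : 0 < e by rewrite divr_gt0 // mulr_gt0.
have ke : k * (2 * e) = eps / 3 by rewrite /e; field; rewrite gt_eqF.
near=> n.
have n0 : (0 < n)%N by near: n; exact: nbhs_infty_gt.
apply: le_trans (bnd K n e isT n0 e0) _.
have hn : 3 * k * B / e / eps <= n%:R by near: n; exact: nbhs_infty_ger.
rewrite -/k mulrDr ke.
have : k * (B / n%:R / e) <= eps / 3.
  have nR : 0 < n%:R :> R by rewrite ltr0n.
  rewrite (_ : k * _ = (3 * k * B / e / eps) * (eps / 3) / n%:R); last first.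
    by field; rewrite !gt_eqF.
  rewrite ler_pdivrMr // mulrC ler_pM2l //; lra.
by move: KP; lra.
Unshelve. all: by end_near. Qed.

(** By [density_cvg], [E mu f] is a limit of averages of the numbers [E (m d) f], so a bound uniform
    in [d] passes to [mu]. *)
Lemma E_le_sup f b : loc f -> (forall d, E (m d) f <= b) -> E mu f <= b.
Proof.
move=> lf h; rewrite leNgt; apply/negP => fb.
have [n hn] := filter_ex (cvgr_gt _ (density_cvg lf) _ fb).
move: hn; apply/negP; rewrite -leNgt -[leRHS](E_cst mu); apply: E_le => //.
  exact: loc_E_density.
exact: loc_cst.
Qed.

(** Under each [m d] both densities are within variance [4/p], respectively [4/q], of their common
    mean; [E_le_sup] transfers the estimate to [mu]. *)
Lemma density_cauchy p q : (0 < p)%N -> (0 < q)%N ->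
  E mu (fun x => (density p x - density q x) ^+ 2) <= 8 / p%:R + 8 / q%:R.
Proof.
move=> p0 q0; apply: E_le_sup => [|d].
  exact: (loc_op2 (fun a b => (a - b) ^+ 2) (loc_density p) (loc_density q)).
have df : dep (window 0 1) (mono [:: 0] : config -> R).
  by rewrite monoE; exact: dep_icyl.
pose V n x := (density n x - E (m d) (mono [:: 0])) ^+ 2.
have lV n : loc (V n).
  exact: (loc_comp (fun r => (r - E (m d) (mono [:: 0])) ^+ 2) (loc_density n)).
have VE n : (0 < n)%N -> E (m d) (V n) <= 4 / n%:R.
  move=> n0; have := variance_avg (clamp01 d) (hm d) df (mono_unit _) n0.
  by move/le_trans; apply; rewrite add0r -natrM.
have l2 n : loc (fun x => 2 * V n x) by apply: loc_op2 => //; exact: loc_cst.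
apply: (@le_trans _ _ (E (m d) (fun x => 2 * V p x + 2 * V q x))).
  apply: E_le => [||x].
  - exact: (loc_op2 (fun a b => (a - b) ^+ 2) (loc_density p) (loc_density q)).
  - exact: loc_op2.
  - rewrite /V; move: (density p x) (density q x) (E _ _) => a b c.
    (* This is [(a - b)^2 <= 2 * (a - c)^2 + 2 * (b - c)^2]. *)
    rewrite -subr_ge0 (_ : _ - _ = (a + b - 2 * c) ^+ 2) ?sqr_ge0 //; ring.
rewrite (E_add _ (l2 p) (l2 q)) (E_scale _ _ (lV p)) (E_scale _ _ (lV q)).
have -> : 8 / p%:R + 8 / q%:R = 2 * (4 / p%:R) + 2 * (4 / q%:R) :> R.
  by rewrite !mulrA -natrM.
by rewrite lerD // ler_pM2l // VE.
Qed.

(** Lengths [8^k] make the squared increments of order [8^-k], still summable, as [4^-k], after the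
    weight [2^k] in [g]. *)
Let Z k : config -> R := density (8 ^ k).

Let g k (x : config) : R := 2 ^+ k * (Z k x - Z k.+1 x) ^+ 2.

Let g_ge0 k x : 0 <= g k x.
Proof. by rewrite mulr_ge0 ?sqr_ge0 // exprn_ge0. Qed.

Let loc_g k : loc (g k).
Proof.
exact: (loc_op2 (fun a b => 2 ^+ k * (a - b) ^+ 2) (loc_density _) (loc_density _)).
Qed.

Let E_g k : E mu (g k) <= 9 * 4^-1 ^+ k.
Proof.
have lz := loc_op2 (fun a b => (a - b) ^+ 2)
  (loc_density (8 ^ k)) (loc_density (8 ^ k.+1)).
rewrite (E_scale mu _ lz).
have h8 j : (0 < 8 ^ j)%N by rewrite expn_gt0.
apply: le_trans (ler_wpM2l _ (density_cauchy (h8 k) (h8 k.+1))) _.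
  exact: exprn_ge0.
have -> : (2 : R) ^+ k * (8 / (8 ^ k)%:R + 8 / (8 ^ k.+1)%:R) =
    9 * (2 ^+ k / (8 ^ k)%:R).
  rewrite expnS natrM; field.
  by rewrite pnatr_eq0 -lt0n h8.
rewrite natrX -exprVn -exprMn (_ : 2 * 8^-1 = 4^-1 :> R) //.
by field.
Qed.

(** The series of the [g k] has finite expectation, hence converges almost everywhere, and it
    dominates the increments up to a geometric series. *)
Let ae_cvg : {ae mu, forall x, cvgn (Z ^~ x)}.
Proof.
have mg k : measurable_fun setT (fun x => (g k x)%:E).
  by apply/measurable_EFinP; exact: loc_measurable.
have g0 k x : setT x -> (0 <= (g k x)%:E)%E by move=> _; rewrite lee_fin.
pose h x := (\sum_(k <oo) (g k x)%:E)%E.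
have mh : measurable_fun setT h.
  by apply: (ge0_emeasurable_sum (P := xpredT)) => // *; rewrite lee_fin.
have h0 x : (0 <= h x)%E by apply: nneseries_ge0 => k _ _; rewrite lee_fin.
have ih : mu.-integrable setT h.
  apply/integrableP; split=> //.
  under eq_integral => x _ do rewrite gee0_abs //.
  rewrite /h integral_nneseries //.
  apply: (@le_lt_trans _ _ (\sum_(k <oo) (9 * 4^-1 ^+ k)%:E)%E).
    apply: lee_nneseries => [k _ _|k _]; first by apply: integral_ge0 => x; exact: g0.
    rewrite -[leLHS]fineK ?lee_fin; first exact: E_g.
    by apply: integral_fune_fin_num => //; exact: loc_integrable.
  have cv : cvgn (series (fun k => 9 * 4^-1 ^+ k : R)).
    apply: is_cvg_geometric_series.
    by rewrite ger0_norm ?invr_ge0 // invf_lt1 // ltr1n.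
  rewrite (_ : (\sum_(k <oo) _)%E =
    (limn (series (fun k => 9 * 4^-1 ^+ k : R)))%:E) ?ltry //.
  rewrite -EFin_lim //; apply: congr_lim; apply/funext => n /=.
  by rewrite /series /= sumEFin.
have := integrable_ae measurableT ih.
apply: filterS => x /(_ I) fin.
have cg : cvgn (series (fun k => g k x)).
  apply: nondecreasing_is_cvgn.
    by apply/nondecreasing_seqP => n; rewrite /series /= big_nat_recr //= lerDl.
  exists (fine (h x)) => _ [n _ <-]; rewrite -lee_fin fineK // /series /= -sumEFin.
  by apply: nneseries_lim_ge => k _ _; rewrite lee_fin.
have cgeo : cvgn (series (fun k => 1 * 2^-1 ^+ k : R)).
  apply: is_cvg_geometric_series.
  by rewrite ger0_norm ?invr_ge0 // invf_lt1 // ltr1n.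
pose u k := Z k.+1 x - Z k x.
(* With [v = 2^n * |z|] this is [v <= 1 + v^2], divided by [2^n]. *)
have H n : `|u n| <= 1 * 2^-1 ^+ n + g n x.
  rewrite mul1r /u distrC /g; set z := Z n x - Z n.+1 x.
  have p0 : 0 < 2 ^+ n :> R by rewrite exprn_gt0.
  rewrite -(ler_pM2l p0) exprVn -[z ^+ 2](real_normK (num_real z)).
  rewrite mulrDr mulfV ?gt_eqF // mulrA -expr2 -exprMn.
  by move: (_ * `|z|) => v; nra.
have cu : cvgn (series u).
  apply: normed_cvg; apply: (series_le_cvg _ _ _ (is_cvg_seriesD cgeo cg)).
  - by move=> n; exact: normr_ge0.
  - move=> n; apply: addr_ge0; last exact: g_ge0.
    by apply: mulr_ge0 => //; apply: exprn_ge0; rewrite invr_ge0.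
  - exact: H.
have -> : Z ^~ x = fun n => series u n + Z 0%N x.
  apply/funext => n; rewrite (_ : u = telescope (Z ^~ x)) // telescopeK /=.
  by rewrite subrK.
by apply: is_cvgD => //; exact: is_cvg_cst.
Qed.

(** The upper limit is defined and measurable everywhere, and clamping keeps it in [0,1] off the set
    of convergence too; almost everywhere it is the limit. *)
Definition limit_density (x : config) : R := clamp (limn_sup (Z ^~ x)).

Lemma limit_density01 x : 0 <= limit_density x <= 1.
Proof. exact: clamp01. Qed.

Lemma measurable_limit_density : measurable_fun setT limit_density.
Proof.
have mZ : measurable_fun setT (fun x => limn_sup (Z ^~ x)).
  apply: measurable_fun_limn_sup => [x _|x _|n].
  - by exists 1 => _ [n _ <-]; have /andP[] := density01 (8 ^ n) x.
  - by exists 0 => _ [n _ <-]; have /andP[] := density01 (8 ^ n) x.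
  - exact: loc_measurable (loc_density _).
apply: measurable_maxr; first exact: measurable_cst.
by apply: measurable_minr => //; exact: measurable_cst.
Qed.

Let ae_limit : {ae mu, forall x, Z k x @[k --> \oo] --> limit_density x}.
Proof.
move: ae_cvg; apply: filterS => x cv.
suff -> : limit_density x = limn (Z ^~ x) by [].
have lE : limn_sup (Z ^~ x) = limn (Z ^~ x).
  by apply/cvg_lim => //; exact: cvg_sups.
rewrite /limit_density lE clamp_id //; apply/andP; split.
  by apply: limr_ge => //; apply: nearW => n; have /andP[] := density01 (8 ^ n) x.
by apply: limr_le => //; apply: nearW => n; have /andP[] := density01 (8 ^ n) x.
Qed.

(** The mean of [f] is bounded and continuous in the density, so dominated convergence applies along
    [8^k], where [density_cvg] identifies the limit. *)
Lemma E_limit_density f : loc f ->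
  E mu f = E mu (fun x => E (m (limit_density x)) f).
Proof.
move=> lf; have [M [L ML]] := blip_E hm lf.
pose phi d := E (m d) f.
have cphi : continuous phi by apply: blip_continuous; exact: (blip_E hm lf).
have mphi (X : config -> R) : measurable_fun setT X -> measurable_fun setT (phi \o X).
  by move=> mg; apply: measurableT_comp => //; exact: continuous_measurable_fun.
have c1 : (fun k => E mu (fun x => phi (Z k x))) @ \oo --> E mu f.
  have c8 : (fun k => (8 ^ k)%N) @ \oo --> \oo.
    apply/cvgnyPge => A; near=> k; apply: leq_trans (ltnW (ltn_expl k _)) => //.
    by near: k; exact: nbhs_infty_ge.
  exact: (cvg_comp _ _ c8 (density_cvg lf)).
have mk k : measurable_fun setT (fun x => (phi (Z k x))%:E).
  by apply/measurable_EFinP; apply: loc_measurable; exact: loc_E_density.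
have ml : measurable_fun setT (fun x => (phi (limit_density x))%:E).
  by apply/measurable_EFinP; exact: (mphi _ measurable_limit_density).
have cvl : {ae mu, forall x, setT x ->
    (fun k => (phi (Z k x))%:E) @ \oo --> (phi (limit_density x))%:E}.
  move: ae_limit; apply: filterS => x cx _.
  apply: cvg_EFin; first exact: nearW.
  exact: (cvg_comp _ _ cx (cphi _)).
have iM : mu.-integrable setT (cst M%:E).
  exact: (loc_integrable mu (loc_cst M)).
have dom : {ae mu, forall x k, setT x -> (`|(phi (Z k x))%:E| <= cst M%:E x)%E}.
  by apply: aeW => x k _; rewrite lee_fin; have [] := ML (Z k x).
have [ilim _ c2] := dominated_convergence measurableT mk ml cvl iM dom.
have c3 : (fun k => E mu (fun x => phi (Z k x))) @ \oo -->
    E mu (fun x => phi (limit_density x)).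
  apply: fine_cvg; rewrite /E /Rintegral fineK //.
  exact: integrable_fin_num ilim.
exact: (cvg_unique _ c1 c3).
Unshelve. all: by end_near. Qed.

End density.

(** * Mixtures *)

Section mixtures.
Context {R : realType}.
Variables (m : R -> probability config R) (rho : probability R R).
Hypothesis hm : forall d, 0 <= d <= 1 -> markov_windows d (m d).
Hypothesis rho1 : rho `[0, 1]%classic = 1%E.

Let D : set R := `[0, 1]%classic.

Let mD : measurable D. Proof. exact: measurable_itv. Qed.

Let hm' d : markov_windows (clamp d) (m (clamp d)).
Proof. by apply: hm; exact: clamp01. Qed.

Let in_D d : D d -> 0 <= d <= 1. Proof. by rewrite /D /= in_itv. Qed.

(** [m] is controlled on [0,1] only, so regularity comes from the clamped family, which agrees with
    it there. *)
Lemma integrable_mixture f : loc f -> rho.-integrable D (EFin \o (fun d => E (m d) f)).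
Proof.
move=> lf; have [M [L ML]] := blip_E hm' lf.
pose phi d := E (m (clamp d)) f.
have cphi : continuous phi by apply: blip_continuous; exact: (blip_E hm' lf).
have mphi : measurable_fun D (fun d => E (m d) f).
  apply: (@eq_measurable_fun _ _ _ _ _ phi).
    by move=> d; rewrite inE => /in_D d01; rewrite /phi clamp_id.
  by apply: measurable_funTS; exact: continuous_measurable_fun.
apply: measurable_bounded_integrable => //.
  by rewrite [X in (X < _)%E](_ : _ = 1%E) ?ltry //; exact: rho1.
exists M; split; first by rewrite num_real.
move=> N MN d /in_D d01 /=; apply: le_trans (ltW MN).
by have [h _] := ML d; rewrite clamp_id in h.
Qed.

Let measurable_cyl_mixture s b : measurable_fun D (fun d => m d (cyl s b)).
Proof.
have l : loc (icyl s b : config -> R) by exists s; exact: dep_icyl.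
have [h _] := integrableP _ _ _ (integrable_mixture l).
by apply: eq_measurable_fun h => d _ /=; rewrite E_icyl.
Qed.

Variable mu : probability config R.

Lemma mixture_ext :
  (forall s b, mu (cyl s b) = \int[rho]_(d in D) m d (cyl s b))%E ->
  forall A, measurable A -> mu A = (\int[rho]_(d in D) m d A)%E.
Proof.
move=> hc A mA.
(* Measurability in [d] is carried along with the identity: the complement and countable union steps
   need it to manipulate the integrals. *)
pose Q (A : set config) := measurable_fun D (fun d => m d A) /\
  mu A = (\int[rho]_(d in D) m d A)%E.
suff : Q A by case.
have i1 : (\int[rho]_(d in D) 1 = 1)%E by rewrite integral_cst // mul1e.
move: A mA; rewrite measurable_configE.
apply: (dynkin_induction (P := Q) measurable_configE setI_closed_cylinders).
- split; first by under eq_fun do rewrite probability_setT; exact: measurable_cst.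
  by under eq_integral do rewrite probability_setT; rewrite probability_setT i1.
- move=> _ [->|[s [b ->]]]; last by split; [exact: measurable_cyl_mixture|exact: hc].
  split; first by under eq_fun do rewrite measure0; exact: measurable_cst.
  by under eq_integral do rewrite measure0; rewrite measure0 integral0.
- move=> A mA [mQ eQ].
  have mC : measurable_fun D (fun d => m d (~` A)).
    under eq_fun do rewrite probability_setC //.
    by apply: emeasurable_funB => //; exact: measurable_cst.
  split=> //.
  have prU (nu : probability config R) : (nu A + nu (~` A) = 1)%E.
    by rewrite probability_setC // addeC subeK // fin_num_measure.
  have := prU mu.
  have : (\int[rho]_(d in D) m d A + \int[rho]_(d in D) m d (~` A) = 1)%E.
    by rewrite -ge0_integralD // -i1; apply: eq_integral => d _; rewrite prU.
  rewrite -eQ => <-.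
  have fA : mu A \is a fin_num by exact: fin_num_measure.
  by rewrite !(addeC (mu A)) => /(congr1 (fun z => z - mu A)%E); rewrite !addeK.
- move=> F mF tF QF.
  have mFd n : measurable_fun D (fun d => m d (F n)) by case: (QF n).
  have mb (nu : probability config R) : nu (\bigcup_k F k) = (\sum_(k <oo) nu (F k))%E.
    by rewrite measure_bigcup //; apply: eq_eseriesl => k; rewrite in_setT.
  split.
    under eq_fun do rewrite mb.
    by apply: (ge0_emeasurable_sum (P := xpredT)).
  under eq_integral do rewrite mb.
  rewrite integral_nneseries // mb.
  by apply: eq_eseriesr => k _; case: (QF k).
Qed.

Hypothesis hmu : forall A, measurable A -> mu A = (\int[rho]_(d in D) m d A)%E.

Lemma E_mixture f : loc f -> E mu f = \int[rho]_(d in D) E (m d) f.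
Proof.
move=> lf; apply: (mono_ind
  (Pr := fun f => E mu f = \int[rho]_(d in D) E (m d) f) _ _ _ lf).
- move=> g h lg lh Hg Hh; rewrite (E_add mu lg lh) Hg Hh.
  rewrite -(RintegralD mD (integrable_mixture lg) (integrable_mixture lh)).
  by apply: eq_Rintegral => d _; rewrite E_add.
- move=> r g lg Hg; rewrite (E_scale mu r lg) Hg.
  rewrite -(RintegralZl r mD (integrable_mixture lg)).
  by apply: eq_Rintegral => d _; rewrite E_scale.
- move=> s; rewrite monoE; apply: EFin_inj.
  rewrite E_icyl hmu; last exact: measurable_cyl.
  have l : loc (icyl s (fun=> true) : config -> R) by exists s; exact: dep_icyl.
  rewrite /Rintegral fineK; last exact: integrable_fin_num (integrable_mixture l).
  by apply: eq_integral => d _; rewrite E_icyl.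
Qed.

Lemma mixture_invariant : translation_invariant mu.
Proof.
apply/translation_invariantP => f lf.
rewrite (E_mixture (@loc_tr _ f 1 lf)) (E_mixture lf).
apply: eq_Rintegral => d; rewrite inE => /in_D d01.
have /translation_invariantP h := markov_windows_invariant (hm d01).
exact: h.
Qed.

Lemma mixture_stationary : stationary mu.
Proof.
have [P fP] := @fair_coins_exist R.
exists P => //; apply/stationaryP => f lf.
have lS : loc (fun x => E P (fun w => f (step x w))).
  by apply: loc2_E; exact: loc_step.
rewrite (E_mixture lS) (E_mixture lf).
apply: eq_Rintegral => d; rewrite inE => /in_D d01.
exact: markov_stationary d01 (hm d01) fP f lf.
Qed.

End mixtures.

Theorem theorem3 (R : realType) (mu : probability config R) :
  (translation_invariant mu /\ stationary mu) <-> markov_mixture mu.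
Proof.
split=> [[imu [P fP smu]]|[m [rho [hm rho1 hmu]]]]; last first.
  have hw d : 0 <= d <= 1 -> markov_windows d (m d).
    by move=> d01; apply/(is_markovP _ d01); exact: hm.
  split; first exact: (mixture_invariant hw rho1 hmu).
  exact: (mixture_stationary hw rho1 hmu).
move: smu => /stationaryP smu.
have [m hm] := @markov_family R.
pose X : config -> R := @limit_density R.
have mX : measurable_fun setT X by exact: measurable_limit_density.
pose mXm := isMeasurableFun.Build _ _ _ _ X mX.
pose Xf : {mfun config >-> R} := HB.pack X mXm.
have X01 x : `[0, 1]%classic (X x) by rewrite /= in_itv; exact: limit_density01.
have preX : X @^-1` `[0, 1]%classic = setT.
  by apply/seteqP; split => x // _; exact: X01.
pose rho : probability R R := distribution mu Xf.
have rho1 : rho `[0, 1]%classic = 1%E.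
  by rewrite /rho /= /distribution /pushforward /= preX probability_setT.
have hw d : 0 <= d <= 1 -> markov_windows d (m d).
  by move=> d01; have := hm d; rewrite clamp_id.
exists m, rho; split=> // [d d01|].
  by apply/(is_markovP _ d01); exact: hw.
apply: mixture_ext => // s b.
have l : loc (icyl s b : config -> R) by exists s; exact: dep_icyl.
rewrite -E_icyl (E_limit_density hm fP imu smu l).
have il := integrable_mixture hw rho1 l.
transitivity (\int[rho]_(d in `[0%R, 1%R]) (E (m d) (icyl s b))%:E)%E; last first.
  by apply: eq_integral => d _; rewrite E_icyl.
(* Change of variables: [rho] is the image of [mu] under the limiting density, which takes all its
   values in [0,1]. *)
have eqI : (\int[rho]_(d in `[0%R, 1%R]) (E (m d) (icyl s b))%:E =
    \int[mu]_x (E (m (X x)) (icyl s b))%:E)%E.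
  rewrite [LHS](ge0_integral_pushforward mX) //.
  - by rewrite preX.
  - by have /integrableP[] := il.
  - by move=> d _; rewrite lee_fin; apply: E_ge0 => x; rewrite ler0n.
rewrite eqI [in LHS]/E /Rintegral fineK //.
by rewrite -eqI; exact: integrable_fin_num il.
Qed.
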